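(* Let $f,g:\mathbb{R}^{d_x}\times\mathbb{R}^{d_y}\to\mathbb{R}$ be such that: $g(x,y)$ is $\mu$-strongly convex in $y$, has $L_g$-Lipschitz gradient and $\rho_g$-Lipschitz Hessian; $f(x,y)$ is $C_f$-Lipschitz in $y$, has $L_f$-Lipschitz gradient and is twice continuously differentiable; and $\varphi(x)=f(x,y^*(x))$, with $y^*(x)=\arg\min_y g(x,y)$, satisfies $\inf_x\varphi(x)>-\infty$. Suppose gradients are accessed through unbiased stochastic estimators $\nabla f(x,y;\phi_f)$, $\nabla g(x,y;\phi_g)$ with $$\mathbb{E}\|\nabla f(x,y;\phi_f)-\nabla f(x,y)\|^2\le\sigma_f^2,\qquad \mathbb{E}\|\nabla g(x,y;\phi_g)-\nabla g(x,y)\|^2\le\sigma_g^2 .$$ Let $\ell=\max\{C_f,L_f,L_g,\rho_g\}$, $\kappa=\ell/\mu$, $\Delta:=\varphi(x_0)-\inf_x\varphi(x)$ and $R:=\|y_0-y^*(x_0)\|^2$. Let $\eta_x\asymp\ell^{-1}\kappa^{-3}$, $\lambda\asymp\max\{\kappa/R,\ \ell\kappa^2/\Delta,\ \ell\kappa^3/\epsilon\}$ and set $$\eta_z=\eta_y=\frac{1}{2\lambda L_g},\quad K_t=\tilde{\mathcal{O}}\Big(\frac{L_g\log\delta_t}{\mu}\Big),\quad B_{\rm out}\asymp\frac{\sigma_f^2+\lambda^2\sigma_g^2}{\epsilon^2},\quad B_{\rm in}\asymp\frac{L_f^2+\lambda^2L_g^2}{\lambda^2\mu^2}\cdot B_{\rm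 out},$$ where $\delta_t$ is defined by $$\delta_{t+1}=\frac12\delta_t+\frac{34L_g^2}{\mu^2}\|x_{t+1}-x_t\|^2+\frac{\sigma_g^2}{2L_gB_{\rm in}},\qquad \delta_0=\mathcal{O}(R).$$ Then the algorithm F$^2$BSA (defined in the context) started at $(x_0,y_0)$ can output a point $x$ such that $\mathbb{E}\|\nabla\varphi(x)\|\le\epsilon$ within $T=\mathcal{O}(\ell\kappa^3\epsilon^{-2})$ iterations. The total number of stochastic first-order oracle calls is bounded by $$\begin{cases}\mathcal{O}(\ell\kappa^6\epsilon^{-4}\log(\ell\kappa/\epsilon)), & \sigma_f>0,\ \sigma_g=0;\\ \mathcal{O}(\ell^3\kappa^{12}\epsilon^{-6}\log(\ell\kappa/\epsilon)), & \sigma_f>0,\ \sigma_g>0.\end{cases}$$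
   Context: Lipschitz continuity of gradient/Hessian is with respect to the joint variable $(x,y)$. Under these hypotheses $\varphi$ is differentiable. For a batch size $B$, write $\nabla f(x,y;B)=\frac1B\sum_{i=1}^B\nabla f(x,y;\phi_f^{(i)})$ and $\nabla g(x,y;B)=\frac1B\sum_{i=1}^B\nabla g(x,y;\phi_g^{(i)})$, with $\phi_f^{(i)},\phi_g^{(i)}$ drawn i.i.d. afresh each time; partial gradients are defined likewise. A stochastic first-order oracle call is one evaluation of a stochastic gradient of $f$ or $g$. Algorithm F$^2$BSA$(x_0,y_0)$: set $z_0=y_0$. For $t=0,\dots,T-1$: set $y_t^0=y_t$, $z_t^0=z_t$; for $k=0,\dots,K_t-1$ do $z_t^{k+1}=z_t^k-\eta_z\lambda\nabla_yg(x_t,z_t^k;B_{\rm in})$ and $y_t^{k+1}=y_t^k-\eta_y\big(\nabla_yf(x_t,y_t^k;B_{\rm in})+\lambda\nabla_yg(x_t,y_t^k;B_{\rm in})\big)$; then set $z_{t+1}=z_t^{K_t}$, $y_{t+1}=y_t^{K_t}$, $G_t=\nabla_xf(x_t,y_t^{K_t};B_{\rm out})+\lambda\big(\nabla_xg(x_t,y_t^{K_t};B_{\rm out})-\nabla_xg(x_t,z_t^{K_t};B_{\rm out})\big)$ and $x_{t+1}=x_t-\eta_xG_t$. $\mathcal{O}(\cdot)$ means an upper bound up to a constant factor, $\asymp$ equality up to constant factors, and $\tilde{\mathcal{O}}$ additionally hides logarithmic factors; the statement asserts that the hidden constants/logarithmic factors in the parameter choices can be chosen so that the conclusion holds. In the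 complexity bounds $\Delta,R,\sigma_f,\sigma_g$ are treated as constants.
   Formalization: Proved for ε ≤ min(1,ℓ)/2 (the call bound fails for large ε, where log(ℓκ/ε) ≤ 0), and the total number of oracle calls is bounded in expectation, since K_t is random and can be unbounded. *)

(* Defs.v *)
From HB Require Import structures.
From mathcomp Require Import all_boot all_order all_algebra.
From mathcomp Require Import all_classical all_reals all_analysis.

Set Implicit Arguments.
Unset Strict Implicit.
Unset Printing Implicit Defensive.

Import Order.TTheory GRing.Theory Num.Theory.
Import numFieldNormedType.Exports.

Local Open Scope classical_set_scope.
Local Open Scope ring_scope.

(* Conventions.  A point of R^dx x R^dy is a row vector [row_mx x y] of length
   dx + dy; the partial gradients in x and y of a function of the joint variable
   are the blocks [lsubmx] and [rsubmx] of its gradient.  The norm that the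
   library puts on matrices is the sup norm, which yields the intended notions
   of continuity and differentiability; all quantitative assumptions use the
   Euclidean norm [enorm]. *)

Section Calculus.
Context {R : realType}.

Definition enorm n (v : 'rV[R]_n) : R := Num.sqrt (\sum_(i < n) v 0 i ^+ 2).

(* Euclidean operator norm of v |-> v *m A. *)
Definition opnorm n m (A : 'M[R]_(n, m)) : R :=
  sup [set enorm (v *m A) | v in [set v : 'rV[R]_n | enorm v <= 1]].

Definition grad n (F : 'rV[R]_n -> R) (u : 'rV[R]_n) : 'rV[R]_n :=
  \row_(j < n) 'D_(delta_mx 0 j) F u.

Definition hess n (F : 'rV[R]_n -> R) (u : 'rV[R]_n) : 'M[R]_n :=
  jacobian (grad F) u.

Definition lipschitz_grad n (L : R) (F : 'rV[R]_n -> R) : Prop :=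
  (forall u, differentiable F u) /\
  (forall u v, enorm (grad F u - grad F v) <= L * enorm (u - v)).

Definition twice_differentiable n (F : 'rV[R]_n -> R) : Prop :=
  (forall u, differentiable F u) /\ (forall u, differentiable (grad F) u).

Definition lipschitz_hess n (rho : R) (F : 'rV[R]_n -> R) : Prop :=
  twice_differentiable F /\
  (forall u v, opnorm (hess F u - hess F v) <= rho * enorm (u - v)).

Definition twice_continuously_differentiable n (F : 'rV[R]_n -> R) : Prop :=
  twice_differentiable F /\ continuous (hess F).

Definition lipschitz_in_y dx dy (C : R) (F : 'rV[R]_(dx + dy) -> R) : Prop :=
  forall x y y',
    `|F (row_mx x y) - F (row_mx x y')| <= C * enorm (y - y').

Definition strongly_convex_in_y dx dy (mu : R)
    (F : 'rV[R]_(dx + dy) -> R) : Prop :=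
  forall (x : 'rV[R]_dx) (y y' : 'rV[R]_dy) (s : R), 0 <= s <= 1 ->
    F (row_mx x (s *: y + (1 - s) *: y')) <=
      s * F (row_mx x y) + (1 - s) * F (row_mx x y')
      - mu / 2 * s * (1 - s) * enorm (y - y') ^+ 2.

(* The default value 0 is irrelevant when g is strongly convex in y and
   continuous: the minimizer then exists and is unique. *)
Definition ystar dx dy (g : 'rV[R]_(dx + dy) -> R) (x : 'rV[R]_dx)
    : 'rV[R]_dy :=
  xget 0 [set y | forall y', g (row_mx x y) <= g (row_mx x y')].

Definition hyperobj dx dy (f g : 'rV[R]_(dx + dy) -> R) (x : 'rV[R]_dx) : R :=
  f (row_mx x (ystar g x)).

End Calculus.

Section Oracles.
Context {R : realType}.

(* [G u xi] is the stochastic gradient at the joint point u with sample xi of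
   law Q.  Joint Borel measurability in (u, xi) is phrased through tuples, which
   carry the product sigma-algebra in the library, whereas row vectors carry
   none.  Integrability of [G u] follows from the variance bound. *)
Definition unbiased_oracle d (Xi : measurableType d) n (Q : probability Xi R)
    (G : 'rV[R]_n -> Xi -> 'rV[R]_n) (F : 'rV[R]_n -> R) (sigma : R) : Prop :=
  [/\ forall j, measurable_fun [set: (n.-tuple R * Xi)%type]
        (fun p : n.-tuple R * Xi => G (\row_i tnth p.1 i) p.2 0 j),
      forall u j, ('E_Q[fun xi => G u xi 0%R j] = (grad F u 0%R j)%:E)%E &
      forall u, ('E_Q[fun xi => enorm (G u xi - grad F u) ^+ 2]%R
                 <= (sigma ^+ 2)%:E)%E].

(* One label for every draw that the algorithm can make: outer iteration t,
   inner iteration k (for the inner loop), position i in the mini-batch.  The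
   two outer evaluations of the gradient of g, at y_t^{K_t} and at z_t^{K_t},
   have separate labels since every batch is drawn afresh. *)
Inductive f_slot : Set :=
  | f_inner of nat & nat & nat
  | f_outer of nat & nat.

Inductive g_slot : Set :=
  | g_inner_y of nat & nat & nat
  | g_inner_z of nat & nat & nat
  | g_outer_y of nat & nat
  | g_outer_z of nat & nat.

Definition independent_systems d (W : measurableType d) (P : probability W R)
    (I : Type) (E : I -> set (set W)) : Prop :=
  forall (n : nat) (s : 'I_n -> I), injective s ->
  forall A : 'I_n -> set W, (forall k, E (s k) (A k)) ->
    fine (P (\bigcap_(k in [set: 'I_n]) A k)) = \prod_(k < n) fine (P (A k)).

Definition sample_events d (W : measurableType d)
    df (Xf : measurableType df) dg (Xg : measurableType dg)
    (xif : f_slot -> W -> Xf) (xig : g_slot -> W -> Xg)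
    (s : f_slot + g_slot) : set (set W) :=
  match s with
  | inl a => preimage_set_system setT (xif a) measurable
  | inr b => preimage_set_system setT (xig b) measurable
  end.

Definition has_law d (W : measurableType d) d' (X : measurableType d')
    (P : probability W R) (Q : probability X R) (xi : W -> X) : Prop :=
  measurable_fun setT xi /\
  forall A, measurable A -> P (xi @^-1` A) = Q A.

(* All draws are mutually independent, with law Qf for f and Qg for g. *)
Definition iid_samples d (W : measurableType d)
    df (Xf : measurableType df) dg (Xg : measurableType dg)
    (P : probability W R) (Qf : probability Xf R) (Qg : probability Xg R)
    (xif : f_slot -> W -> Xf) (xig : g_slot -> W -> Xg) : Prop :=
  [/\ forall a, has_law P Qf (xif a),
      forall b, has_law P Qg (xig b) &
      independent_systems P (sample_events xif xig)].

End Oracles.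

Section Algorithm.
Context {R : realType}.

Record f2bsa_params := F2BSAParams {
  eta_x : R; eta_y : R; eta_z : R;
  lam : R;
  B_in : nat; B_out : nat;
  inner_steps : R -> nat;         (* K_t as a function of delta_t *)
  delta0 : R;
  delta_next : R -> R -> R        (* of delta_t and |x_{t+1} - x_t| *)
}.

Definition batch_mean n (B : nat) (h : nat -> 'rV[R]_n) : 'rV[R]_n :=
  B%:R^-1 *: \sum_(i < B) h i.

Record f2bsa_state (dx dy : nat) := F2BSAState {
  st_x : 'rV[R]_dx;
  st_y : 'rV[R]_dy;
  st_z : 'rV[R]_dy;
  st_delta : R;
  st_calls : nat                  (* oracle calls made so far *)
}.

Variables (dx dy : nat) (Xf Xg : Type).
Variables (Gf : 'rV[R]_(dx + dy) -> Xf -> 'rV[R]_(dx + dy)).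
Variables (Gg : 'rV[R]_(dx + dy) -> Xg -> 'rV[R]_(dx + dy)).
Variable p : f2bsa_params.
(* The values taken by all the draws, i.e. one realization of the randomness. *)
Variables (sf : f_slot -> Xf) (sg : g_slot -> Xg).

Fixpoint inner_z (t : nat) (x : 'rV[R]_dx) (z : 'rV[R]_dy) (k : nat)
    : 'rV[R]_dy :=
  if k is k'.+1 then
    let zk := inner_z t x z k' in
    zk - (eta_z p * lam p) *:
      batch_mean (B_in p)
        (fun i => rsubmx (Gg (row_mx x zk) (sg (g_inner_z t k' i))))
  else z.

Fixpoint inner_y (t : nat) (x : 'rV[R]_dx) (y : 'rV[R]_dy) (k : nat)
    : 'rV[R]_dy :=
  if k is k'.+1 then
    let yk := inner_y t x y k' in
    yk - eta_y p *:
      (batch_mean (B_in p)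
         (fun i => rsubmx (Gf (row_mx x yk) (sf (f_inner t k' i))))
       + lam p *: batch_mean (B_in p)
         (fun i => rsubmx (Gg (row_mx x yk) (sg (g_inner_y t k' i)))))
  else y.

Definition outer_grad (t : nat) (x : 'rV[R]_dx) (y z : 'rV[R]_dy)
    : 'rV[R]_dx :=
  batch_mean (B_out p) (fun i => lsubmx (Gf (row_mx x y) (sf (f_outer t i))))
  + lam p *:
    (batch_mean (B_out p)
       (fun i => lsubmx (Gg (row_mx x y) (sg (g_outer_y t i))))
     - batch_mean (B_out p)
       (fun i => lsubmx (Gg (row_mx x z) (sg (g_outer_z t i))))).

Definition f2bsa_step (t : nat) (s : f2bsa_state dx dy) : f2bsa_state dx dy :=
  let K := inner_steps p (st_delta s) in
  let x := st_x s in
  let y' := inner_y t x (st_y s) K in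
  let z' := inner_z t x (st_z s) K in
  let x' := x - eta_x p *: outer_grad t x y' z' in
  {| st_x := x';
     st_y := y';
     st_z := z';
     st_delta := delta_next p (st_delta s) (enorm (x' - x));
     (* per inner iteration: one batch for z (g), two for y (f and g);
        per outer iteration: one batch of f, two of g *)
     st_calls := (st_calls s + K * (B_in p + (B_in p + B_in p))
                  + (B_out p + (B_out p + B_out p)))%N |}.

(* The state at the beginning of outer iteration t. *)
Fixpoint f2bsa (x0 : 'rV[R]_dx) (y0 : 'rV[R]_dy) (t : nat)
    : f2bsa_state dx dy :=
  if t is t'.+1 then f2bsa_step t' (f2bsa x0 y0 t')
  else {| st_x := x0; st_y := y0; st_z := y0;
          st_delta := delta0 p; st_calls := 0%N |}.

End Algorithm.

Section ParamChoice.
Context {R : realType}.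

Definition nat_ceil (a : R) : nat := `|Num.ceil a|%N.

Definition batch_size (a : R) : nat := maxn 1 (nat_ceil a).

(* The hidden constants of the parameter choices. *)
Record hidden_consts := HiddenConsts {
  c_eta : R; c_lam : R; c_out : R; c_in : R; c_del : R; c_K : R; c_log : R
}.

Definition hidden_consts_pos (c : hidden_consts) : Prop :=
  [/\ 0 < c_eta c, 0 < c_lam c, 0 < c_out c & 0 < c_in c] /\
  [/\ 0 < c_del c, 0 < c_K c & 0 < c_log c].

(* Here [Delta] is phi(x0) - inf phi and [R0] is |y0 - y*(x0)|^2.  Batch sizes
   are rounded up to positive integers.  The number of inner steps is
   O~(Lg log(delta_t) / mu): the hidden logarithmic factor is spelled out as the
   coefficient of delta_t inside the logarithm, and the summand e keeps the
   logarithm at least 1. *)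
Definition f2bsa_choice (c : hidden_consts)
    (Cf Lf Lg rhog mu sigmaf sigmag Delta R0 eps : R) : f2bsa_params :=
  let ell := Num.max Cf (Num.max Lf (Num.max Lg rhog)) in
  let kappa := ell / mu in
  let lambda := c_lam c *
    Num.max (kappa / R0)
      (Num.max (ell * kappa ^+ 2 / Delta) (ell * kappa ^+ 3 / eps)) in
  let Bout := batch_size
    (c_out c * ((sigmaf ^+ 2 + lambda ^+ 2 * sigmag ^+ 2) / eps ^+ 2)) in
  let Bin := batch_size
    (c_in c * ((Lf ^+ 2 + lambda ^+ 2 * Lg ^+ 2) / (lambda ^+ 2 * mu ^+ 2)
               * Bout%:R)) in
  {| eta_x := c_eta c / (ell * kappa ^+ 3);
     eta_y := (2 * lambda * Lg)^-1;
     eta_z := (2 * lambda * Lg)^-1;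
     lam := lambda;
     B_in := Bin;
     B_out := Bout;
     inner_steps := fun delta =>
       nat_ceil (c_K c * (Lg / mu)
         * ln (expR 1 + c_log c * (lambda * ell / eps) ^+ 2 * delta));
     delta0 := c_del c * R0;
     delta_next := fun delta dist =>
       delta / 2 + 34 * Lg ^+ 2 / mu ^+ 2 * dist ^+ 2
       + sigmag ^+ 2 / (2 * Lg * Bin%:R) |}.

End ParamChoice.

(* Main.v *)
(** Write [y_lam x] for the minimizer of [g + f / lam] in [y].  The combination
    [grad_x f + lam (grad_x g(x, y_lam x) - grad_x g(x, y^* x))] differs from
    [grad phi x] by [O(l kappa^3 / lam)], and [phi] has a first-order expansion with
    remainder [2 l kappa^3 |x' - x|^2], so [x] performs an inexact gradient descent.

    Conditionally on the past, every inner step contracts the squared distance to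
    [y_lam x_t] (resp. [y^* x_t]) by [1 - mu / (4 Lg)] up to mini-batch noise.  The
    number of steps [K_t] is random, but it depends on the past only; its dependence
    on [delta_t] makes the total contraction beat both the factor 1/4 and the
    displacement [|x_{t+1} - x_t|^2] recorded in [delta_t], so the expected inner
    error stays [O(noise + eps^2)] without a bound on the displacement.

    Telescoping the descent inequality bounds the sums of [E |grad phi x_t|^2] and of
    [E |x_{t+1} - x_t|^2].  The first gives stationarity, the second bounds the sum of
    [E delta_t] and hence, the logarithm being concave, the expected number of
    inner steps. *)

Require Import Defs.
From HB Require Import structures.
From mathcomp Require Import all_boot all_order all_algebra.
From mathcomp Require Import all_classical all_reals all_analysis.
From mathcomp Require Import measurable_realfun.
From mathcomp Require Import ring lra zify.

Import Order.TTheory GRing.Theory Num.Theory.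
Import numFieldNormedType.Exports.

Local Open Scope classical_set_scope.
Local Open Scope ring_scope.

Set Implicit Arguments.
Unset Strict Implicit.
Unset Printing Implicit Defensive.

(** * Euclidean norm *)

(** No conditional expectation is formed. Each noise estimate is an inequality between integrals
    over an arbitrary event of the past; it is applied on every event [K_t = k] and summed over [k].
    All integrands are nonnegative and integrals are extended reals, so no moment of the iterates
    has to be known beforehand.

    The gradient of phi is not obtained from an implicit function theorem: the expected formula is
    shown to satisfy a two-sided quadratic expansion, which also yields continuity and the Lipschitz
    bound needed for measurability.

    Inner errors enter the gradient error multiplied by [(lam * Lg)^2]. This is why the logarithm in
    [K_t] contains [(lam * ell / eps)^2]: the inner tolerance is the inverse of that quantity, up to
    256, and the product is of order [eps^2]. For the cost, the logarithm is compared with its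
    tangent at [(ell * kappa / eps)^6], an exponent large enough to absorb the powers of kappa
    coming from [lam^2]. *)

Section Euclidean.
Context {R : realType}.

Definition dot n (u v : 'rV[R]_n) : R := \sum_(i < n) u 0 i * v 0 i.

Lemma dotC n (u v : 'rV[R]_n) : dot u v = dot v u.
Proof. by apply: eq_bigr => i _; rewrite mulrC. Qed.

Lemma dotDl n (u v w : 'rV[R]_n) : dot (u + v) w = dot u w + dot v w.
Proof.
by rewrite /dot -big_split/=; apply: eq_bigr => i _; rewrite mxE mulrDl.
Qed.

Lemma dotZl n a (u v : 'rV[R]_n) : dot (a *: u) v = a * dot u v.
Proof.
by rewrite /dot mulr_sumr; apply: eq_bigr => i _; rewrite mxE mulrA.
Qed.

Lemma dotDr n (u v w : 'rV[R]_n) : dot u (v + w) = dot u v + dot u w.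
Proof. by rewrite dotC dotDl !(dotC u). Qed.

Lemma dotZr n a (u v : 'rV[R]_n) : dot u (a *: v) = a * dot u v.
Proof. by rewrite dotC dotZl dotC. Qed.

Lemma dotNl n (u v : 'rV[R]_n) : dot (- u) v = - dot u v.
Proof. by rewrite -scaleN1r dotZl mulN1r. Qed.

Lemma dotNr n (u v : 'rV[R]_n) : dot u (- v) = - dot u v.
Proof. by rewrite dotC dotNl dotC. Qed.

Lemma dotBl n (u v w : 'rV[R]_n) : dot (u - v) w = dot u w - dot v w.
Proof. by rewrite dotDl dotNl. Qed.

Lemma dotBr n (u v w : 'rV[R]_n) : dot u (v - w) = dot u v - dot u w.
Proof. by rewrite dotDr dotNr. Qed.

Lemma dot0l n (v : 'rV[R]_n) : dot 0 v = 0.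
Proof. by rewrite -(scale0r v) dotZl mul0r. Qed.

Lemma dot0r n (v : 'rV[R]_n) : dot v 0 = 0.
Proof. by rewrite dotC dot0l. Qed.

Lemma enorm_sqr n (v : 'rV[R]_n) : enorm v ^+ 2 = dot v v.
Proof.
by rewrite /enorm sqr_sqrtr ?sumr_ge0// => i _; exact: sqr_ge0.
Qed.

Lemma enorm_ge0 n (v : 'rV[R]_n) : 0 <= enorm v.
Proof. exact: sqrtr_ge0. Qed.
Hint Resolve enorm_ge0 : core.

Lemma enorm0 n : enorm (0 : 'rV[R]_n) = 0.
Proof. by apply/eqP; rewrite -sqrf_eq0 enorm_sqr dot0l. Qed.

Lemma enormZ n a (v : 'rV[R]_n) : enorm (a *: v) = `|a| * enorm v.
Proof.
apply/eqP; rewrite -(eqrXn2 (n := 2))// ?mulr_ge0//.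
by rewrite exprMn !enorm_sqr dotZl dotZr mulrA -expr2 real_normK// num_real.
Qed.

Lemma enormN n (v : 'rV[R]_n) : enorm (- v) = enorm v.
Proof. by rewrite -scaleN1r enormZ normrN1 mul1r. Qed.

Lemma enormB n (u v : 'rV[R]_n) : enorm (u - v) = enorm (v - u).
Proof. by rewrite -enormN opprB. Qed.

Lemma enormD_sqr n (u v : 'rV[R]_n) :
  enorm (u + v) ^+ 2 = enorm u ^+ 2 + 2 * dot u v + enorm v ^+ 2.
Proof. by rewrite !enorm_sqr dotDl !dotDr (dotC v u); ring. Qed.

Lemma enormB_sqr n (u v : 'rV[R]_n) :
  enorm (u - v) ^+ 2 = enorm u ^+ 2 - 2 * dot u v + enorm v ^+ 2.
Proof. by rewrite enormD_sqr dotNr enormN; ring. Qed.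

Lemma enorm_eq0 n (v : 'rV[R]_n) : enorm v = 0 -> v = 0.
Proof.
move=> v0; have : dot v v = 0 by rewrite -enorm_sqr v0 expr0n.
move=> /eqP; rewrite psumr_eq0; last by move=> i _; rewrite -expr2 sqr_ge0.
move=> /allP h; apply/rowP => i; rewrite mxE.
by have := h i (mem_index_enum _); rewrite mulf_eq0 orbb => /eqP.
Qed.

(** Cauchy-Schwarz: expand the square of [enorm v *: u - enorm u *: v] and divide by
    [2 * enorm u * enorm v]. *)
Lemma dot_le n (u v : 'rV[R]_n) : dot u v <= enorm u * enorm v.
Proof.
have [/enorm_eq0 ->|u0] := eqVneq (enorm u) 0.
  by rewrite dot0l mulr_ge0.
have [/enorm_eq0 ->|v0] := eqVneq (enorm v) 0.
  by rewrite dot0r mulr_ge0.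
have up : 0 < enorm u by rewrite lt_def u0 enorm_ge0.
have vp : 0 < enorm v by rewrite lt_def v0 enorm_ge0.
have : 0 <= enorm (enorm v *: u - enorm u *: v) ^+ 2 by rewrite sqr_ge0.
rewrite enormB_sqr !enormZ !ger0_norm// dotZl dotZr => h.
have {h} : 0 <= 2 * (enorm u * enorm v) * (enorm u * enorm v - dot u v).
  by move: h; congr (_ <= _); ring.
by rewrite pmulr_rge0 ?subr_ge0// !mulr_gt0.
Qed.

Lemma dot_abs n (u v : 'rV[R]_n) : `|dot u v| <= enorm u * enorm v.
Proof.
by rewrite ler_norml dot_le andbT lerNl -dotNl -[enorm u]enormN dot_le.
Qed.

Lemma enormD n (u v : 'rV[R]_n) : enorm (u + v) <= enorm u + enorm v.
Proof.
rewrite -ler_sqr ?nnegrE ?addr_ge0// enormD_sqr.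
by have := dot_le u v; nra.
Qed.

Lemma enormD_sqr_le n (u v : 'rV[R]_n) :
  enorm (u + v) ^+ 2 <= 2 * enorm u ^+ 2 + 2 * enorm v ^+ 2.
Proof.
have := sqr_ge0 (enorm (u - v)); rewrite enormB_sqr enormD_sqr; lra.
Qed.

Lemma dot_row_mx n m (x x' : 'rV[R]_n) (y y' : 'rV[R]_m) :
  dot (row_mx x y) (row_mx x' y') = dot x x' + dot y y'.
Proof.
rewrite /dot big_split_ord/=; congr (_ + _); apply: eq_bigr => i _.
  by rewrite !row_mxEl.
by rewrite !row_mxEr.
Qed.

Lemma enorm_row_mx n m (x : 'rV[R]_n) (y : 'rV[R]_m) :
  enorm (row_mx x y) ^+ 2 = enorm x ^+ 2 + enorm y ^+ 2.
Proof. by rewrite !enorm_sqr dot_row_mx. Qed.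

Lemma enorm_row_mx0 n m (x : 'rV[R]_n) :
  enorm (row_mx x (0 : 'rV[R]_m)) = enorm x.
Proof.
by apply/eqP; rewrite -(eqrXn2 (n := 2))// enorm_row_mx enorm0 expr0n addr0.
Qed.

Lemma enorm_row_0mx n m (y : 'rV[R]_m) :
  enorm (row_mx (0 : 'rV[R]_n) y) = enorm y.
Proof.
by apply/eqP; rewrite -(eqrXn2 (n := 2))// enorm_row_mx enorm0 expr0n add0r.
Qed.

Lemma enorm_lsubmx n m (v : 'rV[R]_(n + m)) : enorm (lsubmx v) <= enorm v.
Proof.
rewrite -ler_sqr ?nnegrE// -{2}[v]hsubmxK enorm_row_mx lerDl.
by rewrite sqr_ge0.
Qed.

Lemma enorm_rsubmx n m (v : 'rV[R]_(n + m)) : enorm (rsubmx v) <= enorm v.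
Proof.
rewrite -ler_sqr ?nnegrE// -{2}[v]hsubmxK enorm_row_mx lerDr.
by rewrite sqr_ge0.
Qed.

Lemma dot_lsubmx n m (v : 'rV[R]_(n + m)) (x : 'rV[R]_n) :
  dot (lsubmx v) x = dot v (row_mx x 0).
Proof. by rewrite -{2}[v]hsubmxK dot_row_mx dot0r addr0. Qed.

Lemma dot_rsubmx n m (v : 'rV[R]_(n + m)) (y : 'rV[R]_m) :
  dot (rsubmx v) y = dot v (row_mx 0 y).
Proof. by rewrite -{2}[v]hsubmxK dot_row_mx dot0r add0r. Qed.

Lemma dot_delta n (v : 'rV[R]_n) j : dot v (delta_mx 0 j) = v 0 j.
Proof.
rewrite /dot (bigD1 j)//= mxE !eqxx mulr1 big1 ?addr0// => i ij.
by rewrite mxE (negbTE ij) andbF mulr0.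
Qed.

Lemma enorm_delta n j : enorm (delta_mx 0 j : 'rV[R]_n) = 1.
Proof.
apply/eqP; rewrite -(eqrXn2 (n := 2))// enorm_sqr dot_delta.
by rewrite mxE !eqxx expr1n.
Qed.

Lemma coord_le_enorm n (v : 'rV[R]_n) i : `|v 0 i| <= enorm v.
Proof.
by rewrite -dot_delta (le_trans (dot_abs _ _))// enorm_delta mulr1.
Qed.

(** Testing with [u = v] suffices. This reduces bounds on vector remainders to scalar functions on a
    segment. *)
Lemma enorm_dual n (v : 'rV[R]_n) C : 0 <= C ->
  (forall u, dot v u <= C * enorm u) -> enorm v <= C.
Proof.
move=> C0 h; have [->//|v0] := eqVneq (enorm v) 0.
have vp : 0 < enorm v by rewrite lt_def v0 enorm_ge0.
by have := h v; rewrite -enorm_sqr expr2 ler_pM2r.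
Qed.

End Euclidean.
#[global] Hint Extern 0 (is_true (0 <= enorm _)) => exact: enorm_ge0 : core.

(** * Taylor bounds *)

Section Calculus.
Context {R : realType}.
Implicit Types (n : nat).

Lemma derive_dot n (F : 'rV[R]_n -> R) u d :
  differentiable F u -> 'D_d F u = dot (grad F u) d.
Proof.
move=> dF; rewrite deriveE// {1}(row_sum_delta d) linear_sum/=.
by apply: eq_bigr => i _; rewrite linearZ/= mxE deriveE// mulrC.
Qed.

(** Both difference quotients coincide as functions of [h]. Values in a normed module are allowed so
    that the lemma also applies to [grad F]. *)
Lemma is_derive_line (V : normedModType R) n (F : 'rV[R]_n -> V) u d (s : R) :
  (forall v, differentiable F v) ->
  is_derive s 1 (fun t => F (u + t *: d)) ('D_d F (u + s *: d)).
Proof.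
move=> dF.
have E : (fun h : R => h^-1 *: (((fun t => F (u + t *: d)) \o shift s) (h *: 1)
     - F (u + s *: d))) =
   (fun h => h^-1 *: ((F \o shift (u + s *: d)) (h *: d) - F (u + s *: d))).
  apply/funext => h /=; congr (_ *: (F _ - _)).
  rewrite [_ *: 1]mulr1 scalerDl addrCA addrA addrC.
  by rewrite addrCA addrA addrC addrA.
apply: DeriveDef; first by rewrite /derivable E; exact: diff_derivable.
by rewrite /derive E.
Qed.

Lemma is_derive_lineR n (F : 'rV[R]_n -> R) u d (s : R) :
  (forall v, differentiable F v) ->
  is_derive s 1 (fun t => F (u + t *: d)) (dot (grad F (u + s *: d)) d).
Proof. by move=> dF; rewrite -derive_dot//; exact: is_derive_line. Qed.

Lemma is_derive_cont (psi dpsi : R -> R) :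
  (forall s : R, is_derive s 1 psi (dpsi s)) -> continuous psi.
Proof.
by move=> h s; apply/differentiable_continuous/derivable1_diffP; have [] := h s.
Qed.

(** The mean value theorem for [psi s - c * s - L / 2 * s ^+ 2], whose derivative is nonpositive on
    the unit interval, replaces an integration of the derivative bound. *)
Lemma increment_le (psi dpsi : R -> R) c L :
  (forall s : R, is_derive s 1 psi (dpsi s)) ->
  (forall s : R, 0 <= s <= 1 -> dpsi s <= c + L * s) ->
  psi 1 - psi 0 <= c + L / 2.
Proof.
move=> dp h.
pose chi := fun s : R => psi s - c * s - L / 2 * (s * s).
have dchi (s : R) : is_derive s 1 chi (dpsi s - c - L * s).
  have d := dp s; apply: is_derive_eq.
  by rewrite /GRing.scale/=; field.
have [//|xi xi01 E] := @MVT_segment R chi _ 0 1 ler01 (fun s _ => dchi s).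
  by apply: continuous_subspaceT; exact: is_derive_cont dchi.
have := h xi; rewrite in_itv/= in xi01; rewrite xi01 => /(_ isT) hxi.
by move: E; rewrite /chi; lra.
Qed.

Lemma increment_abs (psi dpsi : R -> R) c L :
  (forall s : R, is_derive s 1 psi (dpsi s)) ->
  (forall s : R, 0 <= s <= 1 -> `|dpsi s - c| <= L * s) ->
  `|psi 1 - psi 0 - c| <= L / 2.
Proof.
move=> dp h.
have h1 : psi 1 - psi 0 <= c + L / 2.
  apply: (increment_le dp) => s s01.
  by have := h s s01; rewrite ler_norml; lra.
have dN (s : R) : is_derive s 1 (- psi) (- dpsi s) by exact: is_deriveN.
have h2 : (- psi) 1 - (- psi) 0 <= - c + L / 2.
  apply: (increment_le dN) => s s01.
  by have := h s s01; rewrite ler_norml; lra.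
by move: h2; rewrite !fctE ler_norml; lra.
Qed.

Lemma lipschitz_grad_taylor n L (F : 'rV[R]_n -> R) u v : lipschitz_grad L F ->
  `|F v - F u - dot (grad F u) (v - u)| <= L / 2 * enorm (v - u) ^+ 2.
Proof.
move=> [dF LF]; set d := v - u.
have := @increment_abs _ _ (dot (grad F u) d) (L * enorm d ^+ 2)
  (fun s => is_derive_lineR u d s dF).
rewrite scale1r scale0r addr0 subrKC mulrAC; apply=> s /andP[s0 s1].
rewrite -dotBl (le_trans (dot_abs _ _))// expr2 mulrA mulrAC.
rewrite ler_wpM2r ?enorm_ge0//; apply: le_trans (LF _ _) _.
by rewrite addrC addKr enormZ ger0_norm// mulrA mulrAC.
Qed.

Lemma lipschitz_grad_ge0 n L (F : 'rV[R]_n -> R) : (0 < n)%N ->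
  lipschitz_grad L F -> 0 <= L.
Proof.
case: n F => // n F _ [_ /(_ (delta_mx 0 0) 0)].
by rewrite subr0 enorm_delta mulr1; apply: le_trans; exact: enorm_ge0.
Qed.

(** The sum of the norms of the rows is an upper bound; without one the supremum in [opnorm] would
    be a default value. *)
Lemma opnorm_has_sup n m (A : 'M[R]_(n, m)) :
  has_sup [set enorm (v *m A) | v in [set v : 'rV[R]_n | enorm v <= 1]].
Proof.
split; first by exists (enorm ((0 : 'rV_n) *m A)); exists 0 => //=; rewrite enorm0.
exists (\sum_i enorm (row i A)) => _ [v /= v1 <-].
apply: enorm_dual; first by apply: sumr_ge0 => i _; exact: enorm_ge0.
move=> u; rewrite mulmx_sum_row.
have -> : dot (\sum_i v 0 i *: row i A) u = \sum_i v 0 i * dot (row i A) u.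
  elim/big_ind2 : _ => [|_ x _ y <- <-|i _]; first by rewrite dot0l.
    by rewrite dotDl.
  by rewrite dotZl.
rewrite mulr_suml; apply: ler_sum => i _.
apply: le_trans (ler_norm _) _; rewrite normrM.
rewrite -[leRHS]mul1r ler_pM//; last exact: dot_abs.
exact: le_trans (coord_le_enorm _ _) v1.
Qed.

Lemma opnorm_le n m (A : 'M[R]_(n, m)) (v : 'rV[R]_n) :
  enorm (v *m A) <= opnorm A * enorm v.
Proof.
have [v0|v0] := eqVneq (enorm v) 0.
  by rewrite (enorm_eq0 v0) mul0mx !enorm0 mulr0.
have vp : 0 < enorm v by rewrite lt_def v0 enorm_ge0.
rewrite -ler_pdivrMr//.
have -> : enorm (v *m A) / enorm v = enorm (((enorm v)^-1 *: v) *m A).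
  by rewrite -scalemxAl enormZ ger0_norm ?invr_ge0 ?enorm_ge0// mulrC.
apply: sup_upper_bound; first exact: opnorm_has_sup.
by exists ((enorm v)^-1 *: v) => //=; rewrite enormZ ger0_norm ?invr_ge0// mulVf.
Qed.

Lemma is_derive_grad_dot n (F : 'rV[R]_n -> R) u d w (s : R) :
  twice_differentiable F ->
  is_derive s 1 (fun t => dot (grad F (u + t *: d)) w)
    (dot (d *m hess F (u + s *: d)) w).
Proof.
move=> [_ dF].
have [h1 h2] := is_derive_line u d s dF.
rewrite deriveEjacobian// in h2.
have h i : is_derive s 1 (fun t => grad F (u + t *: d) 0 i)
    ((d *m hess F (u + s *: d)) 0 i).
  have /derivable_mxP/(_ 0 i) hi := h1.
  by apply: DeriveDef => //; rewrite -[RHS]/(_ 0 i) /hess -h2 derive_mx// mxE.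
have -> : (fun t => dot (grad F (u + t *: d)) w) =
    \sum_(i < n) (fun t : R => grad F (u + t *: d) 0 i * w 0 i).
  by apply/funext => t; rewrite fct_sumE.
apply: is_derive_sum => i; have hi := h i.
have -> : (fun t : R => grad F (u + t *: d) 0 i * w 0 i) =
  (fun t : R => grad F (u + t *: d) 0 i) * cst (w 0 i) by [].
by apply: is_derive_eq; rewrite scaler0 add0r/= /GRing.scale/= mulrC.
Qed.

(** Tested against [w], the remainder becomes a scalar increment along the segment. The majorant [L]
    of [rho] allows [ell] to be inserted directly later on. *)
Lemma hess_taylor n rho L (F : 'rV[R]_n -> R) u d :
  lipschitz_hess rho F -> rho <= L -> 0 <= L ->
  enorm (grad F (u + d) - grad F u - d *m hess F u) <= L / 2 * enorm d ^+ 2.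
Proof.
move=> [dF rF] rL L0.
apply: enorm_dual => [|w]; first by rewrite mulr_ge0 ?sqr_ge0// divr_ge0.
rewrite !dotBl; apply: le_trans (ler_norm _) _.
have := @increment_abs _ _ (dot (d *m hess F u) w) (L * enorm d ^+ 2 * enorm w)
  (fun s => is_derive_grad_dot u d w s dF).
rewrite scale1r scale0r addr0 => h; apply: le_trans (h _) _; last first.
  by rewrite le_eqVlt; apply/orP; left; apply/eqP; field.
move=> s /andP[s0 s1]; rewrite -dotBl -mulmxBr (le_trans (dot_abs _ _))//.
rewrite [leRHS]mulrAC ler_wpM2r// (le_trans (opnorm_le _ _))//.
rewrite expr2 mulrA mulrAC ler_wpM2r// (le_trans (rF _ _))//.
rewrite addrC addKr enormZ ger0_norm// mulrCA [leRHS]mulrC.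
by rewrite ler_wpM2l// ler_wpM2r.
Qed.

(** The limit [s -> 0] without topology: if [b < a], the choice of [s] below makes [c * s] at most
    half of the gap. It serves wherever an inequality has been divided by a power of [s]. *)
Lemma le_lim0 (a b c : R) : (forall s, 0 < s <= 1 -> a <= b + c * s) -> a <= b.
Proof.
move=> h; have [c0|c0] := leP c 0.
  by have := h 1; rewrite ltr01 lexx => /(_ isT); lra.
rewrite leNgt; apply/negP => ba.
pose s := Num.min 1 ((a - b) / (2 * c)).
have s0 : 0 < s.
  by rewrite lt_min ltr01/= divr_gt0 ?subr_gt0// mulr_gt0.
have s1 : s <= 1 by rewrite ge_min lexx.
have s2 : s <= (a - b) / (2 * c) by rewrite ge_min lexx orbT.
have := h s; rewrite s0 s1 => /(_ isT).
rewrite ler_pdivlMr ?mulr_gt0// in s2; nra.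
Qed.

(** Needed for the bias of the penalty gradient, where the Hessian must be moved from the
    displacement in [y] onto the direction of implicit differentiation. *)
Lemma hess_sym n rho (F : 'rV[R]_n -> R) u a b : lipschitz_hess rho F ->
  dot (a *m hess F u) b = dot (b *m hess F u) a.
Proof.
move=> hF; pose L := Num.max rho 0.
have rL : rho <= L by rewrite le_max lexx.
have L0 : 0 <= L by rewrite le_max lexx orbT.
have [[dF _] _] := hF.
pose N := enorm a + enorm b.
have N0 : 0 <= N by rewrite addr_ge0.
(* The mixed second difference of [F] is symmetric in the two increments and is
   [s ^+ 2 * dot (x *m hess F u) y] up to [O(s ^+ 3)]. *)
pose S x y := F (u + x + y) - F (u + x) - (F (u + y) - F u).
have SC x y : S x y = S y x by rewrite /S (addrAC u x y); ring.
have main x y s : 0 < s <= 1 -> enorm x <= N -> enorm y <= N ->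
    `|S (s *: x) (s *: y) - s ^+ 2 * dot (x *m hess F u) y|
      <= 3 * L * N ^+ 3 * s ^+ 3.
  move=> /andP[s0 s1] xN yN.
  pose psi t := F (u + s *: x + t *: (s *: y)) - F (u + t *: (s *: y)).
  have dpsi (t : R) : is_derive t 1 psi
     (dot (grad F (u + s *: x + t *: (s *: y))) (s *: y) -
      dot (grad F (u + t *: (s *: y))) (s *: y)).
    have d1 := is_derive_lineR (u + s *: x) (s *: y) t dF.
    have d2 := is_derive_lineR u (s *: y) t dF.
    exact: is_deriveB.
  have ES : S (s *: x) (s *: y) = psi 1 - psi 0.
    by rewrite /S /psi !scale1r !scale0r !addr0; ring.
  have cpsi : continuous psi by exact: is_derive_cont dpsi.
  (* The second difference is the increment of [psi], hence a difference of two gradients at a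
     common intermediate [t]; both are then expanded about [u]. *)
  have [//|t] := @MVT_segment R psi _ 0 1 ler01 (fun s _ => dpsi s).
    exact: continuous_subspaceT.
  rewrite in_itv/= => /andP[t0 t1]; rewrite subr0 mulr1 -ES => ->.
  have -> : s ^+ 2 * dot (x *m hess F u) y =
      dot ((s *: x + t *: (s *: y)) *m hess F u) (s *: y) -
      dot ((t *: (s *: y)) *m hess F u) (s *: y).
    by rewrite mulmxDl dotDl addrK -scalemxAl dotZl dotZr; ring.
  set g1 := grad F _; set g2 := grad F _; set w := t *: (s *: y).
  have -> : dot g1 (s *: y) - dot g2 (s *: y) -
     (dot ((s *: x + w) *m hess F u) (s *: y) - dot (w *m hess F u) (s *: y)) =
     dot (g1 - grad F u - (s *: x + w) *m hess F u) (s *: y) -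
     dot (g2 - grad F u - w *m hess F u) (s *: y).
    by rewrite !dotBl; ring.
  have ew : enorm w <= s * N.
    rewrite !enormZ !ger0_norm ?(ltW s0)//.
    rewrite -[leRHS]mul1r ler_pM ?mulr_ge0 ?(ltW s0)//.
    by rewrite ler_wpM2l ?(ltW s0).
  have ex : enorm (s *: x) <= s * N.
    by rewrite enormZ ger0_norm ?ler_wpM2l ?(ltW s0).
  have ey : enorm (s *: y) <= s * N.
    by rewrite enormZ ger0_norm ?ler_wpM2l ?(ltW s0).
  have sN : 0 <= s * N by rewrite mulr_ge0 ?(ltW s0).
  have bnd z c : 0 <= c -> enorm z <= c * (s * N) ->
      `|dot (grad F (u + z) - grad F u - z *m hess F u) (s *: y)| <=
        L / 2 * (c * (s * N)) ^+ 2 * (s * N).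
    move=> c0 ez; apply: le_trans (dot_abs _ _) _; rewrite ler_pM//.
    apply: le_trans (hess_taylor u z hF rL L0) _.
    by rewrite ler_wpM2l ?divr_ge0// ler_sqr// nnegrE ?enorm_ge0// mulr_ge0.
  have h1 : enorm (s *: x + w) <= 2 * (s * N).
    by apply: le_trans (enormD _ _) _; lra.
  have h2 : enorm w <= 1 * (s * N) by rewrite mul1r.
  have := bnd _ _ (ler0n R 2) h1; have := bnd _ _ ler01 h2.
  rewrite addrA -/g1 -/g2 => b2 b1.
  apply: le_trans (ler_normB _ _) _; apply: le_trans (lerD b1 b2) _.
  (* The gradients are taken at distances at most [2 * (s * N)] and [s * N] from [u], so the
     constants add up to [(4 + 1) / 2], rounded up to 3. *)
  have : 0 <= L * (s * N) ^+ 3 by rewrite mulr_ge0// exprn_ge0.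
  have -> : L / 2 * (2 * (s * N)) ^+ 2 * (s * N) + L / 2 * (1 * (s * N)) ^+ 2 * (s * N)
    = (5 / 2) * (L * (s * N) ^+ 3) by field.
  have -> : 3 * L * N ^+ 3 * s ^+ 3 = 3 * (L * (s * N) ^+ 3) by ring.
  lra.
have aN : enorm a <= N by rewrite lerDl.
have bN : enorm b <= N by rewrite lerDr.
apply/eqP; rewrite -subr_eq0 -normr_le0.
apply: (@le_lim0 _ _ (6 * L * N ^+ 3)) => s s01.
have := main a b s s01 aN bN; have := main b a s s01 bN aN.
have /andP[s0 _] := s01.
rewrite SC => h1 h2.
have := le_trans (ler_normB _ _) (lerD h1 h2).
have -> : S (s *: a) (s *: b) - s ^+ 2 * dot (b *m hess F u) a -
  (S (s *: a) (s *: b) - s ^+ 2 * dot (a *m hess F u) b) =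
  s ^+ 2 * (dot (a *m hess F u) b - dot (b *m hess F u) a) by ring.
rewrite normrM gtr0_norm ?exprn_gt0// add0r => h.
rewrite -(ler_pM2l (exprn_gt0 2 s0)); apply: le_trans h _.
by rewrite le_eqVlt; apply/orP; left; apply/eqP; ring.
Qed.

End Calculus.

(** * Functions with a two-sided quadratic expansion *)

Section QuadraticExpansion.
Context {R : realType} {n : nat}.
Variables (F : 'rV[R]_n -> R) (p : 'rV[R]_n -> 'rV[R]_n) (C : R).
Hypothesis hF : forall u v,
  `|F v - F u - dot (p u) (v - u)| <= C * enorm (v - u) ^+ 2.

Lemma expansion_const_ge0 (u : 'rV[R]_n) : (0 < n)%N -> 0 <= C.
Proof.
move=> n0; have := hF u (u + delta_mx 0 (Ordinal n0)).
by rewrite [u + _ - u]addrC addKr enorm_delta expr1n mulr1; apply: le_trans.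
Qed.

(** The difference quotient in a coordinate direction is within [C * |h|] of the coordinate of
    [p u]. *)
Lemma expansion_grad u : grad F u = p u.
Proof.
apply/rowP => j; rewrite mxE /derive; apply: cvg_lim => //.
have n0 : (0 < n)%N by case: n j => [[]|].
have C0 := expansion_const_ge0 u n0.
apply/cvgrPdist_le => e e0.
near=> h; rewrite /= /shift/=.
have h0 : h != 0 by near: h; exact: nbhs_dnbhs_neq.
have := hF u (h *: delta_mx 0 j + u).
rewrite addrK dotZr dot_delta enormZ enorm_delta mulr1 => H.
rewrite distrC /GRing.scale/=.
have -> : h^-1 * (F (h *: delta_mx 0 j + u) - F u) - p u 0 j =
  h^-1 * (F (h *: delta_mx 0 j + u) - F u - h * p u 0 j).
  by rewrite [RHS]mulrBr mulrA mulVf// mul1r.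
rewrite normrM normfV ler_pdivrMl ?normr_gt0//; apply: le_trans H _.
rewrite expr2 mulrA mulrC ler_wpM2l//.
have hs : `|h| <= e / (C + 1).
  near: h; apply: dnbhs0_le; rewrite divr_gt0//; lra.
rewrite ler_pdivlMr in hs; last lra.
by have := normr_ge0 h; nra.
Unshelve. all: by end_near. Qed.

(** Compare the expansions at [u] and at [v] of the value at [u + z], where [z] has the direction of
    [w] and length [r = enorm (u - v)]. The remainders are [C] times [r ^+ 2], [(2 * r) ^+ 2] and
    [r ^+ 2], whence 6. It makes the hypergradient measurable along the run. *)
Lemma expansion_lipschitz u v : enorm (p u - p v) <= 6 * C * enorm (u - v).
Proof.
have [uv|uv] := eqVneq (enorm (u - v)) 0.
  by move/enorm_eq0/eqP: uv; rewrite subr_eq0 => /eqP ->; rewrite !subrr !enorm0 mulr0.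
have r0 : 0 < enorm (u - v) by rewrite lt_def uv/=.
set r := enorm (u - v) in uv r0 *.
have C0 : 0 <= C.
  have := le_trans (normr_ge0 _) (hF v u); rewrite -/r pmulr_lge0// exprn_gt0//.
apply: enorm_dual => [|w]; first by rewrite !mulr_ge0// ltW.
have [w0|w0] := eqVneq (enorm w) 0.
  by rewrite (enorm_eq0 w0) dot0r enorm0 mulr0.
have wp : 0 < enorm w by rewrite lt_def w0/=.
pose z := (r / enorm w) *: w.
have ez : enorm z = r.
  by rewrite enormZ ger0_norm ?divr_ge0 ?(ltW r0)// mulfVK.
have -> : dot (p u - p v) w = (enorm w / r) * dot (p u - p v) z.
  by rewrite /z dotZr; field; rewrite w0 uv.
have h1 := hF u (u + z); have h2 := hF v (u + z); have h3 := hF v u.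
rewrite [u + z - u]addrC addKr ez in h1.
rewrite (addrAC u) dotDr in h2.
have e2 : enorm (u - v + z) ^+ 2 <= (2 * r) ^+ 2.
  rewrite ler_sqr ?nnegrE ?mulr_ge0 ?(ltW r0)//.
  by apply: le_trans (enormD _ _) _; rewrite ez -/r; lra.
have h2' := le_trans h2 (ler_wpM2l C0 e2).
rewrite -/r in h3.
have key : dot (p u - p v) z <= 6 * C * r ^+ 2.
  move: h1 h2' h3; rewrite !ler_norml dotBl; set a := dot _ z.
  rewrite exprMn; move=> /andP[a1 a2] /andP[b1 b2] /andP[c1 c2].
  have : C * (2 ^+ 2 * r ^+ 2) = 4 * (C * r ^+ 2) by ring.
  lra.
have wr : 0 <= enorm w / r by rewrite divr_ge0// ltW.
apply: le_trans (ler_wpM2l wr key) _.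
by rewrite le_eqVlt; apply/orP; left; apply/eqP; field.
Qed.

Lemma expansion_continuous u e : 0 < e ->
  exists2 d, 0 < d & forall v, enorm (v - u) <= d -> `|F v - F u| <= e.
Proof.
move=> e0; pose A := enorm (p u) + `|C| + 1.
have A0 : 0 < A by rewrite ltr_wpDl// addr_ge0.
exists (Num.min 1 (e / A)); first by rewrite lt_min ltr01 divr_gt0.
move=> v; rewrite le_min => /andP[d1 d2].
have := le_trans (ler_normD _ _) (lerD (hF u v) (dot_abs (p u) (v - u))).
rewrite subrK => /le_trans; apply.
rewrite ler_pdivlMr// in d2; apply: le_trans d2.
have E0 := enorm_ge0 (v - u); set E := enorm (v - u) in d1 E0 *.
have : C * E ^+ 2 <= `|C| * E.
  apply: le_trans (ler_norm _) _; rewrite normrM ler_wpM2l//.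
  by rewrite ger0_norm ?exprn_ge0// expr2 ler_piMl.
by rewrite /A; have := normr_ge0 C; nra.
Qed.

End QuadraticExpansion.

Lemma enorm_le_norm {R : realType} n (v : 'rV[R]_n) : enorm v <= n%:R * `|v|.
Proof.
apply: enorm_dual => [|w]; first by rewrite mulr_ge0.
have -> : n%:R * `|v| * enorm w = \sum_(i < n) `|v| * enorm w.
  by rewrite sumr_const card_ord -mulrA mulr_natl.
apply: ler_sum => i _; apply: le_trans (ler_norm _) _.
rewrite normrM ler_pM ?coord_le_enorm//.
by rewrite [leRHS]/Num.Def.normr/= mx_normrE; exact: (le_bigmax _ _ (0, i)).
Qed.

Lemma enorm_continuous {R : realType} n (F : 'rV[R]_n -> R) :
  (forall u e, 0 < e ->
    exists2 d, 0 < d & forall v, enorm (v - u) <= d -> `|F v - F u| <= e) ->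
  continuous F.
Proof.
move=> h u; apply/(@cvgrPdist_le R R^o _ (nbhs u) (nbhs_filter u)) => e e0.
have [d d0 hd] := h u e e0.
have k0 : 0 < (n%:R + 1 : R) by rewrite ltr_wpDl.
apply/nbhs_ballP; exists (d / (n%:R + 1)) => /=; first by rewrite divr_gt0.
move=> v; rewrite -ball_normE/= => uv.
rewrite distrC; apply: hd; rewrite enormB; apply: le_trans (enorm_le_norm _) _.
rewrite ltr_pdivlMr// in uv; apply: le_trans (ltW uv); rewrite mulrC.
by rewrite ler_wpM2l// lerDl.
Qed.

(** * Smooth strongly convex functions: minimizers and gradient steps *)

Section SmoothStronglyConvex.
Context {R : realType} {n : nat}.
Variables (m L : R) (H : 'rV[R]_n -> R) (DH : 'rV[R]_n -> 'rV[R]_n).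

(** The field [DH] is a parameter and not a gradient, so that blocks of gradients of joint functions
    can be used directly. *)
Definition smooth_sc : Prop := forall y y',
  m / 2 * enorm (y' - y) ^+ 2 <= H y' - H y - dot (DH y) (y' - y)
    <= L / 2 * enorm (y' - y) ^+ 2.

Lemma smooth_sc_mono y y' : smooth_sc ->
  m * enorm (y' - y) ^+ 2 <= dot (DH y' - DH y) (y' - y).
Proof.
move=> h; have /andP[h1 _] := h y y'; have /andP[h2 _] := h y' y.
rewrite enormB -(opprB y' y) dotNr in h2; rewrite dotBl; lra.
Qed.

(** A step of length [1 / L] along [- DH y] would otherwise lower the value by at least
    [enorm (DH y) ^+ 2 / (2 * L)]. *)
Lemma smooth_sc_min y : smooth_sc -> 0 < L -> (forall y', H y <= H y') ->
  DH y = 0.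
Proof.
move=> h L0 ymin; apply: enorm_eq0; apply/eqP; rewrite -sqrf_eq0.
have /andP[_] := h y (y - L^-1 *: DH y).
have := ymin (y - L^-1 *: DH y).
rewrite [y - _ - y]addrC addKr enormN enormZ dotNr dotZr exprMn.
rewrite real_normK ?num_real// -enorm_sqr; set a := enorm _ ^+ 2 => h1 h2.
have a0 : 0 <= a by exact: sqr_ge0.
have h3 : L^-1 * a <= L^-1 / 2 * a.
  have E : L / 2 * (L^-1 ^+ 2 * a) = L^-1 / 2 * a by field; rewrite gt_eqF.
  by move: h2; rewrite E; lra.
have Li : 0 < L^-1 by rewrite invr_gt0.
rewrite eq_le a0 andbT -(ler_pM2l Li); nra.
Qed.

(** Since [ys] is minimal, the decrease [eta / 2 * enorm (DH y) ^+ 2] achieved by the step is at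
    most [H y - H ys]. This gain pays for the quadratic term in the expansion of the new squared
    distance. *)
Lemma smooth_sc_contract y ys eta : smooth_sc -> 0 <= m ->
  0 < eta -> eta * L <= 1 -> DH ys = 0 ->
  enorm (y - eta *: DH y - ys) ^+ 2 <= (1 - eta * m) * enorm (y - ys) ^+ 2.
Proof.
move=> h m0 e0 eL ys0.
have /andP[h1 _] := h y ys.
have /andP[_ h3] := h y (y - eta *: DH y).
have /andP[h4 _] := h ys (y - eta *: DH y).
have h5 : H ys <= H (y - eta *: DH y).
  rewrite ys0 dot0l subr0 in h4; rewrite -subr_ge0; apply: le_trans h4.
  by rewrite mulr_ge0 ?sqr_ge0// divr_ge0.
rewrite [y - _ - y]addrC addKr enormN enormZ dotNr dotZr exprMn in h3.
rewrite real_normK ?num_real// -enorm_sqr in h3.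
rewrite enormB -(opprB y ys) dotNr in h1.
rewrite addrAC [leLHS]enormB_sqr dotZr enormZ exprMn real_normK ?num_real//.
rewrite (dotC _ (DH y)).
have D0 := sqr_ge0 (enorm (DH y)).
set D := enorm (DH y) ^+ 2 in h3 D0 *.
set E := enorm (y - ys) ^+ 2 in h1 *.
have h6 : L / 2 * (eta ^+ 2 * D) <= eta / 2 * D.
  by have : 0 <= eta * D by [rewrite mulr_ge0 ?(ltW e0)]; nra.
have h7 : eta / 2 * D + m / 2 * E <= dot (DH y) (y - ys) by lra.
have := ler_wpM2l (ltW e0) h7; nra.
Qed.

(** Outside the cube of half-side [r] strong convexity gives [H 0 <= H y], so a minimum over this
    compact cube is global. *)
Lemma smooth_sc_ex_min : smooth_sc -> 0 < m -> continuous H ->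
  exists y, forall y', H y <= H y'.
Proof.
move=> h m0 cH.
pose r := 2 * enorm (DH 0) / m.
have r0 : 0 <= r by rewrite divr_ge0 ?(ltW m0)// mulr_ge0.
pose A := [set v : 'rV[R]_n | forall i, `[- r, r]%classic (v ord0 i)].
have A0 : A 0.
  by move=> i; rewrite mxE/= in_itv/= r0 andbT oppr_le0.
have cA : compact A.
  by apply: (@rV_compact R n (fun=> `[- r, r]%classic)) => _; exact: segment_compact.
have [c _ cmin] : exists2 c, c \in A & forall t, t \in A -> H c <= H t.
  by apply: EVT_min_rV => //; [exists 0|exact: continuous_subspaceT].
exists c => y; have [yA|yA] := pselect (A y); first by apply: cmin; rewrite inE.
apply: le_trans (cmin 0 _) _; first by rewrite inE.
have ry : r <= enorm y.
  rewrite leNgt; apply/negP => ry; apply: yA => i; rewrite /= in_itv/= -ler_norml.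
  exact: le_trans (coord_le_enorm _ _) (ltW ry).
have /andP[h1 _] := h 0 y; rewrite subr0 in h1.
have := dot_abs (DH 0) y; rewrite ler_norml => /andP[h2 _].
rewrite /r ler_pdivrMr// in ry.
have : 0 <= enorm y * (enorm y * m - 2 * enorm (DH 0)).
  by rewrite mulr_ge0// subr_ge0.
nra.
Qed.

Lemma smooth_sc_le : smooth_sc -> (0 < n)%N -> m <= L.
Proof.
move=> h n0; pose e : 'rV[R]_n := delta_mx 0 (Ordinal n0).
have /andP[h1 h2] := h 0 e.
have := le_trans h1 h2; rewrite subr0 enorm_delta expr1n; lra.
Qed.

End SmoothStronglyConvex.

(** Only the second field has to be monotone: test its monotonicity at the two zeros and apply
    Cauchy-Schwarz. It covers both a change of [x] and the passage from [g] to the penalized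
    function. *)
Lemma smooth_sc_argmin_lipschitz {R : realType} n (m L K : R)
    (H2 : 'rV[R]_n -> R) (D1 D2 : 'rV[R]_n -> 'rV[R]_n) y1 y2 :
  0 < m -> smooth_sc m L H2 D2 -> D1 y1 = 0 -> D2 y2 = 0 ->
  enorm (D1 y1 - D2 y1) <= K -> enorm (y1 - y2) <= K / m.
Proof.
move=> m0 h d1 d2 hK; rewrite ler_pdivlMr// mulrC.
have := smooth_sc_mono y2 y1 h.
rewrite d2 subr0; have -> : D2 y1 = - (D1 y1 - D2 y1) by rewrite d1 sub0r opprK.
move=> /le_trans => /(_ _ (dot_le _ _)); rewrite enormN.
have [->|y0] := eqVneq (enorm (y1 - y2)) 0.
  by move=> _; rewrite mulr0 (le_trans _ hK).
have yp : 0 < enorm (y1 - y2) by rewrite lt_def y0/=.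
rewrite expr2 mulrA ler_pM2r// => /le_trans; exact.
Qed.

(** * The hyper-objective and its penalty approximation *)

Lemma smooth_sc_continuous {R : realType} n m L (H : 'rV[R]_n -> R) DH :
  smooth_sc m L H DH -> continuous H.
Proof.
move=> h; apply: enorm_continuous; apply: (@expansion_continuous _ _ _ DH (`|m| / 2 + `|L| / 2)).
move=> u v; have /andP[h1 h2] := h u v.
have e0 := sqr_ge0 (enorm (v - u)); set e := enorm (v - u) ^+ 2 in h1 h2 e0 *.
have k1 : - `|m| * e <= m * e by rewrite ler_wpM2r// lerNl -normrN ler_norm.
have k2 : L * e <= `|L| * e by rewrite ler_wpM2r// ler_norm.
have k3 : 0 <= `|m| * e by rewrite mulr_ge0.
have k4 : 0 <= `|L| * e by rewrite mulr_ge0.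
rewrite ler_norml; lra.
Qed.

Section Bilevel.
Context {R : realType} {dx dy : nat} {f g : 'rV[R]_(dx + dy) -> R}.
Context {mu Cf Lf Lg rhog : R}.
Hypothesis hdx : (0 < dx)%N.
Hypothesis hdy : (0 < dy)%N.
Hypothesis hmu : 0 < mu.
Hypothesis hg_sc : strongly_convex_in_y mu g.
Hypothesis hg_grad : lipschitz_grad Lg g.
Hypothesis hg_hess : lipschitz_hess rhog g.
Hypothesis hf_lip : lipschitz_in_y Cf f.
Hypothesis hf_grad : lipschitz_grad Lf f.

Local Notation ell := (Num.max Cf (Num.max Lf (Num.max Lg rhog))).
Local Notation kappa := (ell / mu).
Local Notation gx F x y := (lsubmx (grad F (row_mx x y))).
Local Notation gy F x y := (rsubmx (grad F (row_mx x y))).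

Lemma row_mxB (x x' : 'rV[R]_dx) (y y' : 'rV[R]_dy) :
  row_mx x y - row_mx x' y' = row_mx (x - x') (y - y').
Proof. by rewrite opp_row_mx add_row_mx. Qed.

Lemma slice_taylor L (F : 'rV[R]_(dx + dy) -> R) x y y' : lipschitz_grad L F ->
  `|F (row_mx x y') - F (row_mx x y) - dot (gy F x y) (y' - y)|
    <= L / 2 * enorm (y' - y) ^+ 2.
Proof.
move=> h; have := lipschitz_grad_taylor (row_mx x y) (row_mx x y') h.
by rewrite row_mxB subrr enorm_row_0mx dot_rsubmx.
Qed.

(** For the lower bound, insert the first-order expansion of [g] into the convexity inequality at
    [y + s *: (y' - y)], divide by [s] and let [s] tend to 0. *)
Lemma g_smooth_sc x :
  smooth_sc mu Lg (fun y => g (row_mx x y)) (fun y => gy g x y).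
Proof.
move=> y y'; have h := fun s => slice_taylor x y (y + s *: (y' - y)) hg_grad.
apply/andP; split; last first.
  have := h 1; rewrite scale1r subrKC => /ler_normlP[_]; exact.
set d := y' - y.
apply: (@le_lim0 _ _ _ ((Lg + mu) / 2 * enorm d ^+ 2)) => s /andP[s0 s1].
have := h s; rewrite [y + _ - y]addrC addKr dotZr enormZ exprMn (ger0_norm (ltW s0)).
rewrite ler_norml => /andP[h1 _].
have := hg_sc x y' y (s := s); rewrite s1 (ltW s0) => /(_ isT).
have -> : s *: y' + (1 - s) *: y = y + s *: d.
  by rewrite /d scalerBr scalerBl scale1r addrCA.
rewrite -/d => h2.
rewrite -(ler_pM2l s0); move: h1 h2; set e := enorm d ^+ 2; nra.
Qed.

Lemma Lg_ge_mu : mu <= Lg.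
Proof. exact: smooth_sc_le (g_smooth_sc 0) hdy. Qed.

Lemma Lg_gt0 : 0 < Lg.
Proof. exact: lt_le_trans Lg_ge_mu. Qed.

Lemma ell_ge : [/\ Cf <= ell, Lf <= ell, Lg <= ell & rhog <= ell].
Proof. by split; rewrite !le_max lexx ?orbT. Qed.

Lemma ell_gt0 : 0 < ell.
Proof. by have [_ _ h _] := ell_ge; exact: lt_le_trans Lg_gt0 h. Qed.

Lemma Lf_ge0 : 0 <= Lf.
Proof. by apply: (lipschitz_grad_ge0 _ hf_grad); rewrite addn_gt0 hdx. Qed.

Lemma kappa_ge1 : 1 <= kappa.
Proof.
rewrite ler_pdivlMr// mul1r; have [_ _ h _] := ell_ge.
exact: le_trans Lg_ge_mu h.
Qed.

Lemma grad_f_y_le x y : enorm (gy f x y) <= Cf.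
Proof.
have C0 : 0 <= Cf.
  have := hf_lip x (delta_mx 0 (Ordinal hdy)) 0.
  by rewrite subr0 enorm_delta mulr1; apply: le_trans.
apply: enorm_dual => // d.
apply: (@le_lim0 _ _ _ (Lf / 2 * enorm d ^+ 2)) => s /andP[s0 s1].
have /ler_normlP[h2 _] := slice_taylor x y (y + s *: d) hf_grad.
have /ler_normlP[_ h1] := hf_lip x (y + s *: d) y.
rewrite [y + _ - y]addrC addKr in h1 h2.
rewrite ?dotZr !enormZ ?exprMn (ger0_norm (ltW s0)) in h1 h2.
by rewrite -(ler_pM2l s0); nra.
Qed.

(** Strong convexity provides a minimizer, so [xget] does not return its default. *)
Lemma ystar_min m L (F : 'rV[R]_(dx + dy) -> R) DF x :
  0 < m -> smooth_sc m L (fun y => F (row_mx x y)) DF -> DF (ystar F x) = 0.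
Proof.
move=> m0 h; have [y hy] := smooth_sc_ex_min h m0 (smooth_sc_continuous h).
have L0 : 0 < L := lt_le_trans m0 (smooth_sc_le h hdy).
apply: (smooth_sc_min h L0); rewrite /ystar.
by case: xgetP => [z _ hz|/(_ y)]; first exact: hz.
Qed.

Local Notation yst := (ystar g).

Lemma grad_ystar x : gy g x (yst x) = 0.
Proof. exact: (ystar_min hmu (g_smooth_sc x)). Qed.

Lemma grad_block_lipschitz L (F : 'rV[R]_(dx + dy) -> R) x x' y :
  lipschitz_grad L F -> enorm (gy F x y - gy F x' y) <= L * enorm (x - x').
Proof.
move=> [_ h]; rewrite -raddfB; apply: le_trans (enorm_rsubmx _) _.
by apply: le_trans (h _ _) _; rewrite row_mxB subrr enorm_row_mx0.
Qed.

Lemma ystar_lipschitz x x' : enorm (yst x - yst x') <= Lg / mu * enorm (x - x').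
Proof.
rewrite mulrAC; apply: (smooth_sc_argmin_lipschitz (D1 := fun y => gy g x y) hmu
  (g_smooth_sc x') (grad_ystar x) (grad_ystar x')).
exact: grad_block_lipschitz.
Qed.

Local Notation J x := (hess g (row_mx x (yst x))).

Lemma hess_mul_le u v : enorm (v *m hess g u) <= Lg * enorm v.
Proof.
apply: (@le_lim0 _ _ _ (ell / 2 * enorm v ^+ 2)) => s /andP[s0 s1].
have [_ _ _ rl] := ell_ge.
have h1 := hess_taylor u (s *: v) hg_hess rl (ltW ell_gt0).
have h2 := hg_grad.2 (u + s *: v) u.
rewrite [u + _ - u]addrC addKr in h2.
have := lerD h2 h1; rewrite -scalemxAl !enormZ !gtr0_norm// => h.
have : s * enorm (v *m hess g u) <=
    enorm (grad g (u + s *: v) - grad g u) +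
    enorm (grad g (u + s *: v) - grad g u - s *: (v *m hess g u)).
  rewrite -[in leRHS](enormN (_ - _ - _)) -{1}(gtr0_norm s0) -enormZ.
  by apply: le_trans (enormD _ _); rewrite opprB addrC subrK.
move=> k; rewrite -(ler_pM2l s0); apply: le_trans k _; apply: le_trans h _.
by rewrite le_eqVlt; apply/orP; left; apply/eqP; ring.
Qed.

(** The strong monotonicity of the [y]-gradient along [s *: c], expanded to first order and divided
    by [s ^+ 2]. *)
Lemma hess_yy_coercive x c :
  mu * enorm c ^+ 2 <= dot (row_mx 0 c *m J x) (row_mx 0 c).
Proof.
set u := row_mx x (yst x); set w := row_mx 0 c.
have ew : enorm w = enorm c by rewrite /w enorm_row_0mx.
apply: (@le_lim0 _ _ _ (ell / 2 * enorm c ^+ 3)) => s /andP[s0 s1].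
have [_ _ _ rl] := ell_ge.
have h1 := hess_taylor u (s *: w) hg_hess rl (ltW ell_gt0).
have := smooth_sc_mono (yst x) (yst x + s *: c) (g_smooth_sc x).
rewrite [yst x + _ - _]addrC addKr -raddfB dot_rsubmx/=.
have -> : row_mx x (yst x + s *: c) = u + s *: w.
  by rewrite /u /w scale_row_mx add_row_mx scaler0 addr0.
have -> : row_mx 0 (s *: c) = s *: w :> 'rV[R]_(dx + dy).
  by rewrite /w scale_row_mx scaler0.
have := dot_le (grad g (u + s *: w) - grad g u - (s *: w) *m hess g u) (s *: w).
rewrite dotBl -scalemxAl dotZl !dotZr => h2 h3.
rewrite -scalemxAl in h1; have h4 := ler_wpM2r (enorm_ge0 (s *: w)) h1.
have := le_trans h2 h4; rewrite !enormZ !gtr0_norm// ew => h5.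
rewrite enormZ gtr0_norm// exprMn in h3.
have s2 : 0 < s ^+ 2 by rewrite exprn_gt0.
rewrite -(ler_pM2l s2); move: h3 h5; set A := dot _ w; set B := dot _ w.
move=> h3 h5.
have -> : s ^+ 2 * (B + ell / 2 * enorm c ^+ 3 * s) =
  s * (s * B) + ell / 2 * (s * enorm c) ^+ 2 * (s * enorm c) by ring.
by rewrite mulrCA; lra.
Qed.

Local Notation M x := (- (ursubmx (J x) *m invmx (drsubmx (J x)))).

Lemma rsubmx_row_mul (A : 'M[R]_(dx + dy)) (b : 'rV[R]_dx) (c : 'rV[R]_dy) :
  rsubmx (row_mx b c *m A) = b *m ursubmx A + c *m drsubmx A.
Proof. by rewrite -{1}[A]submxK mul_row_block row_mxKr. Qed.

Lemma hess_yy_unit x : drsubmx (J x) \in unitmx.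
Proof.
rewrite -row_free_unit; apply: inj_row_free => c c0.
have := hess_yy_coercive x c.
rewrite -dot_rsubmx rsubmx_row_mul mul0mx add0r c0 dot0l pmulr_rle0// => h.
by apply: enorm_eq0; apply/eqP; rewrite -sqrf_eq0 eq_le h sqr_ge0.
Qed.

(* [M x] is the Jacobian of [yst] at [x], in row-vector convention. *)
Lemma implicit_diff x (b : 'rV[R]_dx) : rsubmx (row_mx b (b *m M x) *m J x) = 0.
Proof.
by rewrite rsubmx_row_mul mulmxN mulNmx -!mulmxA mulVmx ?hess_yy_unit// mulmx1 subrr.
Qed.

(** The norm bound [1 / mu] on the inverse of the [yy] block, phrased as a linear system so that no
    inverse has to be estimated. *)
Lemma hess_yy_inv_le x c (w : 'rV[R]_(dx + dy)) :
  rsubmx (row_mx 0 c *m J x) = - rsubmx w -> enorm c <= enorm w / mu.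
Proof.
move=> h; rewrite ler_pdivlMr// mulrC.
have := hess_yy_coercive x c.
rewrite -dot_rsubmx h -raddfN dot_rsubmx => /le_trans => /(_ _ (dot_le _ _)).
rewrite enormN enorm_row_0mx.
have [->|c0] := eqVneq (enorm c) 0; first by move=> _; rewrite mulr0 enorm_ge0.
have cp : 0 < enorm c by rewrite lt_def c0/=.
by rewrite expr2 mulrA ler_pM2r.
Qed.

Lemma implicit_diff_le x (b : 'rV[R]_dx) : enorm (b *m M x) <= kappa * enorm b.
Proof.
have h : rsubmx (row_mx 0 (b *m M x) *m J x) = - rsubmx (row_mx b 0 *m J x).
  apply/eqP; rewrite -subr_eq0 opprK -raddfD/= -mulmxDl add_row_mx add0r addr0.
  by rewrite implicit_diff.
apply: le_trans (hess_yy_inv_le h) _.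
rewrite mulrAC ler_pM2r ?invr_gt0//; apply: le_trans (hess_mul_le _ _) _.
by rewrite enorm_row_mx0 ler_wpM2r//; have [] := ell_ge.
Qed.

(** The implicit differentiation formula for the gradient of phi; [M x] acts on row vectors from the
    right, hence the transpose. *)
Definition hypergrad x : 'rV[R]_dx := gx f x (yst x) + gy f x (yst x) *m (M x)^T.

Lemma dot_hypergrad x b :
  dot (hypergrad x) b = dot (grad f (row_mx x (yst x))) (row_mx b (b *m M x)).
Proof.
rewrite /hypergrad dotDl dot_lsubmx.
have -> : dot (gy f x (yst x) *m (M x)^T) b = dot (gy f x (yst x)) (b *m M x).
  have dotE n (u v : 'rV[R]_n) : dot u v = (u *m v^T) 0 0.
    by rewrite mxE; apply: eq_bigr => i _; rewrite mxE.
  by rewrite !dotE -mulmxA trmx_mul.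
by rewrite dot_rsubmx -dotDr add_row_mx addr0 add0r.
Qed.

Lemma enorm_row_mx_le (b : 'rV[R]_dx) (c : 'rV[R]_dy) :
  enorm c <= kappa * enorm b -> enorm (row_mx b c) ^+ 2 <= 2 * kappa ^+ 2 * enorm b ^+ 2.
Proof.
move=> h; rewrite enorm_row_mx.
have k1 := kappa_ge1.
have : enorm c ^+ 2 <= (kappa * enorm b) ^+ 2.
  by rewrite ler_sqr// nnegrE// mulr_ge0// (le_trans _ k1).
have : enorm b ^+ 2 <= kappa ^+ 2 * enorm b ^+ 2.
  by rewrite ler_peMl ?sqr_ge0// exprn_ege1.
rewrite exprMn; lra.
Qed.

(* A quadratic bound on the remainder of [phi] gives differentiability, the value of
   the gradient and the descent inequality at once. *)
Lemma hyperobj_expansion x x' :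
  `|hyperobj f g x' - hyperobj f g x - dot (hypergrad x) (x' - x)|
    <= 2 * ell * kappa ^+ 3 * enorm (x' - x) ^+ 2.
Proof.
rewrite /hyperobj dot_hypergrad.
set y := yst x; set y' := yst x'; set u := row_mx x y; set b := x' - x.
pose d := y' - y; set c := b *m _.
have [_ Lfl Lgl rl] := ell_ge; have k1 := kappa_ge1.
have dle : enorm d <= kappa * enorm b.
  apply: le_trans (ystar_lipschitz _ _) _.
  by rewrite ler_wpM2r// ler_pM2r ?invr_gt0.
have ebd := enorm_row_mx_le dle.
have eu : row_mx x' y' - u = row_mx b d by rewrite row_mxB.
have eu' : row_mx x' y' = u + row_mx b d by rewrite -eu subrKC.
have E0 := sqr_ge0 (enorm b); set E := enorm b ^+ 2 in ebd E0 *.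
have h1 : `|f (row_mx x' y') - f u - dot (grad f u) (row_mx b d)|
    <= ell * kappa ^+ 2 * E.
  have := lipschitz_grad_taylor u (row_mx x' y') hf_grad; rewrite eu.
  move=> /le_trans; apply.
  apply: (@le_trans _ _ (ell / 2 * enorm (row_mx b d) ^+ 2)).
    by rewrite ler_wpM2r ?sqr_ge0// ler_wpM2r.
  have := ler_wpM2l (ltW ell_gt0) ebd; nra.
pose e := grad g (u + row_mx b d) - grad g u - row_mx b d *m hess g u.
have he : enorm e <= ell * kappa ^+ 2 * E.
  apply: le_trans (hess_taylor u (row_mx b d) hg_hess rl (ltW ell_gt0)) _.
  have := ler_wpM2l (ltW ell_gt0) ebd; nra.
(* The [y]-gradients of [g] vanish at both [(x, y)] and [(x', y')]. Subtracting the linearized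
   equation solved by [c] shows that [d - c] solves the [yy] system with right-hand side the
   [y]-block of [- e]. *)
have hdc : enorm (d - c) <= kappa ^+ 3 * E.
  have -> : kappa ^+ 3 * E = ell * kappa ^+ 2 * E / mu by field; rewrite gt_eqF.
  have /le_trans -> // : enorm (d - c) <= enorm e / mu.
    apply: (@hess_yy_inv_le x); 
    have hu : rsubmx (grad g u) = 0 := grad_ystar x.
    rewrite /e -eu' !raddfB/= grad_ystar hu oppr0 subr0 sub0r opprK.
    have -> : row_mx 0 (d - c) = row_mx b d - row_mx b c :> 'rV[R]_(dx + dy).
      by rewrite row_mxB subrr.
    by rewrite mulmxBl raddfB/= implicit_diff subr0.
  by rewrite ler_pM2r ?invr_gt0.
have -> : f (row_mx x' y') - f u - dot (grad f u) (row_mx b c) =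
   (f (row_mx x' y') - f u - dot (grad f u) (row_mx b d)) +
   dot (rsubmx (grad f u)) (d - c).
  have -> : dot (rsubmx (grad f u)) (d - c) =
     dot (grad f u) (row_mx b d - row_mx b c).
    by rewrite dot_rsubmx row_mxB subrr.
  by rewrite dotBr; ring.
apply: le_trans (ler_normD _ _) _.
have h2 : `|dot (rsubmx (grad f u)) (d - c)| <= ell * (kappa ^+ 3 * E).
  apply: le_trans (dot_abs _ _) _; rewrite ler_pM//.
  by apply: le_trans (grad_f_y_le _ _) _; have [] := ell_ge.
have h3 : ell * kappa ^+ 2 * E <= ell * kappa ^+ 3 * E.
  rewrite ler_wpM2r// ler_wpM2l ?(ltW ell_gt0)//.
  by rewrite [leRHS]exprS ler_peMl// exprn_ge0// (le_trans _ k1).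
apply: le_trans (lerD h1 h2) _; nra.
Qed.

Lemma grad_hyperobj x : grad (hyperobj f g) x = hypergrad x.
Proof. exact: (expansion_grad hyperobj_expansion). Qed.

(** * The penalized lower-level problem and its hypergradient bias *)

Section Penalty.
Variable lam : R.
Hypothesis hlam : 0 < lam.
Hypothesis hlam_mu : Lf / lam <= mu / 2.

(** The objective [f + lam * g] of the [y] loop divided by [lam]: its curvature bounds become
    independent of [lam], and the step [eta_y] turns into [(2 * Lg)^-1]. *)
Definition penalty : 'rV[R]_(dx + dy) -> R := fun u => g u + lam^-1 * f u.

Definition penalty_gy x y := gy g x y + lam^-1 *: gy f x y.

Local Notation ylam := (ystar penalty).

(** The summand [f / lam] changes each side by at most [mu / 4 * enorm (y' - y) ^+ 2]; on the upper
    side [mu <= Lg] is used. *)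
Lemma penalty_smooth_sc x : smooth_sc (mu / 2) (3 / 2 * Lg)
  (fun y => penalty (row_mx x y)) (penalty_gy x).
Proof.
move=> y y'; have /andP[h1 h2] := g_smooth_sc x y y'.
have := slice_taylor x y y' hf_grad.
rewrite ler_norml /penalty /penalty_gy dotDl dotZl => /andP[h3 h4].
have li : 0 < lam^-1 by rewrite invr_gt0.
have e0 := sqr_ge0 (enorm (y' - y)); set e := enorm (y' - y) ^+ 2 in h1 h2 h3 h4 e0 *.
have mL := Lg_ge_mu.
have k1 := ler_wpM2l (ltW li) h3; have k2 := ler_wpM2l (ltW li) h4.
have k3 : lam^-1 * (Lf / 2 * e) <= mu / 4 * e.
  have -> : lam^-1 * (Lf / 2 * e) = (Lf / lam) / 2 * e by rewrite mulrC; ring.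
  have -> : mu / 4 = mu / 2 / 2 by field.
  by rewrite ler_wpM2r// ler_wpM2r.
have k4 : mu * e <= Lg * e by rewrite ler_wpM2r.
set a := dot _ _ in h1 h2 *; set b := dot _ _ in h3 h4 k1 k2 *.
have -> : g (row_mx x y') + lam^-1 * f (row_mx x y') -
    (g (row_mx x y) + lam^-1 * f (row_mx x y)) - (a + lam^-1 * b) =
    (g (row_mx x y') - g (row_mx x y) - a) +
    lam^-1 * (f (row_mx x y') - f (row_mx x y) - b) by ring.
rewrite mulrN in k1; clear - h1 h2 k1 k2 k3 k4.
set F := lam^-1 * (_ - b) in k1 k2 *; set G := _ - a in h1 h2 *.
by apply/andP; split; lra.
Qed.

Lemma grad_ylam x : penalty_gy x (ylam x) = 0.
Proof.
by apply: (ystar_min _ (penalty_smooth_sc x)); rewrite divr_gt0.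
Qed.

Lemma ylam_lipschitz x x' :
  enorm (ylam x - ylam x') <= 3 * (Lg / mu) * enorm (x - x').
Proof.
(* [Lg + mu / 2] is the Lipschitz constant in [x] of the penalized [y]-gradient; the last summand is
   slack that rounds the quotient to 3. *)
have -> : 3 * (Lg / mu) * enorm (x - x') =
    (Lg + mu / 2 + (Lg - mu) / 2) * enorm (x - x') / (mu / 2).
  by field; rewrite gt_eqF.
have m0 : 0 < mu / 2 by rewrite divr_gt0.
apply: (smooth_sc_argmin_lipschitz m0 (penalty_smooth_sc x')
  (grad_ylam x) (grad_ylam x')).
rewrite /penalty_gy opprD addrACA -scalerBr (le_trans (enormD _ _))//.
have h1 := grad_block_lipschitz x x' (ylam x) hg_grad.
have h2 := grad_block_lipschitz x x' (ylam x) hf_grad.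
rewrite enormZ ger0_norm ?invr_ge0 ?(ltW hlam)//.
have h3 : lam^-1 * enorm (gy f x (ylam x) - gy f x' (ylam x)) <= mu / 2 * enorm (x - x').
  rewrite mulrC ler_pdivrMr//; apply: le_trans h2 _.
  rewrite mulrAC ler_wpM2r//; move: hlam_mu; rewrite ler_pdivrMr//.
apply: le_trans (lerD h1 h3) _; rewrite -mulrDl ler_wpM2r//.
by rewrite lerDl divr_ge0// subr_ge0 Lg_ge_mu.
Qed.

(** The two [y]-gradient fields differ by [lam^-1] times the [y]-gradient of [f], of norm at most
    [Cf]. *)
Lemma ylam_ystar x : enorm (ylam x - yst x) <= Cf / (lam * mu).
Proof.
rewrite invfM mulrA.
apply: (smooth_sc_argmin_lipschitz hmu (g_smooth_sc x) (grad_ylam x)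
  (grad_ystar x)).
rewrite /penalty_gy addrC addKr enormZ ger0_norm ?invr_ge0 ?(ltW hlam)//.
by rewrite mulrC ler_pdivrMr// divfK ?gt_eqF// grad_f_y_le.
Qed.

Lemma inner_y_contract x y :
  enorm (y - (2 * Lg)^-1 *: penalty_gy x y - ylam x) ^+ 2
    <= (1 - mu / (4 * Lg)) * enorm (y - ylam x) ^+ 2.
Proof.
have L0 := Lg_gt0.
have -> : mu / (4 * Lg) = (2 * Lg)^-1 * (mu / 2) by field; rewrite gt_eqF.
apply: smooth_sc_contract (penalty_smooth_sc x) _ _ _ (grad_ylam x).
- by rewrite divr_ge0// ltW.
- by rewrite invr_gt0 mulr_gt0.
have -> : (2 * Lg)^-1 * (3 / 2 * Lg) = 3 / 4 by field; rewrite gt_eqF.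
by lra.
Qed.

(** The step gives twice this rate, since [g] has modulus [mu] and not [mu / 2]; it is weakened so
    that both loops share one factor. *)
Lemma inner_z_contract x z :
  enorm (z - (2 * Lg)^-1 *: gy g x z - yst x) ^+ 2
    <= (1 - mu / (4 * Lg)) * enorm (z - yst x) ^+ 2.
Proof.
have L0 := Lg_gt0.
apply: (@le_trans _ _ ((1 - (2 * Lg)^-1 * mu) * enorm (z - yst x) ^+ 2)).
  apply: smooth_sc_contract (g_smooth_sc x) _ _ _ (grad_ystar x).
  - exact: ltW.
  - by rewrite invr_gt0 mulr_gt0.
  have -> : (2 * Lg)^-1 * Lg = 1 / 2 by field; rewrite gt_eqF.
  by lra.
rewrite ler_wpM2r ?sqr_ge0//.
have -> : (2 * Lg)^-1 * mu = 2 * (mu / (4 * Lg)) by field; rewrite gt_eqF.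
by have : 0 < mu / (4 * Lg); [rewrite divr_gt0// mulr_gt0|lra].
Qed.

Definition penalty_gx x y z : 'rV[R]_dx := gx f x y + lam *: (gx g x y - gx g x z).

(** Test against [b] and put [c = b *m M x]. The stationarity of [ylam x], tested against [c], may
    be added for free and completes [b] to the joint direction [(b, c)]. In that direction the
    first-order part of the gradient of [g] disappears. What remains is [ell * enorm d] from [f] and
    [lam] times a quadratic remainder from [g], both of order [ell * kappa ^+ 2 / lam] because
    [enorm d <= kappa / lam]. *)
Lemma penalty_gx_bias x :
  enorm (penalty_gx x (ylam x) (yst x) - hypergrad x) <= 3 * ell * kappa ^+ 3 / lam.
Proof.
have [Cfl Lfl Lgl rl] := ell_ge; have k1 := kappa_ge1; have l0 := ell_gt0.
have k0 : 0 <= kappa by rewrite (le_trans _ k1).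
have lam0 : lam != 0 by rewrite gt_eqF.
apply: enorm_dual => [|b].
  by rewrite divr_ge0 ?(ltW hlam)// mulr_ge0 ?exprn_ge0// mulr_ge0// ltW.
set y := yst x; set yl := ylam x; pose c := b *m M x; set u := row_mx x y.
pose d := yl - y; set ul := row_mx x yl.
have eul : ul = u + row_mx 0 d by rewrite /ul /u add_row_mx addr0 subrKC.
have dle : enorm d <= kappa / lam.
  apply: le_trans (ylam_ystar x) _.
  have -> : kappa / lam = ell / (lam * mu) by field; rewrite !gt_eqF.
  by rewrite ler_wpM2r// invr_ge0 mulr_ge0// ltW.
pose e := grad g (u + row_mx 0 d) - grad g u - row_mx 0 d *m hess g u.
have he : enorm e <= ell / 2 * enorm d ^+ 2.
  apply: le_trans (hess_taylor u (row_mx 0 d) hg_hess rl (ltW l0)) _.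
  by rewrite enorm_row_0mx.
have hf : enorm (grad f ul - grad f u) <= ell * enorm d.
  apply: le_trans (hf_grad.2 _ _) _; rewrite eul addrC addKr enorm_row_0mx.
  by rewrite ler_wpM2r.
(* The [y]-gradient of [f + lam * g] vanishes at [ylam x], and that of [g] vanishes at
   [ystar g x]. *)
have stat : dot (grad f ul) (row_mx 0 c) +
    lam * dot (grad g ul - grad g u) (row_mx 0 c) = 0.
  have hu : rsubmx (grad g u) = 0 := grad_ystar x.
  rewrite -2!dot_rsubmx raddfB/= hu subr0 -dotZl -dotDl.
  have := grad_ylam x; rewrite /penalty_gy -/yl -/ul => h.
  have -> : rsubmx (grad f ul) + lam *: rsubmx (grad g ul) =
     lam *: (rsubmx (grad g ul) + lam^-1 *: rsubmx (grad f ul)).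
    by rewrite scalerDr scalerA (mulfV lam0) scale1r addrC.
  by rewrite h scaler0 dot0l.
(* By symmetry the Hessian can act on [(b, c)] instead, and its [y]-block there is zero by the
   choice of [c]. *)
have hJ : dot (row_mx 0 d *m hess g u) (row_mx b c) = 0.
  by rewrite (hess_sym _ _ _ hg_hess) -dot_rsubmx implicit_diff dot0l.
have -> : dot (penalty_gx x yl y - hypergrad x) b =
    dot (grad f ul - grad f u) (row_mx b c) + lam * dot e (row_mx b c).
  rewrite dotBl dot_hypergrad -/c -/u /penalty_gx dotDl dotZl -raddfB/= !dot_lsubmx.
  rewrite -[in LHS](addr0 (dot _ _ + _)) -[in LHS]stat.
  have split_bc : row_mx b c = row_mx b 0 + row_mx 0 c.
    by rewrite add_row_mx addr0 add0r.
  have -> : dot e (row_mx b c) = dot (grad g ul - grad g u) (row_mx b c).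
    by rewrite /e (dotBl (_ - _)) hJ subr0 -eul.
  have fs w : dot w (row_mx b c) = dot w (row_mx b 0) + dot w (row_mx 0 c).
    by rewrite -dotDr -split_bc.
  by rewrite (dotBl (grad f ul)) (fs (grad f ul)) (fs (grad g ul - _)); ring.
have hbc : enorm (row_mx b c) <= 2 * kappa * enorm b.
  have kb : 0 <= 2 * kappa * enorm b by rewrite mulr_ge0// mulr_ge0.
  rewrite -ler_sqr ?nnegrE//.
  apply: le_trans (enorm_row_mx_le (implicit_diff_le x b)) _.
  rewrite [in leRHS]exprMn ler_wpM2r ?sqr_ge0//.
  rewrite [in leRHS]exprMn ler_wpM2r ?sqr_ge0//.
  by rewrite -natrX ler_nat.
have h1 := dot_le (grad f ul - grad f u) (row_mx b c).
have h2 := dot_le e (row_mx b c).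
have bc0 := enorm_ge0 (row_mx b c).
apply: (@le_trans _ _ ((ell * enorm d + lam * (ell / 2 * enorm d ^+ 2)) * enorm (row_mx b c))).
  rewrite [leRHS]mulrDl; apply: lerD; first by apply: le_trans h1 _; rewrite ler_wpM2r.
  rewrite -[leRHS]mulrA ler_wpM2l ?(ltW hlam)//; apply: le_trans h2 _.
  by rewrite ler_wpM2r.
have D0 : 0 <= kappa / lam by rewrite divr_ge0// ltW.
have d2 : enorm d ^+ 2 <= (kappa / lam) ^+ 2 by rewrite ler_sqr ?nnegrE.
(* The factor [3 / 2] is [1] from [f] plus [1 / 2] from the Taylor remainder of [g]; [2 * kappa]
   bounds the norm of [(b, c)]. *)
have -> : 3 * ell * kappa ^+ 3 / lam * enorm b =
   (3 / 2 * (ell * kappa ^+ 2 / lam)) * (2 * kappa * enorm b) by field; rewrite !gt_eqF.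
apply: ler_pM => //.
  by rewrite addr_ge0// !mulr_ge0 ?sqr_ge0 ?(ltW l0) ?(ltW hlam)// divr_ge0// ltW.
have h3 : ell * enorm d <= ell * kappa ^+ 2 / lam.
  rewrite -mulrA ler_pM2l//; apply: le_trans dle _.
  by rewrite ler_wpM2r ?invr_ge0 ?(ltW hlam)// expr2 ler_peMl.
have h4 : lam * (ell / 2 * enorm d ^+ 2) <= 1 / 2 * (ell * kappa ^+ 2 / lam).
  have -> : 1 / 2 * (ell * kappa ^+ 2 / lam) = lam * (ell / 2 * (kappa / lam) ^+ 2).
    by field; rewrite !gt_eqF.
  by rewrite ler_wpM2l ?(ltW hlam)// ler_wpM2l// divr_ge0// ltW.
lra.
Qed.

Lemma penalty_gx_inner x y z y' z' :
  enorm (penalty_gx x y z - penalty_gx x y' z') <=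
    (Lf + lam * Lg) * enorm (y - y') + lam * Lg * enorm (z - z').
Proof.
have lip L (F : 'rV[R]_(dx + dy) -> R) v v' : lipschitz_grad L F ->
    enorm (gx F x v - gx F x v') <= L * enorm (v - v').
  move=> [_ h]; rewrite -raddfB; apply: le_trans (enorm_lsubmx _) _.
  by apply: le_trans (h _ _) _; rewrite row_mxB subrr enorm_row_0mx.
have aux (a a' b b' c c' : 'rV[R]_dx) : a + lam *: (b - c) - (a' + lam *: (b' - c')) =
    (a - a') + lam *: (b - b') + lam *: (c' - c).
  by apply/rowP => i; rewrite !mxE; ring.
rewrite /penalty_gx aux.
have h1 := lip _ _ y y' hf_grad; have h2 := lip _ _ y y' hg_grad.
have h3 := lip _ _ z' z hg_grad; rewrite (enormB z' z) in h3.
apply: le_trans (enormD _ _) _; rewrite mulrDl.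
apply: le_trans (lerD (enormD _ _) (lexx _)) _.
rewrite !enormZ (gtr0_norm hlam) -!(mulrA lam).
by rewrite lerD// ?lerD// ler_wpM2l// ltW.
Qed.

(** As [Lf <= lam * Lg / 2], the [y] error has coefficient [3 / 2 * (lam * Lg)] and the [z] error
    [lam * Lg]. Splitting the square twice multiplies [9 / 4] and [1] by 4; the bias is split off
    once, which gives [2 * 3 ^+ 2 = 18]. *)
Lemma penalty_gx_error x y z :
  enorm (penalty_gx x y z - hypergrad x) ^+ 2 <=
    9 * (lam * Lg) ^+ 2 * enorm (y - ylam x) ^+ 2 +
    4 * (lam * Lg) ^+ 2 * enorm (z - yst x) ^+ 2 +
    18 * (ell * kappa ^+ 3 / lam) ^+ 2.
Proof.
set A := enorm (y - _); set B := enorm (z - _); set D := ell * kappa ^+ 3 / lam.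
set q := penalty_gx x (ylam x) (yst x).
have -> : penalty_gx x y z - hypergrad x = (penalty_gx x y z - q) + (q - hypergrad x).
  by rewrite subrKA.
apply: le_trans (enormD_sqr_le _ _) _.
have A0 : 0 <= A := enorm_ge0 _; have B0 : 0 <= B := enorm_ge0 _.
have c0 : 0 <= lam * Lg by rewrite mulr_ge0 ?(ltW hlam)// ltW// Lg_gt0.
have h1 : enorm (q - hypergrad x) ^+ 2 <= (3 * D) ^+ 2.
  rewrite ler_sqr ?nnegrE ?(le_trans (enorm_ge0 _) _)//.
    by apply: le_trans (penalty_gx_bias x) _; rewrite /D; lra.
  by apply: le_trans (enorm_ge0 (q - hypergrad x)) _;
     apply: le_trans (penalty_gx_bias x) _; rewrite /D; lra.
have Lfl : Lf <= lam * Lg / 2.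
  move: hlam_mu; rewrite ler_pdivrMr// => /le_trans; apply.
  by rewrite mulrC mulrA ler_wpM2r// ler_wpM2l ?(ltW hlam)// Lg_ge_mu.
have h2 : enorm (penalty_gx x y z - q) <= 3 / 2 * (lam * Lg) * A + lam * Lg * B.
  apply: le_trans (penalty_gx_inner _ _ _ _ _) _; rewrite lerD2r ler_wpM2r//; lra.
have h3 : enorm (penalty_gx x y z - q) ^+ 2 <= (3 / 2 * (lam * Lg) * A + lam * Lg * B) ^+ 2.
  by rewrite ler_sqr ?nnegrE// (le_trans _ h2).
have := sqr_ge0 (3 / 2 * (lam * Lg) * A - lam * Lg * B).
set a := lam * Lg in h3 *; nra.
Qed.

End Penalty.

End Bilevel.

(** * Independence of the past and mini-batch noise *)

Section Freezing.
Local Open Scope ereal_scope.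
Context {R : realType} {d dJ dX : measure_display} {W : measurableType d}
  {WJ : measurableType dJ} {X : measurableType dX}.
Variables (P : probability W R) (Q : probability X R).
Variables (pi : W -> WJ) (xi : W -> X).
Hypothesis mpi : measurable_fun setT pi.
Hypothesis mxi : measurable_fun setT xi.
Hypothesis indep : forall A B, measurable A -> measurable B ->
  P (pi @^-1` A `&` xi @^-1` B) = P (pi @^-1` A) * Q B.

Let mphi : measurable_fun setT (fun w => (pi w, xi w)).
Proof. exact: measurable_fun_pair. Qed.
Let pi_mfun : {mfun W >-> WJ} := HB.pack pi (isMeasurableFun.Build _ _ _ _ _ mpi).
Let phi : W -> WJ * X := fun w => (pi w, xi w).
Let phi_mfun : {mfun W >-> (WJ * X)%type} :=
  HB.pack phi (isMeasurableFun.Build _ _ _ _ _ mphi).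

(** Independence says that the law of the pair is a product measure, and Tonelli integrates out the
    fresh draw with the past held fixed. This plays the role of conditioning on the past. *)
Lemma freezing (h : (WJ * X)%type -> \bar R) :
  measurable_fun [set: (WJ * X)%type] h -> (forall p, 0 <= h p) ->
  \int[P]_w h (pi w, xi w) = \int[P]_w \int[Q]_x h (pi w, x).
Proof.
move=> mh h0.
have E1 : \int[distribution P phi_mfun]_p h p = \int[P]_w h (pi w, xi w).
  rewrite /distribution ge0_integral_pushforward//=.
have E2 : \int[distribution P phi_mfun]_p h p =
    \int[distribution P pi_mfun \x Q]_p h p.
  apply: eq_measure_integral => A mA _; apply/esym.
  by apply: product_measure_unique => // B C mB mC; exact: indep.
rewrite -E1 E2 fubini_tonelli1//= /distribution ge0_integral_pushforward//=.
  exact: measurable_fun_fubini_tonelli_F.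
by move=> w _; exact: integral_ge0.
Qed.

(** The indicator of an event of the past is a factor depending on the first component only, so it
    is absorbed into [h]. *)
Lemma freezing_in A (h : (WJ * X)%type -> \bar R) : measurable A ->
  measurable_fun [set: (WJ * X)%type] h -> (forall p, 0 <= h p) ->
  \int[P]_(w in pi @^-1` A) h (pi w, xi w) =
  \int[P]_(w in pi @^-1` A) \int[Q]_x h (pi w, x).
Proof.
move=> mA mh h0.
have mAT : measurable (A `*` [set: X]) by exact: measurableX.
have mh' : measurable_fun setT (h \_ (A `*` setT)).
  by apply: (measurable_restrictT h mAT).1; exact: measurable_funTS mh.
have h0' p : 0 <= (h \_ (A `*` setT)) p by rewrite /patch; case: ifP.
have H := freezing mh' h0'.
rewrite [LHS]integral_mkcond [RHS]integral_mkcond.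
have memE w x : ((pi w, x) \in A `*` [set: X]) = (w \in pi @^-1` A).
  by apply/idP/idP => /set_mem Aw; apply/mem_set => //=; case: Aw.
transitivity (\int[P]_w (h \_ (A `*` [set: X])) (pi w, xi w)).
  by apply: eq_integral => w _; rewrite /patch memE.
rewrite H; apply: eq_integral => w _; rewrite /patch; under eq_integral do rewrite memE.
by case: ifPn => // _; rewrite integral0.
Qed.

End Freezing.

(** * Independence of a fresh draw from the sigma-algebra of the past *)

Section PastIndependence.
Context {R : realType} {d : measure_display} {W : measurableType d}.
Context {P : probability W R} {I : eqType} {E : I -> set (set W)}.
Hypothesis mE : forall i, E i `<=` measurable.
Hypothesis ET : forall i, E i setT.
Hypothesis EI : forall i, setI_closed (E i).
Hypothesis indE : independent_systems P E.

Definition past (J : set I) : set (set W) := \bigcup_(i in J) E i.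

Definition cylinder (l : seq I) (B : I -> set W) : set W :=
  [set w | forall i, i \in l -> B i w].

Lemma cylinder_cons i l B : cylinder (i :: l) B = B i `&` cylinder l B.
Proof.
apply/seteqP; split => [w h|w [h1 h2] j].
  by split; [apply: h; rewrite mem_head|move=> j jl; apply: h; rewrite inE jl orbT].
by rewrite inE => /orP[/eqP->|/h2].
Qed.

Lemma eq_cylinder l B B' : {in l, B =1 B'} -> cylinder l B = cylinder l B'.
Proof.
by move=> h; apply/seteqP; split => w wB i il; have := wB i il; rewrite h.
Qed.

Lemma measurable_cylinder l B : (forall i, i \in l -> E i (B i)) ->
  measurable (cylinder l B).
Proof.
elim: l => [|i l IH] h.
  by rewrite (_ : cylinder [::] B = setT)//; apply/seteqP; split.
rewrite cylinder_cons; apply: measurableI.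
  by apply: (mE (i := i)); apply: h; rewrite mem_head.
by apply: IH => j jl; apply: h; rewrite inE jl orbT.
Qed.

Lemma cylinder_prob l B : uniq l -> (forall i, i \in l -> E i (B i)) ->
  fine (P (cylinder l B)) = \prod_(i <- l) fine (P (B i)).
Proof.
move=> ul hB.
have inj : injective (tnth (in_tuple l)) by apply/tuple_uniqP.
have H := indE inj (fun k => hB _ (mem_tnth k (in_tuple l))).
rewrite big_tnth -H; congr (fine (P _)); apply/seteqP.
split => [w h k _|w h i il]; first by apply: h; exact: mem_tnth.
have /tnthP[k ->] : i \in in_tuple l by [].
exact: h.
Qed.

(** Finite intersections of events of distinct draws in [J]: a pi-system that generates the past and
    on which the product formula is the hypothesis itself. *)
Let cyls (J : set I) : set (set W) := [set A | exists l B,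
  [/\ uniq l, (forall i, i \in l -> J i), (forall i, E i (B i)) & A = cylinder l B]].

Let cyls_setI J : setI_closed (cyls J).
Proof.
move=> _ _ [l1 [B1 [u1 J1 E1 ->]]] [l2 [B2 [u2 J2 E2 ->]]].
(* An index lying in only one of the two lists receives the full space from the other. *)
exists (undup (l1 ++ l2)), (fun i => (if i \in l1 then B1 i else setT) `&`
  (if i \in l2 then B2 i else setT)); split.
- exact: undup_uniq.
- by move=> i; rewrite mem_undup mem_cat => /orP[/J1|/J2].
- by move=> i; apply: EI; case: ifP.
- apply/seteqP; split => [w [h1 h2] i _|w h].
    by split; case: ifPn => // il; [exact: h1|exact: h2].
  by split => i il; have := h i; rewrite mem_undup mem_cat il ?orbT => /(_ isT)[].
Qed.

Let cyls_measurable J : cyls J `<=` measurable.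
Proof. by move=> _ [l [B [_ _ hB ->]]]; apply: measurable_cylinder. Qed.

Let cyls_setT J : cyls J setT.
Proof.
by exists [::], (fun=> setT); split => //; apply/seteqP; split.
Qed.

Let past_cyls J : <<s past J >> `<=` <<s cyls J >>.
Proof.
apply: smallest_sub; first exact: smallest_sigma_algebra.
move=> A [i Ji EA]; apply: sub_sigma_algebra.
exists [:: i], (fun j => if j == i then A else setT); split => //.
- by move=> j; rewrite inE => /eqP ->.
- by move=> j; case: eqP => [->//|_].
- rewrite cylinder_cons eqxx; apply/seteqP; split => [w Aw|w []//].
  by split.
Qed.

Lemma measurable_past J : <<s past J >> `<=` measurable.
Proof.
apply: smallest_sub; first exact: sigma_algebra_measurable.
by move=> A [i _ /mE].
Qed.

(** With [B] fixed, both sides are finite measures in [A]. They agree on cylinders, hence on the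
    generated sigma-algebra. *)
Lemma past_indep J s A B : ~ J s -> <<s past J >> A -> E s B ->
  P (A `&` B) = (P A * P B)%E.
Proof.
move=> nJs JA EB.
have mB := mE EB.
have PBfin : P B \is a fin_num by exact: fin_num_measure.
pose b : {nonneg R} := NngNum (fine_ge0 (measure_ge0 P B)).
have := @g_sigma_algebra_measure_unique _ R W (cyls J) (@cyls_measurable J)
  (fun=> setT) (fun=> @cyls_setT J) _ (mrestr P mB) (mscale b P) (@cyls_setI J).
rewrite bigcup_const// => /(_ erefl) H.
suff : mrestr P mB A = mscale b P A by rewrite /mrestr /mscale/= fineK// muleC.
apply: H; last exact: past_cyls.
- move=> C [l [D [ul lJ hD ->]]].
  change (P (cylinder l D `&` B) = (fine (P B))%:E * P (cylinder l D))%E.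
  rewrite fineK//; have sl : s \notin l by apply/negP => /lJ.
  (* Placing [B] at the new index [s] leaves the cylinder over [l] unchanged and turns the
     intersection with [B] into a cylinder over [s :: l]. *)
  pose D' i := if i == s then B else D i.
  have eD : cylinder l D = cylinder l D'.
    apply: eq_cylinder => i il; rewrite /D'; case: eqP => // si.
    by rewrite -si il in sl.
  have ED' i : E i (D' i) by rewrite /D'; case: eqP => [->|].
  have -> : cylinder l D `&` B = cylinder (s :: l) D'.
    by rewrite cylinder_cons eD setIC /D' eqxx.
  have h1 := @cylinder_prob (s :: l) D' _ (fun i _ => ED' i).
  have h2 := @cylinder_prob l D' ul (fun i _ => ED' i).
  rewrite eD -(fineK (fin_num_measure P _ (measurable_cylinder (fun i _ => ED' i)))).
  rewrite h1 /=; last by rewrite sl.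
  rewrite big_cons -h2 {1}/D' eqxx EFinM fineK//; congr (_ * _)%E.
  by rewrite fineK// fin_num_measure//; exact: measurable_cylinder.
- move=> _; change (P (setT `&` B) < +oo)%E; rewrite setTI.
  by rewrite (le_lt_trans (probability_le1 P mB))// ltry.
Qed.

End PastIndependence.

(** * Measurability of vector-valued maps *)

Definition econtinuous {R : realType} n (F : 'rV[R]_n -> R) := forall u e, 0 < e ->
  exists2 d, 0 < d & forall v, enorm (v - u) <= d -> `|F v - F u| <= e.

Lemma enorm_lipschitz_econtinuous {R : realType} n (F : 'rV[R]_n -> R) K :
  (forall u v, `|F u - F v| <= K * enorm (u - v)) -> econtinuous F.
Proof.
move=> h u e e0; have K0 : 0 < `|K| + 1 by rewrite ltr_wpDl.
exists (e / (`|K| + 1)); first by rewrite divr_gt0.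
move=> v; rewrite ler_pdivlMr// mulrC => d; apply: le_trans d; apply: le_trans (h _ _) _.
by rewrite ler_wpM2r// (le_trans (ler_norm _))// lerDl.
Qed.

Section MeasurableVectors.
Context {R : realType} {d : measure_display} {T : measurableType d}.

Definition mvec n (X : T -> 'rV[R]_n) :=
  forall j, measurable_fun setT (fun w => X w 0 j).

Lemma measurable_rsum n (h : 'I_n -> T -> R) :
  (forall i, measurable_fun setT (h i)) ->
  measurable_fun setT (fun w => \sum_(i < n) h i w).
Proof.
move=> mh; have : measurable_fun setT (\sum_(i < n) h i).
  elim/big_ind : _ => [|a b ma mb|i _]; [exact: measurable_cst|exact: measurable_funD|exact: mh].
by apply: eq_measurable_fun => w _; rewrite fct_sumE.
Qed.

Lemma mvec_cst n (v : 'rV[R]_n) : mvec (fun=> v).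
Proof. by move=> j; exact: measurable_cst. Qed.

Lemma mvecD n (X Y : T -> 'rV[R]_n) : mvec X -> mvec Y -> mvec (fun w => X w + Y w).
Proof.
move=> mX mY j; have := measurable_funD (mX j) (mY j).
by apply: eq_measurable_fun => w _; rewrite mxE.
Qed.

Lemma mvecZ n c (X : T -> 'rV[R]_n) : mvec X -> mvec (fun w => c *: X w).
Proof.
move=> mX j; have := measurable_funM (measurable_cst c) (mX j).
by apply: eq_measurable_fun => w _; rewrite mxE.
Qed.

Lemma mvecN n (X : T -> 'rV[R]_n) : mvec X -> mvec (fun w => - X w).
Proof.
move=> /(mvecZ (-1)) h; rewrite (_ : (fun w => - X w) = fun w => -1 *: X w)//.
by apply/funext => w; rewrite scaleN1r.
Qed.

Lemma mvecB n (X Y : T -> 'rV[R]_n) : mvec X -> mvec Y -> mvec (fun w => X w - Y w).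
Proof. by move=> mX mY; apply: mvecD => //; exact: mvecN. Qed.

Lemma mvec_sum n m (X : 'I_m -> T -> 'rV[R]_n) : (forall i, mvec (X i)) ->
  mvec (fun w => \sum_(i < m) X i w).
Proof.
move=> mX j; have := measurable_rsum (fun i => mX i j).
by apply: eq_measurable_fun => w _; rewrite summxE.
Qed.

Lemma mvec_row_mx n m (X : T -> 'rV[R]_n) (Y : T -> 'rV[R]_m) :
  mvec X -> mvec Y -> mvec (fun w => row_mx (X w) (Y w)).
Proof.
move=> mX mY j; case: (fintype.splitP j) => k jk.
  have -> : j = lshift m k by exact: val_inj.
  by apply: eq_measurable_fun (mX k) => w _; rewrite row_mxEl.
have -> : j = rshift n k by exact: val_inj.
by apply: eq_measurable_fun (mY k) => w _; rewrite row_mxEr.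
Qed.

Lemma mvec_lin n m (L : {linear 'rV[R]_n -> 'rV[R]_m}) (X : T -> 'rV[R]_n) :
  mvec X -> mvec (fun w => L (X w)).
Proof.
move=> mX i; have := measurable_rsum
  (fun j => measurable_funM (mX j) (measurable_cst (L (delta_mx 0 j) 0 i))).
apply: eq_measurable_fun => w _; rewrite {1}(row_sum_delta (X w)) linear_sum/= summxE.
by apply: eq_bigr => j _; rewrite linearZ mxE.
Qed.

Lemma measurable_enorm_sqr n (X : T -> 'rV[R]_n) : mvec X ->
  measurable_fun setT (fun w => enorm (X w) ^+ 2).
Proof.
move=> mX; have := measurable_rsum (fun j => measurable_funM (mX j) (mX j)).
by apply: eq_measurable_fun => w _; rewrite enorm_sqr.
Qed.

Lemma measurable_countable_valued (Z : countType) (F : Z -> R) (X : T -> Z) :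
  (forall z, measurable (X @^-1` [set z])) -> measurable_fun setT (fun w => F (X w)).
Proof.
move=> mX _ Y mY; rewrite setTI.
rewrite (_ : _ @^-1` Y = \bigcup_m (if @unpickle Z m is Some z then
  (if F z \in Y then X @^-1` [set z] else set0) else set0)); last first.
  apply/seteqP; split => [w Yw|w [m _]].
    exists (pickle (X w)) => //; rewrite pickleK ifT//.
    exact/mem_set.
  by case: unpickle => // z; case: ifPn => // /set_mem Fz /= ->.
by apply: bigcupT_measurable => m; case: unpickle => // z; case: ifP.
Qed.

(** Round [X] down to the grid of mesh [1 / (k + 1)]. The rounded map takes countably many values,
    each on a measurable set, and [F] of it converges pointwise to [F (X w)]. *)
Lemma measurable_econtinuous n (F : 'rV[R]_n -> R) (X : T -> 'rV[R]_n) :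
  econtinuous F -> mvec X -> measurable_fun setT (fun w => F (X w)).
Proof.
move=> cF mX.
pose q k w : 'rV[int]_n := \row_j Num.floor (X w 0 j * k.+1%:R).
pose h k w := F (\row_j (((q k w) 0 j)%:~R / k.+1%:R)).
apply: (@measurable_fun_cvg _ _ _ _ h) => [k|w _].
- pose Fk (z : 'rV[int]_n) := F (\row_j ((z 0 j)%:~R / k.+1%:R)).
  apply: (@measurable_countable_valued _ Fk (q k)) => z.
  rewrite (_ : _ @^-1` _ = \big[setI/setT]_(j < n)
    ((fun w => X w 0 j * k.+1%:R) @^-1` `[(z 0 j)%:~R, (z 0 j + 1)%:~R[%classic)).
    apply: bigsetI_measurable => j _.
    have := measurable_funM (mX j) (measurable_cst (k.+1%:R : R)).
    by move=> /(_ measurableT _ (measurable_itv `[(z 0 j)%:~R, (z 0 j + 1)%:~R[)); rewrite setTI.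
  apply/seteqP; split => w.
    move=> <-; elim/big_ind : _ => // j _ /=.
    by rewrite mxE in_itv/= floor_le floorD1_gt.
  move=> H; apply/rowP => j; rewrite mxE.
  move: H; rewrite (bigD1 j)//= => -[+ _]; rewrite in_itv/= => /andP[h1 h2].
  by apply: floor_def; rewrite h1 h2.
- apply/cvgrPdist_le => e e0; have [dl dl0 hd] := cF (X w) e e0.
  have n0 : 0 < n%:R + 1 :> R by rewrite ltr_wpDl.
  near=> k; rewrite distrC; apply: hd.
  have kn : n%:R / k.+1%:R <= dl.
    have kd : k.+1%:R^-1 <= dl / (n%:R + 1).
      by apply/ltW; near: k; apply: (near_infty_natSinv_lt (PosNum (divr_gt0 dl0 n0))).
    rewrite ler_pdivlMr// in kd; apply: le_trans kd.
    by rewrite mulrC ler_wpM2l// lerDl.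
  apply: le_trans kn; apply: enorm_dual => [|v]; first by rewrite divr_ge0.
  rewrite (_ : n%:R / k.+1%:R * enorm v = \sum_(j < n) (k.+1%:R^-1 * enorm v)); last first.
    by rewrite sumr_const card_ord -[RHS]mulr_natl mulrA.
  apply: ler_sum => j _; apply: le_trans (ler_norm _) _; rewrite normrM.
  rewrite ler_pM ?coord_le_enorm// !mxE.
  have k0 : 0 < k.+1%:R :> R by [].
  rewrite -[leRHS]mul1r -ler_pdivrMr ?invr_gt0// invrK.
  rewrite -[X in _ * X]gtr0_norm// -normrM mulrBl divfK ?gt_eqF//.
  have := floor_le (X w 0 j * k.+1%:R); have := floorD1_gt (X w 0 j * k.+1%:R).
  rewrite intrD1 ler_norml; lra.
Unshelve. all: by end_near. Qed.

End MeasurableVectors.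

(** * First and second moments of one stochastic gradient *)

Section OracleNoise.
Context {R : realType} {dX : measure_display} {Xi : measurableType dX} {n : nat}.
Context {Q : probability Xi R} {G : 'rV[R]_n -> Xi -> 'rV[R]_n}.
Context {F : 'rV[R]_n -> R} {sigma : R}.
Hypothesis hG : unbiased_oracle Q G F sigma.

Lemma row_tnth_mktuple (u : 'rV[R]_n) : \row_i tnth [tuple u 0 i | i < n] i = u.
Proof. by apply/rowP => i; rewrite mxE tnth_mktuple. Qed.

Lemma mvec_oracle d (T : measurableType d) (U : T -> 'rV[R]_n) (xi : T -> Xi) :
  mvec U -> measurable_fun setT xi -> mvec (fun w => G (U w) (xi w)).
Proof.
move=> mU mxi j; have [/(_ j) mG _ _] := hG.
have mp : measurable_fun setT (fun w => ([tuple U w 0 i | i < n] : n.-tuple R, xi w)).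
  apply: measurable_fun_pair => //; apply/measurable_fun_tnthP => i.
  by apply: eq_measurable_fun (mU i) => w _; rewrite /= tnth_mktuple.
have := measurableT_comp mG mp.
by apply: eq_measurable_fun => w _ /=; rewrite row_tnth_mktuple.
Qed.

Let N u x := G u x - grad F u.

Lemma mvec_noise u : mvec (N u).
Proof.
apply: mvecB; last exact: mvec_cst.
by apply: mvec_oracle; [exact: mvec_cst|exact: measurable_id].
Qed.

Lemma noise_sqr u : (\int[Q]_x (enorm (N u x) ^+ 2)%:E <= (sigma ^+ 2)%:E)%E.
Proof. by have [_ _ /(_ u)] := hG; rewrite unlock. Qed.

Lemma noise_sqr_integrable u : Q.-integrable setT (fun x => (enorm (N u x) ^+ 2)%:E).
Proof.
apply/integrableP; split.
  by apply/measurable_EFinP; exact: measurable_enorm_sqr (mvec_noise u).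
under eq_integral do rewrite gee0_abs ?lee_fin ?sqr_ge0//.
by apply: le_lt_trans (noise_sqr u) _; rewrite ltry.
Qed.

Lemma noise_integrable u j : Q.-integrable setT (fun x => (N u x 0 j)%:E).
Proof.
(* [1 + t ^+ 2] dominates [t], so the variance bound makes every noise coordinate integrable. *)
have i1 : Q.-integrable setT (fun x => (1 + enorm (N u x) ^+ 2)%:E).
  under eq_fun do rewrite EFinD.
  apply: integrableD => //; first exact: finite_measure_integrable_cst.
  exact: noise_sqr_integrable.
apply: le_integrable i1 => //; first by apply/measurable_EFinP; exact: mvec_noise.
move=> x _; rewrite /= lee_fin [leRHS]ger0_norm ?addr_ge0 ?sqr_ge0//.
apply: le_trans (coord_le_enorm _ j) _.
have := sqr_ge0 (enorm (N u x) - 1); have := enorm_ge0 (N u x); nra.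
Qed.

Lemma noise_mean u j : (\int[Q]_x (N u x 0 j)%:E = 0)%E.
Proof.
have [_ /(_ u j) hE _] := hG; rewrite unlock in hE.
have i2 : Q.-integrable setT (fun=> (grad F u 0 j)%:E).
  exact: finite_measure_integrable_cst.
have i1 : Q.-integrable setT (fun x => (G u x 0 j)%:E).
  have := integrableD measurableT (noise_integrable u j) i2.
  by apply: eq_integrable => // x _; rewrite /N !mxE -EFinD subrK.
rewrite (eq_integral (fun x => (G u x 0 j)%:E - (grad F u 0 j)%:E)%E); last first.
  by move=> x _; rewrite /N !mxE EFinB.
rewrite integralB// hE integral_cst//= probability_setT mule1.
by rewrite subee.
Qed.

(** The cross term is linear in the noise and has mean zero. The map [L] will be one of the two
    block projections. *)
Lemma noise_second_moment m (L : {linear 'rV[R]_n -> 'rV[R]_m}) u v (c : R) :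
  (forall z, enorm (L z) <= enorm z) ->
  (\int[Q]_x (enorm (v + c *: L (N u x)) ^+ 2)%:E
    <= (enorm v ^+ 2 + c ^+ 2 * sigma ^+ 2)%:E)%E.
Proof.
move=> hL.
(* The coefficients of the cross term in the noise coordinates, so that unbiasedness can be used
   coordinate by coordinate. *)
pose a j := 2 * c * dot v (L (delta_mx 0 j)).
have iS : Q.-integrable setT (fun x => (\sum_(j < n) (a j)%:E * (N u x 0 j)%:E)%E).
  by apply: integrable_sum => // j _; apply: integrableZl => //; exact: noise_integrable.
have iC : Q.-integrable setT (fun=> (enorm v ^+ 2)%:E).
  exact: finite_measure_integrable_cst.
have iN : Q.-integrable setT (fun x => ((c ^+ 2)%:E * (enorm (N u x) ^+ 2)%:E)%E).
  by apply: integrableZl => //; exact: noise_sqr_integrable.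
pose h x : \bar R := ((enorm v ^+ 2)%:E + \sum_(j < n) (a j)%:E * (N u x 0 j)%:E +
  (c ^+ 2)%:E * (enorm (N u x) ^+ 2)%:E)%E.
have E x : dot v (c *: L (N u x)) *+ 2 = \sum_(j < n) a j * N u x 0 j.
  rewrite {1}(row_sum_delta (N u x)) linear_sum/= dotZr /dot.
  have -> : \sum_(i < m) v 0 i * (\sum_(j < n) L (N u x 0 j *: 'e_j)) 0 i =
     \sum_(j < n) N u x 0 j * dot v (L 'e_j).
    rewrite /dot; under [RHS]eq_bigr do rewrite mulr_sumr.
    rewrite exchange_big/=; apply: eq_bigr => i _.
    rewrite summxE mulr_sumr; apply: eq_bigr => j _.
    by rewrite linearZ mxE mulrCA.
  by rewrite -mulr_natl mulrA mulr_sumr; apply: eq_bigr => j _; rewrite /a; ring.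
have hE x : ((enorm (v + c *: L (N u x)) ^+ 2)%:E <= h x)%E.
  rewrite /h (eq_bigr (fun j => (a j * N u x 0 j)%:E)) => [|j _]; last by rewrite EFinM.
  rewrite sumEFin -EFinM -!EFinD lee_fin enormD_sqr -E mulr_natl lerD2l.
  rewrite enormZ exprMn real_normK ?num_real// ler_wpM2l ?sqr_ge0//.
  by rewrite ler_sqr ?nnegrE.
have mv : mvec (fun x => v + c *: L (N u x)).
  apply: mvecD; first exact: mvec_cst.
  by apply: mvecZ; apply: mvec_lin; exact: mvec_noise.
have ih : Q.-integrable setT h by apply: integrableD => //; exact: integrableD.
apply: (@le_trans _ _ (\int[Q]_x h x)%E).
  apply: ge0_le_integral => //.
  - by move=> x _; rewrite lee_fin sqr_ge0.
  - by apply/measurable_EFinP; exact: measurable_enorm_sqr.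
  - exact: measurable_int ih.
rewrite /h integralD//; last exact: integrableD.
rewrite integralD// integral_cst//= probability_setT mule1.
rewrite integral_sum//; last first.
  by move=> j; apply: integrableZl => //; exact: noise_integrable.
rewrite big1 ?adde0 => [|j _]; last first.
  by rewrite integralZl//; [rewrite noise_mean mule0|exact: noise_integrable].
rewrite integralZl//; last exact: noise_sqr_integrable.
rewrite EFinD (EFinM (c ^+ 2)) leeD2l// lee_wpmul2l ?lee_fin ?sqr_ge0//.
exact: noise_sqr.
Qed.

End OracleNoise.

HB.instance Definition _ := gen_eqMixin f_slot.
HB.instance Definition _ := gen_eqMixin g_slot.

Definition slot : eqType := (f_slot + g_slot)%type.

(** * The filtration generated by the draws *)

Section Sampling.
Context {R : realType} {dF dG dW : measure_display}.
Context {Xf : measurableType dF} {Xg : measurableType dG} {W : measurableType dW}.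
Context {Qf : probability Xf R} {Qg : probability Xg R} {P : probability W R}.
Context {xif : f_slot -> W -> Xf} {xig : g_slot -> W -> Xg}.
Hypothesis hiid : iid_samples P Qf Qg xif xig.

Local Notation ev := (sample_events xif xig : slot -> set (set W)).

(* The sample space with the sigma-algebra generated by the draws in [J]. *)
Definition Wpast (J : set slot) := g_sigma_algebraType (past (E := ev) J).

Lemma ev_measurable s : ev s `<=` measurable.
Proof.
by case: hiid => hf hg _; case: s => a A [B mB <-]/=;
  rewrite setTI -[X in measurable X]setTI; [apply: (hf a).1|apply: (hg a).1].
Qed.

Lemma ev_setT s : ev s setT.
Proof. by case: s => a /=; exists setT; rewrite ?setTI ?preimage_setT. Qed.

Lemma ev_setI s : setI_closed (ev s).
Proof.
by case: s => a _ _ [A mA <-] [B mB <-] /=;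
  exists (A `&` B); rewrite ?setTI//; exact: measurableI.
Qed.

Definition event J (A : set W) := measurable (A : set (Wpast J)).

Lemma event_measurable J A : event J A -> measurable A.
Proof. exact: (measurable_past ev_measurable). Qed.

Lemma event_sub J J' A : J `<=` J' -> event J A -> event J' A.
Proof.
move=> JJ'; apply: smallest_sub; first exact: smallest_sigma_algebra.
by move=> B [i Ji EB]; apply: sub_sigma_algebra; exists i => //; exact: JJ'.
Qed.

Lemma measurable_Wpast d (X : measurableType d) J (f : W -> X) :
  measurable_fun [set: Wpast J] f -> measurable_fun [set: W] f.
Proof.
by move=> mf _ B mB; apply: (@event_measurable J); apply: mf.
Qed.

Lemma measurable_Wpast_sub d (X : measurableType d) J J' (f : W -> X) : J `<=` J' ->
  measurable_fun [set: Wpast J] f -> measurable_fun [set: Wpast J'] f.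
Proof. by move=> JJ' mf _ B mB; apply: (event_sub JJ'); apply: mf. Qed.

Definition adapted J n (X : W -> 'rV[R]_n) := @mvec R _ (Wpast J) n X.

Lemma adapted_sub J J' n (X : W -> 'rV[R]_n) : J `<=` J' ->
  adapted J X -> adapted J' X.
Proof. by move=> JJ' aX j; apply: (measurable_Wpast_sub JJ'); exact: aX. Qed.

Lemma adapted_mvec J n (X : W -> 'rV[R]_n) : adapted J X -> mvec X.
Proof. by move=> aX j; apply: (@measurable_Wpast _ _ J); exact: aX. Qed.

(** Hides whether a slot belongs to [f] or to [g], so that a single noise lemma serves both
    oracles. *)
Definition draw_of d (Xi : measurableType d) (Q : probability Xi R) (s : slot)
    (xi : W -> Xi) : Prop :=
  has_law P Q xi /\ ev s = preimage_set_system setT xi measurable.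

Lemma draw_f a : draw_of Qf (inl a) (xif a).
Proof. by split => //; case: hiid. Qed.

Lemma draw_g a : draw_of Qg (inr a) (xig a).
Proof. by split => //; case: hiid. Qed.

Section Noise.
Context {d : measure_display} {Xi : measurableType d} {Q : probability Xi R}.
Context {n : nat} {G : 'rV[R]_n -> Xi -> 'rV[R]_n} {F : 'rV[R]_n -> R} {sigma : R}.
Hypothesis hG : unbiased_oracle Q G F sigma.

Lemma measurable_draw J s xi : draw_of Q s xi -> J s ->
  measurable_fun [set: Wpast J] xi.
Proof.
move=> [_ Es] Js _ B mB; apply: sub_sigma_algebra; exists s => //.
by rewrite Es; exists B.
Qed.

Lemma adapted_oracle J s xi (U : W -> 'rV[R]_n) : draw_of Q s xi -> J s ->
  adapted J U -> adapted J (fun w => G (U w) (xi w)).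
Proof.
by move=> hxi Js aU; apply: (mvec_oracle hG) => //; exact: measurable_draw hxi Js.
Qed.

Context {m : nat} {L : {linear 'rV[R]_n -> 'rV[R]_m}}.
Hypothesis hL : forall z, enorm (L z) <= enorm z.

(** Freezing reduces the claim to [noise_second_moment] at each point of the past. The arbitrary
    event [A] is what later admits a random number of inner steps. *)
Lemma noise_step J U A s xi (V : W -> 'rV[R]_m) (c : R) :
  adapted J U -> adapted J (fun w => grad F (U w)) -> event J A ->
  draw_of Q s xi -> ~ J s -> adapted J V ->
  (\int[P]_(w in A) (enorm (V w + c *: L (G (U w) (xi w) - grad F (U w))) ^+ 2)%:E
   <= \int[P]_(w in A) (enorm (V w) ^+ 2)%:E + (c ^+ 2 * sigma ^+ 2)%:E * P A)%E.
Proof.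
move=> aU aF eA [[mxi lxi] Es] nJs aV.
(* The identity, regarded as a map into the same space with the coarser sigma-algebra of the
   past. *)
pose pi : W -> Wpast J := fun w => w.
have mpi : measurable_fun setT pi.
  by move=> _ B mB; rewrite setTI; exact: (event_measurable mB).
have ind B C : measurable B -> measurable C ->
    P (pi @^-1` B `&` xi @^-1` C) = (P (pi @^-1` B) * Q C)%E.
  move=> mB mC; rewrite -lxi//; apply: (past_indep ev_measurable ev_setT ev_setI _ nJs).
  - by case: hiid.
  - exact: mB.
  - by rewrite Es; exists C => //; rewrite setTI.
pose h (p : (Wpast J * Xi)%type) : \bar R :=
  (enorm (V p.1 + c *: L (G (U p.1) p.2 - grad F (U p.1))) ^+ 2)%:E.
have mfst k (X : W -> 'rV[R]_k) : adapted J X ->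
    mvec (fun p : (Wpast J * Xi)%type => X p.1).
  by move=> aX j; exact: (measurableT_comp (aX j) measurable_fst).
have mh : measurable_fun [set: (Wpast J * Xi)%type] h.
  apply/measurable_EFinP; apply: measurable_enorm_sqr.
  apply: mvecD; first exact: mfst.
  apply: mvecZ; apply: mvec_lin; apply: mvecB; last exact: (mfst _ (fun w => grad F (U w))).
  by apply: (mvec_oracle hG); [exact: mfst|exact: measurable_snd].
have h0 p : (0 <= h p)%E by rewrite lee_fin sqr_ge0.
have mA := event_measurable eA.
have -> := freezing_in mpi mxi ind eA mh h0.
have mV : measurable_fun A (fun w => (enorm (V w) ^+ 2)%:E).
  apply/measurable_EFinP; apply: measurable_funTS.
  exact: (measurable_enorm_sqr (adapted_mvec aV)).
apply: (@le_trans _ _ (\int[P]_(w in A)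
   ((enorm (V w) ^+ 2)%:E + (c ^+ 2 * sigma ^+ 2)%:E))%E).
  apply: ge0_le_integral => //.
  - by move=> w _; exact: integral_ge0.
  - have mF := @measurable_fun_fubini_tonelli_F _ _ _ _ _ Q h mh h0.
    exact: (measurable_funTS (measurableT_comp mF mpi)).
  - exact: emeasurable_funD.
  - move=> w _; rewrite /h /pi /= -EFinD.
    exact: (noise_second_moment hG (U w) (V w) c hL).
have V0 w : A w -> (0 <= (enorm (V w) ^+ 2)%:E)%E by rewrite lee_fin sqr_ge0.
have c0 w : A w -> (0 <= (c ^+ 2 * sigma ^+ 2)%:E)%E.
  by rewrite lee_fin mulr_ge0 ?sqr_ge0.
rewrite (ge0_integralD P mA V0 mV c0 (measurable_cst _)).
by rewrite integral_cst.
Qed.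

Lemma adapted_noise J s xi (U : W -> 'rV[R]_n) : J s -> draw_of Q s xi ->
  adapted J U -> adapted J (fun w => grad F (U w)) ->
  adapted J (fun w => L (G (U w) (xi w) - grad F (U w))).
Proof.
move=> Js hxi aU aF; apply: mvec_lin; apply: mvecB => //.
exact: adapted_oracle hxi Js aU.
Qed.

(** The draws of the batch join the past one at a time, each adding the variance of one draw scaled
    by [c / B]. The factor [1 / B] thus results from [B] applications of [noise_step]. *)
Lemma batch_step J U A (s : nat -> slot) (xi : nat -> W -> Xi)
    (V : W -> 'rV[R]_m) (c : R) B :
  (0 < B)%N -> injective s -> (forall i, draw_of Q (s i) (xi i)) ->
  (forall i, ~ J (s i)) ->
  adapted J U -> adapted J (fun w => grad F (U w)) -> event J A -> adapted J V ->
  (\int[P]_(w in A) (enorm (V w + c *: (batch_mean B (fun i => L (G (U w) (xi i w)))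
      - L (grad F (U w)))) ^+ 2)%:E
   <= \int[P]_(w in A) (enorm (V w) ^+ 2)%:E + (c ^+ 2 * sigma ^+ 2 / B%:R)%:E * P A)%E.
Proof.
move=> B0 sinj hxi nJ aU aF eA aV.
pose N i w := L (G (U w) (xi i w) - grad F (U w)).
pose Jk k := J `|` [set s i | i in [set i | (i < k)%N]].
have JJk k : J `<=` Jk k by move=> x; left.
have Bn0 : B%:R != 0 :> R by rewrite pnatr_eq0 -lt0n.
have main k : adapted (Jk k) (fun w => V w + (c / B%:R) *: \sum_(i < k) N i w) /\
   (\int[P]_(w in A) (enorm (V w + (c / B%:R) *: \sum_(i < k) N i w) ^+ 2)%:E
    <= \int[P]_(w in A) (enorm (V w) ^+ 2)%:E +
       (k%:R * ((c / B%:R) ^+ 2 * sigma ^+ 2))%:E * P A)%E.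
  elim: k => [|k [IH1 IH2]].
    have E : (fun w => V w + (c / B%:R) *: \sum_(i < 0) N i w) = V.
      by apply/funext => w; rewrite big_ord0 scaler0 addr0.
    rewrite E; split; first exact: adapted_sub aV.
    by rewrite mul0r mul0e adde0; under eq_integral do rewrite big_ord0 scaler0 addr0.
  have E w : V w + (c / B%:R) *: \sum_(i < k.+1) N i w =
      V w + (c / B%:R) *: \sum_(i < k) N i w + (c / B%:R) *: N k w.
    by rewrite big_ord_recr/= scalerDr addrA.
  have Jkk : Jk k `<=` Jk k.+1.
    by move=> x [Jx|[i /= ik <-]]; [left|right; exists i => //=; exact: ltnW].
  split.
    rewrite (funext E); apply: mvecD; first exact: adapted_sub Jkk IH1.
    apply: mvecZ; apply: adapted_noise (hxi k) _ _.
    - by right; exists k => /=.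
    - exact: adapted_sub aU.
    - exact: adapted_sub aF.
  under eq_integral do rewrite E.
  have nJk : ~ Jk k (s k).
    by move=> [/nJ//|[i /= ik /sinj ki]]; rewrite ki ltnn in ik.
  apply: le_trans (noise_step (c / B%:R) (adapted_sub (JJk k) aU)
    (adapted_sub (JJk k) aF) (event_sub (JJk k) eA) (hxi k) nJk IH1) _.
  apply: le_trans (leeD2r _ IH2) _.
  rewrite -addeA leeD2l// -muleDl// -?EFinD -?natr1; last first.
    by apply: fin_num_measure; exact: event_measurable eA.
  by rewrite mulrDl mul1r.
have [_ h] := main B.
have E w : V w + c *: (batch_mean B (fun i => L (G (U w) (xi i w))) - L (grad F (U w)))
   = V w + (c / B%:R) *: \sum_(i < B) N i w.
  congr (_ + _); rewrite -scalerA; congr (_ *: _).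
  rewrite /batch_mean /N; under [in RHS]eq_bigr do rewrite linearB.
  rewrite big_split/= sumr_const card_ord scalerDr; congr (_ + _).
  by rewrite -[- _ *+ B]scaler_nat scalerA mulVf// scale1r.
under eq_integral do rewrite E.
apply: le_trans h _; rewrite le_eqVlt; apply/orP; left; apply/eqP.
by congr (_ + _%:E * _)%E; field.
Qed.

End Noise.
End Sampling.

(** * One iteration of the algorithm *)

(* Draws made before inner step [k] of iteration [t]; within a step, the batch of [f]
   (flag [b]) is ordered before the batches of [g]. *)
Definition inner_past (t k : nat) (b : bool) (s : slot) : bool :=
  match s with
  | inl (f_inner t' k' _) => (t' < t)%N || ((t' == t) && ((k' < k)%N || (b && (k' == k))))
  | inr (g_inner_y t' k' _) | inr (g_inner_z t' k' _) => (t' < t)%N || ((t' == t) && (k' < k)%N)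
  | inl (f_outer t' _) | inr (g_outer_y t' _) | inr (g_outer_z t' _) => (t' < t)%N
  end.

(* Draws made when [j] of the three outer batches of iteration [t] are drawn. *)
Definition outer_past (t j : nat) (s : slot) : bool :=
  match s with
  | inl (f_inner t' _ _) | inr (g_inner_y t' _ _) | inr (g_inner_z t' _ _) => (t' <= t)%N
  | inl (f_outer t' _) => (t' < t)%N || ((t' == t) && (1 <= j)%N)
  | inr (g_outer_y t' _) => (t' < t)%N || ((t' == t) && (2 <= j)%N)
  | inr (g_outer_z t' _) => (t' < t)%N || ((t' == t) && (3 <= j)%N)
  end.

Local Notation Jin t k b := ([set s | inner_past t k b s]).
Local Notation Jout t j := ([set s | outer_past t j s]).

Lemma inner_past_sub t k (b : bool) k' (b' : bool) : (k < k')%N || ((k == k') && (b ==> b')) ->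
  Jin t k b `<=` Jin t k' b'.
Proof.
move=> h [[t1 k1 i|t1 i]|[t1 k1 i|t1 k1 i|t1 i|t1 i]] /=;
  by move: h; case: b; case: b'; lia.
Qed.

Lemma inner_outer_past t k b : Jin t k b `<=` Jout t 0.
Proof. by move=> [[t1 k1 i|t1 i]|[t1 k1 i|t1 k1 i|t1 i|t1 i]] /=; case: b; lia. Qed.

Lemma outer_past_sub t j j' : (j <= j')%N -> Jout t j `<=` Jout t j'.
Proof. by move=> h [[t1 k1 i|t1 i]|[t1 k1 i|t1 k1 i|t1 i|t1 i]] /=; lia. Qed.

Lemma outer_past_next t j : Jout t j `<=` Jin t.+1 0 false.
Proof. by move=> [[t1 k1 i|t1 i]|[t1 k1 i|t1 k1 i|t1 i|t1 i]] /=; lia. Qed.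

(** * Quantities stopped at a random index *)

Section RandomIndex.
Context {R : realType} {d : measure_display} {W : measurableType d} {P : probability W R}.

Lemma measurable_random_index d' (T : measurableType d') (K : W -> nat) (h : nat -> W -> T) :
  (forall k, measurable [set w | K w = k]) -> (forall k, measurable_fun setT (h k)) ->
  measurable_fun setT (fun w => h (K w) w).
Proof.
move=> mK mh _ B mB; rewrite setTI.
rewrite (_ : _ @^-1` B = \bigcup_k ([set w | K w = k] `&` (h k @^-1` B))).
  apply: bigcupT_measurable => k; apply: measurableI => //.
  by rewrite -[X in measurable X]setTI; exact: mh.
by apply/seteqP; split => [w /= Bw|w [k _ [/= <-]]//]; exists (K w).
Qed.

(** The events [K = k] partition the space, and on each of them the random index is a constant. *)
Lemma integral_random_index (K : W -> nat) (h h' : nat -> W -> R) :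
  (forall k, measurable [set w | K w = k]) ->
  (forall k, measurable_fun setT (h k)) -> (forall k, measurable_fun setT (h' k)) ->
  (forall k w, 0 <= h k w) -> (forall k w, 0 <= h' k w) ->
  (forall k, \int[P]_(w in [set w | K w = k]) (h k w)%:E <=
     \int[P]_(w in [set w | K w = k]) (h' k w)%:E)%E ->
  (\int[P]_w (h (K w) w)%:E <= \int[P]_w (h' (K w) w)%:E)%E.
Proof.
move=> mK mh mh' h0 h'0 hh.
pose D k := [set w | K w = k].
have DT : \bigcup_k D k = [set: W] by apply/seteqP; split => // w _; exists (K w).
have tD : trivIset setT D.
  apply/trivIsetP => i j _ _ /eqP ij; apply/seteqP; split => // w [/= Ki Kj].
  by apply: ij; rewrite -Ki -Kj.
have E (f : nat -> W -> R) : (forall k, measurable_fun setT (f k)) ->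
    (forall k w, 0 <= f k w) ->
    (\int[P]_w (f (K w) w)%:E = \sum_(k <oo) \int[P]_(w in D k) (f k w)%:E)%E.
  move=> mf f0; rewrite -DT ge0_integral_bigcup//.
  - by apply: eq_eseriesr => k _; apply: eq_integral => w /set_mem /= ->.
  - rewrite DT; apply/measurable_EFinP; exact: measurable_random_index.
  - by move=> w _; rewrite lee_fin.
rewrite !E//; apply: lee_nneseries => [k _ _|k _]; last exact: hh.
by apply: integral_ge0 => w _; rewrite lee_fin.
Qed.

Lemma integral_affine A (h : W -> R) (a b : R) : measurable A ->
  measurable_fun setT h -> (forall w, 0 <= h w) -> 0 <= a -> 0 <= b ->
  (\int[P]_(w in A) (a * h w + b)%:E =
   a%:E * \int[P]_(w in A) (h w)%:E + b%:E * P A)%E.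
Proof.
move=> mA mh h0 a0 b0.
have mhA : measurable_fun A (EFin \o h) by apply/measurable_EFinP; exact: measurable_funTS.
have h0' w : A w -> (0 <= (h w)%:E)%E by rewrite lee_fin.
have ah0 w : A w -> (0 <= a%:E * (h w)%:E)%E by rewrite -EFinM lee_fin mulr_ge0.
have b0' w : A w -> (0 <= b%:E)%E by rewrite lee_fin.
have mah : measurable_fun A (fun w => a%:E * (h w)%:E)%E by exact: measurable_funeM.
under eq_integral do rewrite EFinD EFinM.
rewrite (ge0_integralD P mA ah0 mah b0' (measurable_cst _)).
by rewrite integral_cst// (ge0_integralZl_EFin P mA h0' mhA a0).
Qed.

Lemma integral_le A (h h' : W -> R) : measurable A ->
  measurable_fun setT h -> measurable_fun setT h' -> (forall w, 0 <= h w) ->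
  (forall w, A w -> h w <= h' w) ->
  (\int[P]_(w in A) (h w)%:E <= \int[P]_(w in A) (h' w)%:E)%E.
Proof.
move=> mA mh mh' h0 hh; apply: ge0_le_integral => //.
- by move=> w _; rewrite lee_fin.
- by apply/measurable_EFinP; exact: measurable_funTS.
- by apply/measurable_EFinP; exact: measurable_funTS.
Qed.

Lemma measurable_affine (h : W -> R) (a b : R) : measurable_fun setT h ->
  measurable_fun setT (fun w => a * h w + b).
Proof.
by move=> mh; apply: measurable_funD => //; apply: measurable_funM.
Qed.

(** [s / (1 - rho)] is the fixed point of [r |-> rho * r + s]. The integral of [h] may be infinite,
    so the induction stays in the extended reals. *)
Lemma integral_geometric A (h : nat -> W -> R) (rho s : R) : measurable A ->
  (forall k, measurable_fun setT (h k)) -> (forall k w, 0 <= h k w) ->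
  0 <= rho -> rho < 1 -> 0 <= s ->
  (forall k, \int[P]_(w in A) (h k.+1 w)%:E <= \int[P]_(w in A) (rho * h k w + s)%:E)%E ->
  forall k, (\int[P]_(w in A) (h k w)%:E <=
    \int[P]_(w in A) (rho ^+ k * h 0 w + s / (1 - rho))%:E)%E.
Proof.
move=> mA mh h0 r0 r1 s0 hh.
have s1 : 0 <= s / (1 - rho) by rewrite divr_ge0// subr_ge0 ltW.
have r1' : 1 - rho != 0 by rewrite subr_eq0 gt_eqF.
elim=> [|k IH].
  apply: integral_le => // [|w _]; first exact: measurable_affine.
  by rewrite expr0 mul1r lerDl.
apply: le_trans (hh k) _; rewrite !integral_affine ?exprn_ge0// in IH *.
have IH' := lee_wpmul2l (x := rho%:E) r0 IH.
apply: le_trans (leeD2r _ IH') _.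
have f1 : P A \is a fin_num by exact: fin_num_measure.
rewrite muleDr ?ge0_adde_def ?inE ?mule_ge0 ?lee_fin ?exprn_ge0 ?integral_ge0//.
- have -> : ((rho ^+ k.+1)%:E * \int[P]_(w in A) (h 0 w)%:E =
      rho%:E * ((rho ^+ k)%:E * \int[P]_(w in A) (h 0 w)%:E))%E.
    by rewrite exprS EFinM muleA.
  rewrite -addeA leeD2l// muleA -EFinM -muleDl// -EFinD.
  rewrite le_eqVlt; apply/orP; left; apply/eqP; congr (_%:E * _)%E.
  by field.
- by move=> w _; rewrite lee_fin.
Qed.

End RandomIndex.

(** * The iterates as adapted random variables *)

Section Run.
Context {R : realType} {dF dG dW : measure_display}.
Context {Xf : measurableType dF} {Xg : measurableType dG} {W : measurableType dW}.
Context {Qf : probability Xf R} {Qg : probability Xg R} {P : probability W R}.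
Context {xif : f_slot -> W -> Xf} {xig : g_slot -> W -> Xg}.
Hypothesis hiid : iid_samples P Qf Qg xif xig.
Context {dx dy : nat} {f g : 'rV[R]_(dx + dy) -> R}.
Context {Gf : 'rV[R]_(dx + dy) -> Xf -> 'rV[R]_(dx + dy)}.
Context {Gg : 'rV[R]_(dx + dy) -> Xg -> 'rV[R]_(dx + dy)}.
Context {sigmaf sigmag : R}.
Hypothesis hGf : unbiased_oracle Qf Gf f sigmaf.
Hypothesis hGg : unbiased_oracle Qg Gg g sigmag.
Context {mu Cf Lf Lg rhog : R}.
Hypothesis hdx : (0 < dx)%N.
Hypothesis hdy : (0 < dy)%N.
Hypothesis hmu : 0 < mu.
Hypothesis hg_sc : strongly_convex_in_y mu g.
Hypothesis hg_grad : lipschitz_grad Lg g.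
Hypothesis hg_hess : lipschitz_hess rhog g.
Hypothesis hf_lip : lipschitz_in_y Cf f.
Hypothesis hf_grad : lipschitz_grad Lf f.
Context {p : @f2bsa_params R}.
Hypothesis hlam : 0 < lam p.
Hypothesis hlam_mu : Lf / lam p <= mu / 2.
Hypothesis hB_in : (0 < B_in p)%N.
Hypothesis hB_out : (0 < B_out p)%N.
Hypothesis heta_y : eta_y p = (2 * lam p * Lg)^-1.
Hypothesis heta_z : eta_z p = (2 * lam p * Lg)^-1.
Context {c1 c2 : R}.
Hypothesis hdelta : forall delta dist, delta_next p delta dist =
  delta / 2 + c1 * dist ^+ 2 + c2.
Hypothesis hK : forall k, measurable [set delta | inner_steps p delta = k].
Context {x0 : 'rV[R]_dx} {y0 : 'rV[R]_dy}.

Local Notation ev := (sample_events xif xig : slot -> set (set W)).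
Local Notation adapted := (@adapted R _ _ _ Xf Xg W xif xig).
Local Notation event := (@event _ _ _ Xf Xg W xif xig).
Local Notation measurable_past J := (@measurable_fun _ _ (@Wpast _ _ _ Xf Xg W xif xig J) R setT).
Local Notation sf w := (fun a => xif a w).
Local Notation sg w := (fun a => xig a w).

Definition run t w := f2bsa Gf Gg p (sf w) (sg w) x0 y0 t.
Definition run_x t w := st_x (run t w).
Definition run_y t w := st_y (run t w).
Definition run_z t w := st_z (run t w).
Definition run_delta t w := st_delta (run t w).
Definition run_K t w := inner_steps p (run_delta t w).
Definition run_inner_y t k w := inner_y Gf Gg p (sf w) (sg w) t (run_x t w) (run_y t w) k.
Definition run_inner_z t k w := inner_z Gg p (sg w) t (run_x t w) (run_z t w) k.
Definition run_G t w := outer_grad Gf Gg p (sf w) (sg w) t (run_x t w)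
  (run_y t.+1 w) (run_z t.+1 w).

Lemma run_xS t w : run_x t.+1 w = run_x t w - eta_x p *: run_G t w.
Proof. by []. Qed.

Lemma run_inner_yS t k w : run_inner_y t k.+1 w = run_inner_y t k w - eta_y p *:
  (batch_mean (B_in p) (fun i => rsubmx
     (Gf (row_mx (run_x t w) (run_inner_y t k w)) (xif (f_inner t k i) w))) +
   lam p *: batch_mean (B_in p) (fun i => rsubmx
     (Gg (row_mx (run_x t w) (run_inner_y t k w)) (xig (g_inner_y t k i) w)))).
Proof. by []. Qed.

Lemma run_inner_zS t k w : run_inner_z t k.+1 w = run_inner_z t k w -
  (eta_z p * lam p) *: batch_mean (B_in p) (fun i => rsubmx
     (Gg (row_mx (run_x t w) (run_inner_z t k w)) (xig (g_inner_z t k i) w))).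
Proof. by []. Qed.

Lemma run_GE t w : run_G t w =
  batch_mean (B_out p) (fun i => lsubmx
    (Gf (row_mx (run_x t w) (run_y t.+1 w)) (xif (f_outer t i) w))) +
  lam p *: (batch_mean (B_out p) (fun i => lsubmx
    (Gg (row_mx (run_x t w) (run_y t.+1 w)) (xig (g_outer_y t i) w))) -
  batch_mean (B_out p) (fun i => lsubmx
    (Gg (row_mx (run_x t w) (run_z t.+1 w)) (xig (g_outer_z t i) w)))).
Proof. by []. Qed.

Lemma run_deltaS t w : run_delta t.+1 w =
  run_delta t w / 2 + c1 * enorm (run_x t.+1 w - run_x t w) ^+ 2 + c2.
Proof. by rewrite {1}/run_delta /= hdelta. Qed.

Lemma adapted_grad J n L (F : 'rV[R]_n -> R) (U : W -> 'rV[R]_n) :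
  lipschitz_grad L F -> adapted J U -> adapted J (fun w => grad F (U w)).
Proof.
move=> [_ hF] aU j; apply: (@measurable_econtinuous _ _ _ _ (fun u => grad F u 0 j)) => //.
apply: (@enorm_lipschitz_econtinuous _ _ _ L) => u v.
apply: le_trans (hF u v); apply: le_trans (coord_le_enorm _ j).
by rewrite !mxE.
Qed.

Lemma adapted_comp J n m (H : 'rV[R]_n -> 'rV[R]_m) K (U : W -> 'rV[R]_n) :
  (forall u v, enorm (H u - H v) <= K * enorm (u - v)) -> adapted J U ->
  adapted J (fun w => H (U w)).
Proof.
move=> hH aU j; apply: (@measurable_econtinuous _ _ _ _ (fun u => H u 0 j)) => //.
apply: (@enorm_lipschitz_econtinuous _ _ _ K) => u v.
apply: le_trans (hH u v); apply: le_trans (coord_le_enorm _ j).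
by rewrite !mxE.
Qed.

Lemma adapted_batch d (Xi : measurableType d) (Q : probability Xi R) n m J
    (G : 'rV[R]_n -> Xi -> 'rV[R]_n) (F : 'rV[R]_n -> R) sigma
    (L : {linear 'rV[R]_n -> 'rV[R]_m}) (s : nat -> slot) (xi : nat -> W -> Xi)
    (U : W -> 'rV[R]_n) B :
  unbiased_oracle Q G F sigma ->
  (forall i, @draw_of _ _ _ _ Xf Xg W P xif xig _ Xi Q (s i) (xi i)) ->
  (forall i, J (s i)) -> adapted J U ->
  adapted J (fun w => batch_mean B (fun i => L (G (U w) (xi i w)))).
Proof.
move=> hG hs Js aU; apply: mvecZ; apply: mvec_sum => i; apply: mvec_lin.
exact: (adapted_oracle hG (hs i) (Js i) aU).
Qed.

Lemma adapted_inner_y t k :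
  adapted (Jin t 0 false) (run_x t) -> adapted (Jin t 0 false) (run_y t) ->
  adapted (Jin t k false) (run_inner_y t k).
Proof.
move=> ax ay; elim: k => [|k IH]; first exact: ay.
have sub1 : Jin t k false `<=` Jin t k.+1 false by apply: inner_past_sub; lia.
have sub2 : Jin t 0 false `<=` Jin t k.+1 false by apply: inner_past_sub; lia.
have aU : adapted (Jin t k.+1 false) (fun w => row_mx (run_x t w) (run_inner_y t k w)).
  by apply: mvec_row_mx; [exact: adapted_sub ax|exact: adapted_sub IH].
rewrite (funext (run_inner_yS t k)); apply: mvecB; first exact: adapted_sub IH.
apply: mvecZ; apply: mvecD; last apply: mvecZ.
- apply: (adapted_batch rsubmx (s := fun i => inl (f_inner t k i))
    (xi := fun i => xif (f_inner t k i))
      (U := fun w => row_mx (run_x t w) (run_inner_y t k w)) (B_in p) hGf) => // [i|i /=].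
    exact: (draw_f hiid).
  by lia.
- apply: (adapted_batch rsubmx (s := fun i => inr (g_inner_y t k i))
    (xi := fun i => xig (g_inner_y t k i))
      (U := fun w => row_mx (run_x t w) (run_inner_y t k w)) (B_in p) hGg) => // [i|i /=].
    exact: (draw_g hiid).
  by lia.
Qed.

Lemma adapted_inner_z t k :
  adapted (Jin t 0 false) (run_x t) -> adapted (Jin t 0 false) (run_z t) ->
  adapted (Jin t k false) (run_inner_z t k).
Proof.
move=> ax ay; elim: k => [|k IH]; first exact: ay.
have sub1 : Jin t k false `<=` Jin t k.+1 false by apply: inner_past_sub; lia.
have sub2 : Jin t 0 false `<=` Jin t k.+1 false by apply: inner_past_sub; lia.
have aU : adapted (Jin t k.+1 false) (fun w => row_mx (run_x t w) (run_inner_z t k w)).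
  by apply: mvec_row_mx; [exact: adapted_sub ax|exact: adapted_sub IH].
rewrite (funext (run_inner_zS t k)); apply: mvecB; first exact: adapted_sub IH.
apply: mvecZ.
apply: (adapted_batch rsubmx (s := fun i => inr (g_inner_z t k i))
    (xi := fun i => xig (g_inner_z t k i))
      (U := fun w => row_mx (run_x t w) (run_inner_z t k w)) (B_in p) hGg) => // [i|i /=].
  exact: (draw_g hiid).
by lia.
Qed.

Lemma adapted_random_index J n (K : W -> nat) (h : nat -> W -> 'rV[R]_n) :
  (forall k, event J [set w | K w = k]) -> (forall k, adapted J (h k)) ->
  adapted J (fun w => h (K w) w).
Proof.
move=> eK ah j; apply: (@measurable_random_index _ (Wpast J) _ _ K (fun k w => h k w 0 j)).
  exact: eK.
by move=> k; exact: ah.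
Qed.

Lemma event_K t J : measurable_past J (run_delta t) -> forall k, event J [set w | run_K t w = k].
Proof.
move=> mD k.
have := mD measurableT _ (hK k); rewrite setTI; exact.
Qed.

(** [K_t] is known when iteration [t] starts but has no deterministic bound; therefore [Jout t 0]
    contains the inner draws of iteration [t] for every [k]. *)
Lemma adapted_inner_end t :
  adapted (Jin t 0 false) (run_x t) -> adapted (Jin t 0 false) (run_y t) ->
  adapted (Jin t 0 false) (run_z t) -> measurable_past (Jin t 0 false) (run_delta t) ->
  adapted (Jout t 0) (run_y t.+1) /\ adapted (Jout t 0) (run_z t.+1).
Proof.
move=> ax ay az mD.
have eK k : event (Jout t 0) [set w | run_K t w = k].
  by apply: (event_sub (@inner_outer_past t 0 false)); exact: event_K.
split.
  apply: (adapted_random_index (h := run_inner_y t) eK) => k.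
  by apply: (adapted_sub (@inner_outer_past t k false)); exact: adapted_inner_y.
apply: (adapted_random_index (h := run_inner_z t) eK) => k.
by apply: (adapted_sub (@inner_outer_past t k false)); exact: adapted_inner_z.
Qed.

Lemma run_adapted t :
  [/\ adapted (Jin t 0 false) (run_x t), adapted (Jin t 0 false) (run_y t),
     adapted (Jin t 0 false) (run_z t) & measurable_past (Jin t 0 false) (run_delta t)].
Proof.
elim: t => [|t [ax ay az mD]].
  by split; [exact: mvec_cst|exact: mvec_cst|exact: mvec_cst|exact: measurable_cst].
have [ay' az'] := adapted_inner_end ax ay az mD.
have ax0 : adapted (Jout t 3) (run_x t).
  apply: adapted_sub ax; apply: subset_trans (@outer_past_sub t 0 3 isT).
  exact: inner_outer_past.
have ay0 : adapted (Jout t 3) (run_y t.+1).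
  by apply: adapted_sub ay'; exact: outer_past_sub.
have az0 : adapted (Jout t 3) (run_z t.+1).
  by apply: adapted_sub az'; exact: outer_past_sub.
have aG : adapted (Jout t 3) (run_G t).
  rewrite (funext (run_GE t)); apply: mvecD; last (apply: mvecZ; apply: mvecB).
  - apply: (adapted_batch lsubmx (s := fun i => inl (f_outer t i))
      (xi := fun i => xif (f_outer t i))
      (U := fun w => row_mx (run_x t w) (run_y t.+1 w)) (B_out p) hGf) => // [i|i /=|].
    + exact: (draw_f hiid).
    + by lia.
    + exact: mvec_row_mx.
  - apply: (adapted_batch lsubmx (s := fun i => inr (g_outer_y t i))
      (xi := fun i => xig (g_outer_y t i))
      (U := fun w => row_mx (run_x t w) (run_y t.+1 w)) (B_out p) hGg) => // [i|i /=|].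
    + exact: (draw_g hiid).
    + by lia.
    + exact: mvec_row_mx.
  - apply: (adapted_batch lsubmx (s := fun i => inr (g_outer_z t i))
      (xi := fun i => xig (g_outer_z t i))
      (U := fun w => row_mx (run_x t w) (run_z t.+1 w)) (B_out p) hGg) => // [i|i /=|].
    + exact: (draw_g hiid).
    + by lia.
    + exact: mvec_row_mx.
have ax' : adapted (Jout t 3) (run_x t.+1) by apply: mvecB => //; exact: mvecZ.
have sub := @outer_past_next t 3.
split.
- exact: adapted_sub ax'.
- exact: adapted_sub ay0.
- exact: adapted_sub az0.
have mD0 : measurable_past (Jin t.+1 0 false) (run_delta t).
  apply: measurable_Wpast_sub mD; apply: subset_trans (@outer_past_next t 0).
  exact: inner_outer_past.
have mdx := measurable_enorm_sqr (mvecB (adapted_sub sub ax') (adapted_sub sub ax0)).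
have mE := measurable_funD (measurable_funD (measurable_funM mD0 (measurable_cst (2^-1 : R)))
  (measurable_funM (measurable_cst (c1 : R)) mdx)) (measurable_cst (c2 : R)).
by apply: eq_measurable_fun mE => w _; rewrite run_deltaS.
Qed.

Local Notation ylam := (ystar (@penalty _ _ _ f g (lam p))).
Local Notation yst := (ystar g).
Local Notation q := (mu / (4 * Lg)).

(** The variance [eta_y ^+ 2 * (sigmaf ^+ 2 + lam ^+ 2 * sigmag ^+ 2) / B_in] of one [y] step, with
    [eta_y] substituted. *)
Definition noise_in : R :=
  (sigmaf ^+ 2 + lam p ^+ 2 * sigmag ^+ 2) / ((2 * lam p * Lg) ^+ 2 * (B_in p)%:R).

Let Lg0 : 0 < Lg. Proof. exact: Lg_gt0 hdy hmu hg_sc hg_grad. Qed.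

Let noise_in_ge0 : 0 <= noise_in.
Proof.
apply: divr_ge0; last by rewrite mulr_ge0 ?sqr_ge0.
by apply: addr_ge0; [exact: sqr_ge0|rewrite mulr_ge0 ?sqr_ge0].
Qed.

Lemma adapted_ylam J t : adapted J (run_x t) -> adapted J (fun w => ylam (run_x t w)).
Proof.
move=> ax; apply: (adapted_comp (H := ylam) _ ax).
exact: (ylam_lipschitz hdy hmu hg_sc hg_grad hf_grad hlam hlam_mu).
Qed.

Lemma adapted_yst J t : adapted J (run_x t) -> adapted J (fun w => yst (run_x t w)).
Proof.
move=> ax; apply: (adapted_comp (H := yst) _ ax).
exact: (ystar_lipschitz hdy hmu hg_sc hg_grad).
Qed.

(** The stochastic step is an exact gradient step on the penalized function plus two independent
    batch noises. They are removed in reverse order of drawing: first [g], whose past includes the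
    batch of [f], then [f]. *)
Lemma inner_y_step t k A : event (Jin t 0 false) A ->
  (\int[P]_(w in A) (enorm (run_inner_y t k.+1 w - ylam (run_x t w)) ^+ 2)%:E <=
   \int[P]_(w in A) ((1 - q) * enorm (run_inner_y t k w - ylam (run_x t w)) ^+ 2
     + noise_in)%:E)%E.
Proof.
move=> eA0; have [ax ay _ _] := run_adapted t.
have sub : Jin t 0 false `<=` Jin t k false by apply: inner_past_sub; lia.
have sub' : Jin t k false `<=` Jin t k true by apply: inner_past_sub; lia.
have eA := event_sub sub eA0; have eA' := event_sub sub' eA.
have ayk := @adapted_inner_y t k ax ay.
have axk := adapted_sub sub ax.
set J := Jin t k false in eA ayk axk sub sub' *.
set J' := Jin t k true in eA' sub' *.
pose U w := row_mx (run_x t w) (run_inner_y t k w).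
have aU : adapted J U by exact: mvec_row_mx.
have aU' : adapted J' U by exact: adapted_sub aU.
have aF := adapted_grad hf_grad aU.
have aG := adapted_grad hg_grad aU'; have aG0 := adapted_grad hg_grad aU.
pose V w := run_inner_y t k w - (2 * Lg)^-1 *:
  @penalty_gy _ _ _ f g (lam p) (run_x t w) (run_inner_y t k w)
  - ylam (run_x t w).
have aV : adapted J V.
  apply: mvecB; last exact: adapted_ylam.
  apply: mvecB => //; apply: mvecZ; apply: mvecD; last apply: mvecZ.
    exact: (mvec_lin rsubmx aG0).
  exact: (mvec_lin rsubmx aF).
pose bf w := batch_mean (B_in p) (fun i => rsubmx (Gf (U w) (xif (f_inner t k i) w))).
pose bg w := batch_mean (B_in p) (fun i => rsubmx (Gg (U w) (xig (g_inner_y t k i) w))).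
(* The exact step together with the noise of [f]: everything known before the batch of [g] is
   drawn. *)
pose V' w := V w + (- eta_y p) *: (bf w - rsubmx (grad f (U w))).
have abf : adapted J' bf.
  apply: (adapted_batch rsubmx (s := fun i => inl (f_inner t k i))
     (xi := fun i => xif (f_inner t k i)) (U := U) (B_in p) hGf) => // [i|i /=].
    exact: (draw_f hiid).
  by rewrite /J' /=; lia.
have aV' : adapted J' V'.
  apply: mvecD; first exact: adapted_sub aV.
  apply: mvecZ; apply: mvecB => //.
  by apply: (adapted_sub sub'); exact: (mvec_lin rsubmx aF).
have hr (z : 'rV[R]_(dx + dy)) : enorm (rsubmx z) <= enorm z by exact: enorm_rsubmx.
have E w : run_inner_y t k.+1 w - ylam (run_x t w) =
    V' w + (- (eta_y p * lam p)) *: (bg w - rsubmx (grad g (U w))).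
  rewrite run_inner_yS -/(bf w) -/(bg w) /V' /V /penalty_gy -/(U w).
  have l0 : lam p != 0 by rewrite gt_eqF.
  have E1 : (2 * Lg)^-1 = eta_y p * lam p.
    by rewrite heta_y; field; rewrite l0 gt_eqF.
  have E2 : eta_y p = (2 * Lg)^-1 * (lam p)^-1.
    by rewrite heta_y; field; rewrite l0 gt_eqF.
  move: (rsubmx (grad f (U w))) (rsubmx (grad g (U w))) (bf w) (bg w) => a b c d.
  apply/rowP => j; rewrite !mxE E1.
  have E3 : eta_y p * lam p * (lam p)^-1 = eta_y p by field.
  rewrite !mulrDr !mulrA E3; ring.
have mA := event_measurable hiid eA.
have injf : injective (fun i => inl (f_inner t k i) : slot) by move=> i j [].
have injg : injective (fun i => inr (g_inner_y t k i) : slot) by move=> i j [].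
have nJ i : ~ J (inl (f_inner t k i)) by rewrite /J /=; lia.
have nJ' i : ~ J' (inr (g_inner_y t k i)) by rewrite /J' /=; lia.
under eq_integral do rewrite E.
apply: le_trans (batch_step hiid hGg (L := rsubmx) hr (- (eta_y p * lam p)) hB_in
  injg (fun i => draw_g hiid _) nJ' aU' aG eA' aV') _.
have h1 := batch_step hiid hGf (L := rsubmx) hr (- eta_y p) hB_in
  injf (fun i => draw_f hiid _) nJ aU aF eA aV.
apply: le_trans (leeD2r _ h1) _.
have q1 : 0 <= 1 - q.
  rewrite subr_ge0 ler_pdivrMr ?mulr_gt0// mul1r.
  by have := Lg_ge_mu hdy hg_sc hg_grad; have := Lg0; lra.
have mYk : measurable_fun setT (fun w => enorm (run_inner_y t k w - ylam (run_x t w)) ^+ 2).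
  exact: (measurable_enorm_sqr (adapted_mvec hiid (mvecB ayk (adapted_ylam axk)))).
rewrite (integral_affine (P := P) mA mYk (fun w => sqr_ge0 _) q1 noise_in_ge0).
have h2 : (\int[P]_(w in A) (enorm (V w) ^+ 2)%:E <=
   (1 - q)%:E * \int[P]_(w in A) (enorm (run_inner_y t k w - ylam (run_x t w)) ^+ 2)%:E)%E.
  have := @integral_affine _ _ _ P A _ (1 - q) 0 mA mYk (fun w => sqr_ge0 _) q1 (lexx _).
  rewrite mul0e adde0 => <-; apply: integral_le => //.
  - exact: (measurable_enorm_sqr (adapted_mvec hiid aV)).
  - exact: measurable_affine.
  - by move=> w; exact: sqr_ge0.
  - move=> w _; rewrite addr0.
    exact: (inner_y_contract hdy hmu hg_sc hg_grad hf_grad hlam hlam_mu).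
rewrite -addeA; apply: leeD => //.
have fA : P A \is a fin_num by exact: fin_num_measure.
rewrite -(muleDl fA)//.
rewrite -EFinD le_eqVlt; apply/orP; left; apply/eqP; congr (_%:E * _)%E.
rewrite /noise_in heta_y; field.
by rewrite pnatr_eq0 -lt0n hB_in !gt_eqF.
Qed.

Lemma inner_z_step t k A : event (Jin t 0 false) A ->
  (\int[P]_(w in A) (enorm (run_inner_z t k.+1 w - yst (run_x t w)) ^+ 2)%:E <=
   \int[P]_(w in A) ((1 - q) * enorm (run_inner_z t k w - yst (run_x t w)) ^+ 2
     + noise_in)%:E)%E.
Proof.
move=> eA0; have [ax _ az _] := run_adapted t.
have sub : Jin t 0 false `<=` Jin t k false by apply: inner_past_sub; lia.
have eA := event_sub sub eA0.
have azk := @adapted_inner_z t k ax az.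
have axk := adapted_sub sub ax.
set J := Jin t k false in eA azk axk sub *.
pose U w := row_mx (run_x t w) (run_inner_z t k w).
have aU : adapted J U by exact: mvec_row_mx.
have aG := adapted_grad hg_grad aU.
pose V w := run_inner_z t k w - (2 * Lg)^-1 *: rsubmx (grad g (U w)) - yst (run_x t w).
have aV : adapted J V.
  apply: mvecB; last exact: adapted_yst.
  by apply: mvecB => //; apply: mvecZ; exact: (mvec_lin rsubmx aG).
have hr (z : 'rV[R]_(dx + dy)) : enorm (rsubmx z) <= enorm z by exact: enorm_rsubmx.
have l0 : lam p != 0 by rewrite gt_eqF.
have E1 : (2 * Lg)^-1 = eta_z p * lam p.
  by rewrite heta_z; field; rewrite l0 gt_eqF.
have E w : run_inner_z t k.+1 w - yst (run_x t w) =
    V w + (- (eta_z p * lam p)) *: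
      (batch_mean (B_in p) (fun i => rsubmx (Gg (U w) (xig (g_inner_z t k i) w)))
       - rsubmx (grad g (U w))).
  rewrite run_inner_zS /V -/(U w) E1; set d := batch_mean _ _.
  move: (rsubmx (grad g (U w))) => b.
  by apply/rowP => j; rewrite !mxE; ring.
have mA := event_measurable hiid eA.
have injg : injective (fun i => inr (g_inner_z t k i) : slot) by move=> i j [].
have nJ i : ~ J (inr (g_inner_z t k i)) by rewrite /J /=; lia.
under eq_integral do rewrite E.
apply: le_trans (batch_step hiid hGg (L := rsubmx) hr (- (eta_z p * lam p)) hB_in
  injg (fun i => draw_g hiid _) nJ aU aG eA aV) _.
have q1 : 0 <= 1 - q.
  rewrite subr_ge0 ler_pdivrMr ?mulr_gt0// mul1r.
  by have := Lg_ge_mu hdy hg_sc hg_grad; have := Lg0; lra.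
have mZk : measurable_fun setT (fun w => enorm (run_inner_z t k w - yst (run_x t w)) ^+ 2).
  exact: (measurable_enorm_sqr (adapted_mvec hiid (mvecB azk (adapted_yst axk)))).
rewrite (integral_affine (P := P) mA mZk (fun w => sqr_ge0 _) q1 noise_in_ge0).
apply: leeD.
  have := @integral_affine _ _ _ P A _ (1 - q) 0 mA mZk (fun w => sqr_ge0 _) q1 (lexx _).
  rewrite mul0e adde0 => <-; apply: integral_le => //.
  - exact: (measurable_enorm_sqr (adapted_mvec hiid aV)).
  - exact: measurable_affine.
  - by move=> w; exact: sqr_ge0.
  - by move=> w _; rewrite addr0; exact: (inner_z_contract hdy hmu hg_sc hg_grad).
(* The [z] step has only the noise of [g]; adding the variance of [f] gives both loops the same
   noise level. *)
apply: lee_wpmul2r => //; rewrite lee_fin /noise_in heta_z.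
have -> : (- ((2 * lam p * Lg)^-1 * lam p)) ^+ 2 * sigmag ^+ 2 / (B_in p)%:R =
    (lam p ^+ 2 * sigmag ^+ 2) / ((2 * lam p * Lg) ^+ 2 * (B_in p)%:R).
  by field; rewrite pnatr_eq0 -lt0n hB_in !gt_eqF.
apply: ler_wpM2r; first by rewrite invr_ge0 mulr_ge0 ?sqr_ge0.
by rewrite lerDr sqr_ge0.
Qed.

Let q0 : 0 < q. Proof. by rewrite divr_gt0// mulr_gt0. Qed.

Let q_le : 0 <= 1 - q.
Proof.
rewrite subr_ge0 ler_pdivrMr ?mulr_gt0// mul1r.
by have := Lg_ge_mu hdy hg_sc hg_grad; have := Lg0; lra.
Qed.

Lemma measurable_K t k : measurable [set w | run_K t w = k].
Proof.
have [_ _ _ mD] := run_adapted t.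
exact: (event_measurable hiid (event_K mD k)).
Qed.

Lemma inner_y_error t :
  (\int[P]_w (enorm (run_y t.+1 w - ylam (run_x t w)) ^+ 2)%:E <=
   \int[P]_w ((1 - q) ^+ run_K t w * enorm (run_y t w - ylam (run_x t w)) ^+ 2
     + noise_in / q)%:E)%E.
Proof.
have [ax ay _ mD] := run_adapted t.
pose h k w := enorm (run_inner_y t k w - ylam (run_x t w)) ^+ 2.
have mh k : measurable_fun setT (h k).
  have ayk := @adapted_inner_y t k ax ay.
  apply: measurable_enorm_sqr; apply: mvecB; first exact: (adapted_mvec hiid ayk).
  exact: (adapted_mvec hiid (adapted_ylam ax)).
have h0 k w : 0 <= h k w by exact: sqr_ge0.
apply: (integral_random_index (K := run_K t) (h := h)
  (h' := fun k w => (1 - q) ^+ k * h 0 w + noise_in / q)) => //.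
- exact: measurable_K.
- by move=> k; exact: measurable_affine.
- move=> k w; apply: addr_ge0; first by rewrite mulr_ge0 ?exprn_ge0.
  by apply: divr_ge0 => //; exact: ltW.
- move=> k.
  have -> : noise_in / q = noise_in / (1 - (1 - q)) by rewrite subKr.
  have q1 : 1 - q < 1 by rewrite ltrBlDr ltrDl.
  apply: (integral_geometric (measurable_K t k) mh h0 q_le q1 noise_in_ge0) => j.
  exact: inner_y_step (event_K mD k).
Qed.

Lemma inner_z_error t :
  (\int[P]_w (enorm (run_z t.+1 w - yst (run_x t w)) ^+ 2)%:E <=
   \int[P]_w ((1 - q) ^+ run_K t w * enorm (run_z t w - yst (run_x t w)) ^+ 2
     + noise_in / q)%:E)%E.
Proof.
have [ax _ az mD] := run_adapted t.
pose h k w := enorm (run_inner_z t k w - yst (run_x t w)) ^+ 2.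
have mh k : measurable_fun setT (h k).
  have azk := @adapted_inner_z t k ax az.
  apply: measurable_enorm_sqr; apply: mvecB; first exact: (adapted_mvec hiid azk).
  exact: (adapted_mvec hiid (adapted_yst ax)).
have h0 k w : 0 <= h k w by exact: sqr_ge0.
apply: (integral_random_index (K := run_K t) (h := h)
  (h' := fun k w => (1 - q) ^+ k * h 0 w + noise_in / q)) => //.
- exact: measurable_K.
- by move=> k; exact: measurable_affine.
- move=> k w; apply: addr_ge0; first by rewrite mulr_ge0 ?exprn_ge0.
  by apply: divr_ge0 => //; exact: ltW.
- move=> k.
  have -> : noise_in / q = noise_in / (1 - (1 - q)) by rewrite subKr.
  have q1 : 1 - q < 1 by rewrite ltrBlDr ltrDl.
  apply: (integral_geometric (measurable_K t k) mh h0 q_le q1 noise_in_ge0) => j.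
  exact: inner_z_step (event_K mD k).
Qed.

Local Notation ell := (Num.max Cf (Num.max Lf (Num.max Lg rhog))).
Local Notation kappa := (ell / mu).
Local Notation hyper := (@hypergrad _ _ _ f g).
Local Notation gbar x y z := (@penalty_gx _ _ _ f g (lam p) x y z).

(** The factor 2 comes from the two separate batches of [g], at the final [y] and at the final
    [z]. *)
Definition noise_out : R := (sigmaf ^+ 2 + 2 * (lam p ^+ 2 * sigmag ^+ 2)) / (B_out p)%:R.

Let noise_out_ge0 : 0 <= noise_out.
Proof.
apply: divr_ge0 => //; apply: addr_ge0; first exact: sqr_ge0.
by rewrite mulr_ge0// mulr_ge0// sqr_ge0.
Qed.

Lemma adapted_hyper J t : adapted J (run_x t) -> adapted J (fun w => hyper (run_x t w)).
Proof.
move=> ax; apply: (adapted_comp (H := hyper) _ ax).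
exact: (expansion_lipschitz
  (hyperobj_expansion hdy hmu hg_sc hg_grad hg_hess hf_lip hf_grad)).
Qed.

(** The three batches are ordered as [f], [g] at [y], [g] at [z] and peeled off from the last. Both
    inner endpoints are known before any of them. *)
Lemma outer_error t :
  (\int[P]_w (enorm (run_G t w - hyper (run_x t w)) ^+ 2)%:E <=
   \int[P]_w (enorm (gbar (run_x t w) (run_y t.+1 w) (run_z t.+1 w) - hyper (run_x t w)) ^+ 2
     + noise_out)%:E)%E.
Proof.
have [ax ay az mD] := run_adapted t.
have [ay' az'] := adapted_inner_end ax ay az mD.
have sub01 : Jout t 0 `<=` Jout t 1 by exact: outer_past_sub.
have sub12 : Jout t 1 `<=` Jout t 2 by exact: outer_past_sub.
have sub02 : Jout t 0 `<=` Jout t 2 by exact: outer_past_sub.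
have ax' := adapted_sub (@inner_outer_past t 0 false) ax.
pose U w := row_mx (run_x t w) (run_y t.+1 w).
pose Uz w := row_mx (run_x t w) (run_z t.+1 w).
have aU0 : adapted (Jout t 0) U by exact: mvec_row_mx.
have aU1 := adapted_sub sub01 aU0.
have aUz0 : adapted (Jout t 0) Uz by exact: mvec_row_mx.
have aUz2 := adapted_sub sub02 aUz0.
have aF0 := adapted_grad hf_grad aU0.
have aG0 := adapted_grad hg_grad aU0; have aG1 := adapted_grad hg_grad aU1.
have aGz0 := adapted_grad hg_grad aUz0; have aGz2 := adapted_grad hg_grad aUz2.
pose V0 w := gbar (run_x t w) (run_y t.+1 w) (run_z t.+1 w) - hyper (run_x t w).
have aV0 : adapted (Jout t 0) V0.
  apply: mvecB; last exact: adapted_hyper.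
  apply: mvecD; first exact: (mvec_lin lsubmx aF0).
  apply: mvecZ; apply: mvecB; first exact: (mvec_lin lsubmx aG0).
  exact: (mvec_lin lsubmx aGz0).
pose bf w := batch_mean (B_out p) (fun i => lsubmx (Gf (U w) (xif (f_outer t i) w))).
pose bg w := batch_mean (B_out p) (fun i => lsubmx (Gg (U w) (xig (g_outer_y t i) w))).
pose bz w := batch_mean (B_out p) (fun i => lsubmx (Gg (Uz w) (xig (g_outer_z t i) w))).
pose V1 w := V0 w + 1 *: (bf w - lsubmx (grad f (U w))).
pose V2 w := V1 w + lam p *: (bg w - lsubmx (grad g (U w))).
have aV1 : adapted (Jout t 1) V1.
  apply: mvecD; first exact: adapted_sub aV0.
  apply: mvecZ; apply: mvecB.
    apply: (adapted_batch lsubmx (s := fun i => inl (f_outer t i))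
      (xi := fun i => xif (f_outer t i)) (U := U) (B_out p) hGf) => // [i|i /=].
      exact: (draw_f hiid).
    by lia.
  by apply: (adapted_sub sub01); exact: (mvec_lin lsubmx aF0).
have aV2 : adapted (Jout t 2) V2.
  apply: mvecD; first exact: adapted_sub aV1.
  apply: mvecZ; apply: mvecB.
    apply: (adapted_batch lsubmx (s := fun i => inr (g_outer_y t i))
      (xi := fun i => xig (g_outer_y t i)) (U := U) (B_out p) hGg) => // [i|i /=|].
    - exact: (draw_g hiid).
    - by lia.
    - exact: adapted_sub aU1.
  by apply: (adapted_sub sub02); exact: (mvec_lin lsubmx aG0).
have hl (z : 'rV[R]_(dx + dy)) : enorm (lsubmx z) <= enorm z by exact: enorm_lsubmx.
have E w : run_G t w - hyper (run_x t w) =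
    V2 w + (- lam p) *: (bz w - lsubmx (grad g (Uz w))).
  have aux (b c d h b' c' d' : 'rV[R]_dx) : b + lam p *: (c - d) - h =
      b' + lam p *: (c' - d') - h + 1 *: (b - b') + lam p *: (c - c') +
      (- lam p) *: (d - d').
    by apply/rowP => j; rewrite !mxE; ring.
  exact: aux.
have eT j : event (Jout t j) setT by exact: measurableT.
have injf : injective (fun i => inl (f_outer t i) : slot) by move=> i j [].
have injg : injective (fun i => inr (g_outer_y t i) : slot) by move=> i j [].
have injz : injective (fun i => inr (g_outer_z t i) : slot) by move=> i j [].
have n0 i : ~ Jout t 0 (inl (f_outer t i)) by rewrite /=; lia.
have n1 i : ~ Jout t 1 (inr (g_outer_y t i)) by rewrite /=; lia.
have n2 i : ~ Jout t 2 (inr (g_outer_z t i)) by rewrite /=; lia.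
under eq_integral do rewrite E.
have h3 := batch_step hiid hGg (L := lsubmx) hl (- lam p) hB_out injz
  (fun i => draw_g hiid _) n2 aUz2 aGz2 (eT 2) aV2.
have h2 := batch_step hiid hGg (L := lsubmx) hl (lam p) hB_out injg
  (fun i => draw_g hiid _) n1 aU1 aG1 (eT 1) aV1.
have h1 := batch_step hiid hGf (L := lsubmx) hl 1 hB_out injf
  (fun i => draw_f hiid _) n0 aU0 aF0 (eT 0) aV0.
apply: le_trans h3 _; apply: le_trans (leeD2r _ h2) _.
apply: le_trans (leeD2r _ (leeD2r _ h1)) _.
have mV0 : measurable_fun setT (fun w => enorm (V0 w) ^+ 2).
  exact: (measurable_enorm_sqr (adapted_mvec hiid aV0)).
under [leRHS]eq_integral do rewrite -[enorm _ ^+ 2]mul1r.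
rewrite (integral_affine (P := P) measurableT mV0 (fun w => sqr_ge0 _) ler01 noise_out_ge0).
rewrite probability_setT !mule1 mul1e -!addeA.
rewrite le_eqVlt; apply/orP; left; apply/eqP; congr (_ + _)%E.
have -> : noise_out = 1 ^+ 2 * sigmaf ^+ 2 / (B_out p)%:R +
    (lam p ^+ 2 * sigmag ^+ 2 / (B_out p)%:R +
     (- lam p) ^+ 2 * sigmag ^+ 2 / (B_out p)%:R).
  by rewrite /noise_out; field; rewrite pnatr_eq0 -lt0n.
by rewrite !EFinD.
Qed.

End Run.

(** * Error recursion and descent in expectation *)

Section StochasticDescent.
Context {R : realType} {d : measure_display} {W : measurableType d} {P : probability W R}.

Local Notation Ex h := (\int[P]_w (h w)%:E)%E.

Definition nnmeas (h : W -> R) : Prop := measurable_fun setT h /\ forall w, 0 <= h w.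

Lemma Ex_ge0 h : nnmeas h -> (0 <= Ex h)%E.
Proof. by move=> [_ h0]; apply: integral_ge0 => w _; rewrite lee_fin. Qed.

Lemma Ex_le h h' : nnmeas h -> measurable_fun setT h' -> (forall w, h w <= h' w) ->
  (Ex h <= Ex h')%E.
Proof. by move=> [mh h0] mh' hh; apply: integral_le => // w _; exact: hh. Qed.

Lemma Ex_affine h (a b : R) : nnmeas h -> 0 <= a -> 0 <= b ->
  (Ex (fun w => a * h w + b) = a%:E * Ex h + b%:E)%E.
Proof.
by move=> [mh h0] a0 b0; rewrite integral_affine//= probability_setT mule1.
Qed.

Lemma Ex_cst (b : R) : (Ex (fun=> b) = b%:E)%E.
Proof. by rewrite integral_cst//= probability_setT mule1. Qed.

Lemma ExD h h' : nnmeas h -> nnmeas h' -> (Ex (fun w => h w + h' w)%R = Ex h + Ex h')%E.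
Proof.
move=> [mh h0] [mh' h'0]; under eq_integral do rewrite EFinD.
rewrite ge0_integralD//.
- by move=> w _; rewrite lee_fin.
- exact/measurable_EFinP.
- by move=> w _; rewrite lee_fin.
- exact/measurable_EFinP.
Qed.

Lemma nnmeasD h h' : nnmeas h -> nnmeas h' -> nnmeas (fun w => h w + h' w).
Proof.
by move=> [mh h0] [mh' h'0]; split; [exact: measurable_funD|move=> w; rewrite addr_ge0].
Qed.

Lemma nnmeasZ h (a : R) : 0 <= a -> nnmeas h -> nnmeas (fun w => a * h w).
Proof.
move=> a0 [mh h0]; split; last by move=> w; rewrite mulr_ge0.
exact: measurable_funM.
Qed.

Lemma nnmeas_cst (a : R) : 0 <= a -> nnmeas (fun=> a).
Proof. by move=> a0; split. Qed.

Lemma nnmeas_sum T (h : nat -> W -> R) : (forall t, nnmeas (h t)) ->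
  nnmeas (fun w => \sum_(t < T) h t w).
Proof.
move=> hh; split; last by move=> w; apply: sumr_ge0 => t _; exact: (hh t).2.
by apply: measurable_rsum => t; exact: (hh t).1.
Qed.

Lemma ExZ h (a : R) : nnmeas h -> 0 <= a -> (Ex (fun w => a * h w)%R = a%:E * Ex h)%E.
Proof.
move=> hh a0; have := Ex_affine hh a0 (lexx 0); rewrite adde0 => <-.
by apply: eq_integral => w _; rewrite addr0.
Qed.

Lemma Ex_sum T (h : nat -> W -> R) : (forall t, nnmeas (h t)) ->
  (Ex (fun w => \sum_(t < T) h t w)%R = \sum_(t < T) Ex (h t))%E.
Proof.
move=> hh; elim: T => [|T IH].
  by under eq_integral do rewrite big_ord0; rewrite big_ord0 integral0.
rewrite big_ord_recr/= -IH -ExD//; last exact: nnmeas_sum.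
by apply: eq_integral => w _; rewrite big_ord_recr.
Qed.

Section ErrorRecursion.
Variables (r e th : nat -> W -> R) (nu ia : R).
Hypothesis hr : forall t, nnmeas (r t).
Hypothesis hthe : forall t, nnmeas (fun w => th t w * e t w).
Hypothesis nu0 : 0 <= nu.
Hypothesis ia0 : 0 <= ia.
Hypothesis r_le : forall t, (Ex (r t) <= Ex (fun w => th t w * e t w + nu)%R)%E.
Hypothesis e_next : forall t w, th t.+1 w * e t.+1 w <= r t w / 2 + ia.
Hypothesis e_init : forall w, th 0%N w * e 0%N w <= ia.

Lemma error_recursion t : (Ex (r t) <= (2 * (nu + ia))%:E)%E.
Proof.
have step t' : (Ex (fun w => th t' w * e t' w)%R <= (nu + 2 * ia)%:E)%E ->
    (Ex (r t') <= (2 * (nu + ia))%:E)%E.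
  move=> h; apply: le_trans (r_le t') _.
  have E : (Ex (fun w => th t' w * e t' w + nu)%R = Ex (fun w => th t' w * e t' w)%R + nu%:E)%E.
    rewrite -[X in (X + _)%E]mul1e -Ex_affine//.
    by apply: eq_integral => w _; rewrite mul1r.
  rewrite E; apply: le_trans (leeD2r _ h) _.
  by rewrite -EFinD lee_fin; lra.
apply: (step _ _); elim: t => [|t IH].
  apply: le_trans (Ex_le (h' := fun=> ia) (hthe 0) (measurable_cst (ia : R)) e_init) _.
  rewrite Ex_cst lee_fin; move: nu0 ia0; lra.
have mh : measurable_fun setT (fun w => 2^-1 * r t w + ia).
  by apply: measurable_affine; exact: (hr t).1.
apply: le_trans (Ex_le (hthe t.+1) mh _) _.
  by move=> w; apply: le_trans (e_next t w) _; rewrite mulrC.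
rewrite Ex_affine//.
have h2 : (0 <= 2^-1 :> R) by rewrite invr_ge0.
have := lee_wpmul2l (x := (2^-1)%:E) h2 (step t IH); rewrite -EFinM => h.
apply: le_trans (leeD2r _ h) _; rewrite -EFinD lee_fin.
by have -> : 2^-1 * (2 * (nu + ia)) + ia = nu + 2 * ia by field.
Qed.

End ErrorRecursion.

Section Descent.
Variables (Phi gr G2 err : nat -> W -> R) (eta Delta xi : R).
Hypothesis hPhi : forall t, nnmeas (Phi t).
Hypothesis hgr : forall t, nnmeas (gr t).
Hypothesis hG2 : forall t, nnmeas (G2 t).
Hypothesis herr : forall t, nnmeas (err t).
Hypothesis eta0 : 0 < eta.
Hypothesis Phi0 : forall w, Phi 0%N w = Delta.
Hypothesis descent : forall t w,
  Phi t.+1 w + eta / 2 * gr t w + eta / 4 * G2 t w <= Phi t w + eta / 2 * err t w.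
Hypothesis err_le : forall t, (Ex (err t) <= xi%:E)%E.

(** Telescoping is done pathwise before integrating, and the final [Phi T] is dropped by
    nonnegativity. *)
Lemma descent_sum T :
  ((eta / 2)%:E * \sum_(t < T) Ex (gr t) + (eta / 4)%:E * \sum_(t < T) Ex (G2 t)
   <= (Delta + T%:R * (eta / 2 * xi))%:E)%E.
Proof.
have e2 : 0 <= eta / 2 by rewrite divr_ge0// ltW.
have e4 : 0 <= eta / 4 by rewrite divr_ge0// ltW.
have tel w : Phi T w + (eta / 2 * (\sum_(t < T) gr t w) + eta / 4 * (\sum_(t < T) G2 t w))
    <= (eta / 2) * (\sum_(t < T) err t w) + Delta.
  elim: T => [|T IH]; first by rewrite !big_ord0 !mulr0 Phi0; lra.
  by rewrite !big_ord_recr/= !mulrDr; have := descent T w; lra.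
have hs (h : nat -> W -> R) := @nnmeas_sum T h.
have hlhs := nnmeasD (nnmeasZ e2 (hs _ hgr)) (nnmeasZ e4 (hs _ hG2)).
have D0 : 0 <= Delta.
  have w0 : W := point.
  by rewrite -(Phi0 w0); exact: (hPhi 0).2.
have mrhs : measurable_fun setT (fun w => (eta / 2) * (\sum_(t < T) err t w) + Delta).
  by apply: measurable_affine; exact: (hs _ herr).1.
have tel' w : eta / 2 * (\sum_(t < T) gr t w) + eta / 4 * (\sum_(t < T) G2 t w)
    <= (eta / 2) * (\sum_(t < T) err t w) + Delta.
  by have := tel w; have := (hPhi T).2 w; lra.
have := Ex_le hlhs mrhs tel'.
rewrite ExD; [|exact: nnmeasZ (hs _ _)|exact: nnmeasZ (hs _ _)].
rewrite !ExZ//; try exact: hs.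
rewrite Ex_affine//; try exact: hs.
rewrite !Ex_sum// => h; apply: le_trans h _.
have hsum : (\sum_(t < T) Ex (err t) <= (T%:R * xi)%:E)%E.
  apply: (@le_trans _ _ (\sum_(t < T) xi%:E)%E); first by apply: lee_sum => t _.
  by rewrite sumEFin sumr_const card_ord mulr_natl.
apply: le_trans (leeD2r _ (lee_wpmul2l _ hsum)) _; first by rewrite lee_fin.
rewrite -EFinM -EFinD lee_fin.
by rewrite addrC (mulrCA (eta / 2)).
Qed.

Lemma descent_gr T : (\sum_(t < T) Ex (gr t) <= (2 * Delta / eta + T%:R * xi)%:E)%E.
Proof.
have e2 : 0 < eta / 2 by rewrite divr_gt0.
have e4 : 0 <= eta / 4 by rewrite divr_ge0// ltW.
have s0 : (0 <= (eta / 4)%:E * \sum_(t < T) Ex (G2 t))%E.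
  by rewrite mule_ge0 ?lee_fin// sume_ge0// => t _; exact: Ex_ge0.
rewrite -(lee_pmul2l (x := (eta / 2)%:E))// ?lte_fin//.
apply: le_trans (leeDl _ s0) _; apply: le_trans (descent_sum T) _.
rewrite -EFinM lee_fin le_eqVlt; apply/orP; left; apply/eqP; field.
by rewrite gt_eqF.
Qed.

Lemma descent_G2 T : (\sum_(t < T) Ex (G2 t) <= (4 * Delta / eta + 2 * (T%:R * xi))%:E)%E.
Proof.
have e2 : 0 <= eta / 2 by rewrite divr_ge0// ltW.
have e4 : 0 < eta / 4 by rewrite divr_gt0.
have s0 : (0 <= (eta / 2)%:E * \sum_(t < T) Ex (gr t))%E.
  by rewrite mule_ge0 ?lee_fin// sume_ge0// => t _; exact: Ex_ge0.
rewrite -(lee_pmul2l (x := (eta / 4)%:E))// ?lte_fin//.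
apply: le_trans (leeDr _ s0) _; apply: le_trans (descent_sum T) _.
rewrite -EFinM lee_fin le_eqVlt; apply/orP; left; apply/eqP; field.
by rewrite gt_eqF.
Qed.

End Descent.
End StochasticDescent.

Lemma delta_sum_arith {R : realType} (S d A G c d0 c2 T : R) :
  S + 2 * d <= c * A + (2 * d0 + 2 * (T * c2)) ->
  S + d + 2 * (d / 2 + c / 2 * G + c2) <= c * (A + G) + (2 * d0 + 2 * (T * c2 + c2)).
Proof.
rewrite (mulrDr c) (mulrAC c).
by move: (c * A) (c * G) (T * c2) => cA cG Tc h; lra.
Qed.

(** Polarization of the inner product of [u] and [G] leaves [- eta / 2 * enorm G ^+ 2]; half of it
    absorbs the second-order remainder and the other half stays on the left. *)
Lemma descent_arith {R : realType} n (F F' eta C inf : R) (u G : 'rV[R]_n) :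
  0 < eta -> 4 * C * eta <= 1 ->
  `|F' - F - dot u (- eta *: G)| <= C * enorm (- eta *: G) ^+ 2 ->
  F' - inf + eta / 2 * enorm u ^+ 2 + eta / 4 * enorm G ^+ 2
    <= F - inf + eta / 2 * enorm (G - u) ^+ 2.
Proof.
move=> eta0 hC; rewrite enormB_sqr dotZr enormZ normrN (gtr0_norm eta0) exprMn => h.
have {h} := le_trans (ler_norm _) h; rewrite dotC.
have : C * (eta ^+ 2 * enorm G ^+ 2) <= eta / 4 * enorm G ^+ 2.
  rewrite mulrA; apply: ler_wpM2r; first exact: sqr_ge0.
  by have := ler_wpM2r (ltW eta0) hC; lra.
lra.
Qed.

(** The displacement contributes [2 * 3 ^+ 2 = 18] times [(c * D) ^+ 2], which the coefficient 34 in
    the recursion of delta covers. *)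
Lemma warm_start_arith {R : realType} (th U V UV dl D c ia : R) :
  0 <= th -> th <= 1 / 4 -> th * dl <= ia -> UV <= 2 * U + 2 * V ->
  V <= (3 * c * D) ^+ 2 -> 34 * (c * D) ^+ 2 <= dl -> 0 <= U ->
  th * UV <= U / 2 + ia.
Proof.
move=> th0 th4 thd hUV hV hD U0.
have h3 : (3 * c * D) ^+ 2 = 9 * (c * D) ^+ 2 by ring.
have h2 : th * UV <= th * (2 * U + dl).
  by apply: ler_wpM2l => //; have := sqr_ge0 (c * D); move: hV; rewrite h3; lra.
apply: le_trans h2 _; rewrite mulrDr.
by have := ler_wpM2r U0 th4; lra.
Qed.

(** * Convergence for parameters satisfying abstract inequalities *)

Section Convergence.
Context {R : realType} {dF dG dW : measure_display}.
Context {Xf : measurableType dF} {Xg : measurableType dG} {W : measurableType dW}.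
Context {Qf : probability Xf R} {Qg : probability Xg R} {P : probability W R}.
Context {xif : f_slot -> W -> Xf} {xig : g_slot -> W -> Xg}.
Hypothesis hiid : iid_samples P Qf Qg xif xig.
Context {dx dy : nat} {f g : 'rV[R]_(dx + dy) -> R}.
Context {Gf : 'rV[R]_(dx + dy) -> Xf -> 'rV[R]_(dx + dy)}.
Context {Gg : 'rV[R]_(dx + dy) -> Xg -> 'rV[R]_(dx + dy)}.
Context {sigmaf sigmag : R}.
Hypothesis hGf : unbiased_oracle Qf Gf f sigmaf.
Hypothesis hGg : unbiased_oracle Qg Gg g sigmag.
Context {mu Cf Lf Lg rhog : R}.
Hypothesis hdx : (0 < dx)%N.
Hypothesis hdy : (0 < dy)%N.
Hypothesis hmu : 0 < mu.
Hypothesis hg_sc : strongly_convex_in_y mu g.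
Hypothesis hg_grad : lipschitz_grad Lg g.
Hypothesis hg_hess : lipschitz_hess rhog g.
Hypothesis hf_lip : lipschitz_in_y Cf f.
Hypothesis hf_grad : lipschitz_grad Lf f.
Context {p : @f2bsa_params R}.
Hypothesis hlam : 0 < lam p.
Hypothesis hlam_mu : Lf / lam p <= mu / 2.
Hypothesis hB_in : (0 < B_in p)%N.
Hypothesis hB_out : (0 < B_out p)%N.
Hypothesis heta_y : eta_y p = (2 * lam p * Lg)^-1.
Hypothesis heta_z : eta_z p = (2 * lam p * Lg)^-1.
Context {c2 : R}.
Hypothesis hdelta : forall delta dist, delta_next p delta dist =
  delta / 2 + 34 * Lg ^+ 2 / mu ^+ 2 * dist ^+ 2 + c2.
Hypothesis hK : forall k, measurable [set delta | inner_steps p delta = k].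
Context {x0 : 'rV[R]_dx} {y0 : 'rV[R]_dy}.

Local Notation ell := (Num.max Cf (Num.max Lf (Num.max Lg rhog))).
Local Notation kappa := (ell / mu).
Local Notation hyper := (@hypergrad _ _ _ f g).
Local Notation ylam := (ystar (@penalty _ _ _ f g (lam p))).
Local Notation yst := (ystar g).
Local Notation q := (mu / (4 * Lg)).
Local Notation run := (@run _ _ _ _ Xf Xg W xif xig dx dy Gf Gg p x0 y0).
Local Notation run_x := (@run_x _ _ _ _ Xf Xg W xif xig dx dy Gf Gg p x0 y0).
Local Notation run_y := (@run_y _ _ _ _ Xf Xg W xif xig dx dy Gf Gg p x0 y0).
Local Notation run_z := (@run_z _ _ _ _ Xf Xg W xif xig dx dy Gf Gg p x0 y0).
Local Notation run_delta := (@run_delta _ _ _ _ Xf Xg W xif xig dx dy Gf Gg p x0 y0).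
Local Notation run_K := (@run_K _ _ _ _ Xf Xg W xif xig dx dy Gf Gg p x0 y0).
Local Notation run_G := (@run_G _ _ _ _ Xf Xg W xif xig dx dy Gf Gg p x0 y0).
Local Notation Ex h := (\int[P]_w (h w)%:E)%E.
Local Notation nu := (@noise_in _ sigmaf sigmag Lg p / q).
Local Notation noise_out := (@noise_out _ sigmaf sigmag p).

(** [ia] is the accuracy to which the inner loop contracts [delta]; it will be
    [(256 * (lam * ell / eps) ^+ 2)^-1]. *)
Context {ia : R}.
Hypothesis hia : 0 <= ia.
Hypothesis hc2 : 0 <= c2.
Hypothesis hdelta0 : 0 <= delta0 p.
Hypothesis hinit_y : enorm (y0 - ylam x0) ^+ 2 <= delta0 p.
Hypothesis hinit_z : enorm (y0 - yst x0) ^+ 2 <= delta0 p.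
Hypothesis hsteps : forall delta, 0 <= delta ->
  (1 - q) ^+ inner_steps p delta <= 1 / 4 /\
  (1 - q) ^+ inner_steps p delta * delta <= ia.

Lemma run_delta_ge0 t w : 0 <= run_delta t w.
Proof.
elim: t => [//|t IH]; rewrite (run_deltaS hdelta) !addr_ge0// ?divr_ge0//.
by rewrite mulr_ge0 ?sqr_ge0// divr_ge0 ?sqr_ge0// mulr_ge0// sqr_ge0.
Qed.

Let Lg0 : 0 < Lg. Proof. exact: Lg_gt0 hdy hmu hg_sc hg_grad. Qed.

Let q_le : 0 <= 1 - q.
Proof.
rewrite subr_ge0 ler_pdivrMr ?mulr_gt0// mul1r.
by have := Lg_ge_mu hdy hg_sc hg_grad; have := Lg0; lra.
Qed.

Let adap t := run_adapted hiid hGf hGg hdx hdy hmu hlam hlam_mu hB_in hB_out hdelta hK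
  (x0 := x0) (y0 := y0) t.

Let mx t : mvec (run_x t).
Proof. by have [h _ _ _] := adap t; exact: (adapted_mvec hiid h). Qed.

Let mylam t : mvec (fun w => ylam (run_x t w)).
Proof.
have [h _ _ _] := adap t.
exact: (adapted_mvec hiid (adapted_ylam hdy hmu hg_sc hg_grad hf_grad hlam hlam_mu h)).
Qed.

Let myst t : mvec (fun w => yst (run_x t w)).
Proof.
have [h _ _ _] := adap t.
exact: (adapted_mvec hiid (adapted_yst hdy hmu hg_sc hg_grad h)).
Qed.

Lemma mvec_hyper t : mvec (fun w => hyper (run_x t w)).
Proof.
have [h _ _ _] := adap t.
exact: (adapted_mvec hiid
  (adapted_hyper hdy hmu hg_sc hg_grad hg_hess hf_lip hf_grad h)).
Qed.

Lemma measurable_run_delta t : measurable_fun setT (run_delta t).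
Proof.
elim: t => [|t IH]; first exact: measurable_cst.
rewrite (funext (run_deltaS hdelta t)); apply: measurable_funD => //.
apply: measurable_funD; first exact: measurable_funM.
by apply: measurable_funM => //; apply: measurable_enorm_sqr; exact: mvecB.
Qed.

Lemma nnmeas_sqr n (X : W -> 'rV[R]_n) : mvec X -> nnmeas (fun w => enorm (X w) ^+ 2).
Proof. by move=> mX; split; [exact: measurable_enorm_sqr|move=> w; exact: sqr_ge0]. Qed.

Let mK t k : measurable [set w | run_K t w = k] :=
  measurable_K hiid hGf hGg hdx hdy hmu hlam hlam_mu hB_in hB_out hdelta hK t k.

Let nnmeas_theta t n (X : W -> 'rV[R]_n) : mvec X ->
  nnmeas (fun w => (1 - q) ^+ run_K t w * enorm (X w) ^+ 2).
Proof.
move=> hX; split; last by move=> w; rewrite mulr_ge0 ?exprn_ge0 ?sqr_ge0.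
apply: measurable_funM; last exact: measurable_enorm_sqr.
exact: (measurable_random_index (K := run_K t) (h := fun k _ => (1 - q) ^+ k) (mK t)).
Qed.

(* The new target moves by O(|x_{t+1} - x_t|), and the recursion of delta
   dominates this displacement. *)
Lemma warm_start t w (u v : 'rV[R]_dy) :
  enorm v <= 3 * (Lg / mu) * enorm (run_x t w - run_x t.+1 w) ->
  (1 - q) ^+ run_K t.+1 w * enorm (u + v) ^+ 2 <= enorm u ^+ 2 / 2 + ia.
Proof.
move=> hv; have D0 := run_delta_ge0 t.+1 w.
have [th4 thd] := hsteps D0.
have h0 : 0 <= 3 * (Lg / mu) * enorm (run_x t w - run_x t.+1 w).
  by apply: mulr_ge0 => //; rewrite mulr_ge0// divr_ge0 ?ltW.
apply: (warm_start_arith (exprn_ge0 _ q_le) th4 thd (enormD_sqr_le u v) _ _ (sqr_ge0 _)).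
  by apply: lerXn2r hv; rewrite nnegrE.
rewrite (run_deltaS hdelta) enormB exprMn exprMn exprVn !mulrA.
by rewrite -[leLHS]add0r -[leLHS]addr0; apply: lerD => //; apply: lerD => //;
  rewrite divr_ge0// run_delta_ge0.
Qed.

Lemma y_error t : (Ex (fun w => (enorm (run_y t.+1 w - ylam (run_x t w)) ^+ 2)%R)
  <= (2 * (nu + ia))%:E)%E.
Proof.
have my t' : mvec (run_y t') by have [_ h _ _] := adap t'; exact: (adapted_mvec hiid h).
have nu0 : 0 <= nu.
  apply: divr_ge0; last by rewrite divr_ge0 ?ltW// mulr_gt0.
  apply: divr_ge0; last by rewrite mulr_ge0 ?sqr_ge0.
  by apply: addr_ge0; [exact: sqr_ge0|rewrite mulr_ge0 ?sqr_ge0].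
apply: (error_recursion (r := fun t w => enorm (run_y t.+1 w - ylam (run_x t w)) ^+ 2)
  (e := fun t w => enorm (run_y t w - ylam (run_x t w)) ^+ 2)
  (th := fun t w => (1 - q) ^+ run_K t w) _ _ nu0 hia) => [t'|t'|t'|t' w|w].
- by apply: nnmeas_sqr; exact: mvecB.
- by apply: nnmeas_theta; exact: mvecB.
- exact: (inner_y_error hiid hGf hGg hdx hdy hmu hg_sc hg_grad hf_grad hlam hlam_mu
    hB_in hB_out heta_y hdelta hK).
- have -> : run_y t'.+1 w - ylam (run_x t'.+1 w) = run_y t'.+1 w - ylam (run_x t' w) +
      (ylam (run_x t' w) - ylam (run_x t'.+1 w)) by rewrite addrA subrK.
  apply: warm_start.
  exact: (ylam_lipschitz hdy hmu hg_sc hg_grad hf_grad hlam hlam_mu).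
- apply: le_trans (hsteps (run_delta_ge0 0 w)).2; apply: ler_wpM2l => //.
  exact: exprn_ge0.
Qed.

Lemma z_error t : (Ex (fun w => (enorm (run_z t.+1 w - yst (run_x t w)) ^+ 2)%R)
  <= (2 * (nu + ia))%:E)%E.
Proof.
have mz t' : mvec (run_z t') by have [_ _ h _] := adap t'; exact: (adapted_mvec hiid h).
have nu0 : 0 <= nu.
  apply: divr_ge0; last by rewrite divr_ge0 ?ltW// mulr_gt0.
  apply: divr_ge0; last by rewrite mulr_ge0 ?sqr_ge0.
  by apply: addr_ge0; [exact: sqr_ge0|rewrite mulr_ge0 ?sqr_ge0].
apply: (error_recursion (r := fun t w => enorm (run_z t.+1 w - yst (run_x t w)) ^+ 2)
  (e := fun t w => enorm (run_z t w - yst (run_x t w)) ^+ 2)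
  (th := fun t w => (1 - q) ^+ run_K t w) _ _ nu0 hia) => [t'|t'|t'|t' w|w].
- by apply: nnmeas_sqr; exact: mvecB.
- by apply: nnmeas_theta; exact: mvecB.
- exact: (inner_z_error hiid hGf hGg hdx hdy hmu hg_sc hg_grad hlam hlam_mu
    hB_in hB_out heta_z hdelta hK).
- have -> : run_z t'.+1 w - yst (run_x t'.+1 w) = run_z t'.+1 w - yst (run_x t' w) +
      (yst (run_x t' w) - yst (run_x t'.+1 w)) by rewrite addrA subrK.
  apply: warm_start.
  apply: le_trans (ystar_lipschitz hdy hmu hg_sc hg_grad _ _) _.
  apply: ler_wpM2r => //; have : 0 < Lg / mu by rewrite divr_gt0.
  by lra.
- apply: le_trans (hsteps (run_delta_ge0 0 w)).2; apply: ler_wpM2l => //.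
  exact: exprn_ge0.
Qed.

(** [26 = 2 * (9 + 4)]: both inner errors are at most [2 * (nu + ia)], with weights 9 and 4 from
    [penalty_gx_error]. *)
Definition grad_noise : R :=
  26 * (lam p * Lg) ^+ 2 * (nu + ia) + 18 * (ell * kappa ^+ 3 / lam p) ^+ 2 + noise_out.

Lemma mvec_gbar t :
  mvec (fun w => @penalty_gx _ _ _ f g (lam p) (run_x t w) (run_y t.+1 w) (run_z t.+1 w)
    - hyper (run_x t w)).
Proof.
have [ax ay az mD] := adap t.
have [ay' az'] := adapted_inner_end hiid hGf hGg hdx hdy hmu hlam hlam_mu hB_in hB_out hK
  ax ay az mD.
have ax' := adapted_sub (@inner_outer_past t 0 false) ax.
have aF := adapted_grad hf_grad (mvec_row_mx ax' ay').
have aG := adapted_grad hg_grad (mvec_row_mx ax' ay').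
have aGz := adapted_grad hg_grad (mvec_row_mx ax' az').
apply: mvecB; last exact: mvec_hyper.
apply: mvecD; first exact: (mvec_lin lsubmx (adapted_mvec hiid aF)).
apply: mvecZ; apply: mvecB; first exact: (mvec_lin lsubmx (adapted_mvec hiid aG)).
exact: (mvec_lin lsubmx (adapted_mvec hiid aGz)).
Qed.

Lemma gradient_error t :
  (Ex (fun w => (enorm (run_G t w - hyper (run_x t w)) ^+ 2)%R) <= grad_noise%:E)%E.
Proof.
apply: le_trans (outer_error hiid hGf hGg hdx hdy hmu hg_sc hg_grad hg_hess hf_lip hf_grad
  hlam hlam_mu hB_in hB_out hdelta hK t) _.
have mry : nnmeas (fun w => enorm (run_y t.+1 w - ylam (run_x t w)) ^+ 2).
  by apply: nnmeas_sqr; apply: mvecB => //; have [_ h _ _] := adap t.+1;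
    exact: (adapted_mvec hiid h).
have mrz : nnmeas (fun w => enorm (run_z t.+1 w - yst (run_x t w)) ^+ 2).
  by apply: nnmeas_sqr; apply: mvecB => //; have [_ _ h _] := adap t.+1;
    exact: (adapted_mvec hiid h).
have no0 : 0 <= noise_out.
  apply: divr_ge0 => //; apply: addr_ge0; first exact: sqr_ge0.
  by rewrite mulr_ge0// mulr_ge0// sqr_ge0.
set A := (lam p * Lg) ^+ 2.
set b := 18 * (ell * kappa ^+ 3 / lam p) ^+ 2.
have A0 : 0 <= A by exact: sqr_ge0.
have b0 : 0 <= b by rewrite mulr_ge0// sqr_ge0.
have h9 : 0 <= 9 * A by rewrite mulr_ge0.
have h4 : 0 <= 4 * A by rewrite mulr_ge0.
have m9 := nnmeasZ h9 mry; have m4 := nnmeasZ h4 mrz.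
have mg := nnmeas_sqr (mvec_gbar t).
pose h w := 1 * (9 * A * enorm (run_y t.+1 w - ylam (run_x t w)) ^+ 2 +
   4 * A * enorm (run_z t.+1 w - yst (run_x t w)) ^+ 2) + (b + noise_out).
have mh : measurable_fun setT h by apply: measurable_affine; exact: (nnmeasD m9 m4).1.
have hle := Ex_le (P := P) (nnmeasD mg (nnmeas_cst no0)) mh.
apply: le_trans (hle _) _ => [w|].
  rewrite /h mul1r addrA lerD2r.
  exact: (penalty_gx_error hdy hmu hg_sc hg_grad hg_hess hf_lip hf_grad hlam hlam_mu).
rewrite /h (Ex_affine (nnmeasD m9 m4)) ?addr_ge0// mul1e ExD// !ExZ//.
have l9 := lee_wpmul2l (x := (9 * A)%:E) h9 (y_error t).
have l4 := lee_wpmul2l (x := (4 * A)%:E) h4 (z_error t).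
apply: le_trans (leeD2r _ (leeD l9 l4)) _.
rewrite -!EFinM -!EFinD lee_fin le_eqVlt; apply/orP; left; apply/eqP.
by rewrite /grad_noise -/A -/b; ring.
Qed.

Context {phi_inf : R}.
Hypothesis heta : 0 < eta_x p.
Hypothesis heta_le : 8 * (ell * kappa ^+ 3) * eta_x p <= 1.
Hypothesis hphi : forall x, phi_inf <= hyperobj f g x.

Local Notation phi := (hyperobj f g).

(** The curvature constant of phi is [2 * ell * kappa ^+ 3], so [heta_le] is exactly the step
    condition [4 * C * eta <= 1] of [descent_arith]. *)
Lemma run_descent t w :
  phi (run_x t.+1 w) - phi_inf + eta_x p / 2 * enorm (hyper (run_x t w)) ^+ 2
    + eta_x p / 4 * enorm (run_G t w) ^+ 2
  <= phi (run_x t w) - phi_inf + eta_x p / 2 * enorm (run_G t w - hyper (run_x t w)) ^+ 2.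
Proof.
have := hyperobj_expansion hdy hmu hg_sc hg_grad hg_hess hf_lip hf_grad
  (run_x t w) (run_x t.+1 w).
rewrite run_xS [_ - eta_x p *: _ - _]addrAC subrr add0r -scaleNr.
apply: descent_arith => //.
by apply: le_trans heta_le; rewrite le_eqVlt; apply/orP; left; apply/eqP; ring.
Qed.

Lemma measurable_phi t : measurable_fun setT (fun w => phi (run_x t w)).
Proof.
apply: measurable_econtinuous => // u e.
exact: (expansion_continuous
  (hyperobj_expansion hdy hmu hg_sc hg_grad hg_hess hf_lip hf_grad)).
Qed.

Lemma mvec_G t : mvec (run_G t).
Proof.
have -> : run_G t = fun w => (eta_x p)^-1 *: (run_x t w - run_x t.+1 w).
  apply/funext => w; rewrite run_xS subKr scalerA mulVf ?scale1r//.
  by rewrite gt_eqF.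
by apply: mvecZ; exact: mvecB.
Qed.

Let hPhi t : nnmeas (fun w => phi (run_x t w) - phi_inf).
Proof.
by split; [apply: measurable_funB => //; exact: measurable_phi|move=> w; rewrite subr_ge0].
Qed.

Let hgr t := nnmeas_sqr (mvec_hyper t).
Let hG2 t := nnmeas_sqr (mvec_G t).
Let herr t := nnmeas_sqr (mvecB (mvec_G t) (mvec_hyper t)).

Let hPhi0 w : phi (run_x 0 w) - phi_inf = phi x0 - phi_inf.
Proof. by []. Qed.

Lemma sum_grad_sqr T :
  (\sum_(t < T) Ex (fun w => (enorm (hyper (run_x t w)) ^+ 2)%R) <=
   (2 * (phi x0 - phi_inf) / eta_x p + T%:R * grad_noise)%:E)%E.
Proof.
exact: (descent_gr hPhi hgr hG2 herr heta hPhi0 run_descent gradient_error).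
Qed.

(** A recursion with factor [1 / 2] has total at most twice its inputs, hence [68 = 2 * 34]. The sum
    of squared displacements is [eta_x ^+ 2] times the sum of the squared [run_G], which the descent
    inequality controls. *)
Lemma sum_delta T :
  (Ex (fun w => (\sum_(t < T) run_delta t w)%R) <=
   (2 * delta0 p + 68 * (Lg / mu) ^+ 2 * eta_x p ^+ 2 *
     (4 * (phi x0 - phi_inf) / eta_x p + 2 * (T%:R * grad_noise)) + 2 * (T%:R * c2))%:E)%E.
Proof.
have mD t : nnmeas (run_delta t).
  by split; [exact: measurable_run_delta|move=> w; exact: run_delta_ge0].
set c := 68 * (Lg / mu) ^+ 2 * eta_x p ^+ 2.
have c0 : 0 <= c by rewrite mulr_ge0 ?sqr_ge0// mulr_ge0// sqr_ge0.
set d0 := 2 * delta0 p + 2 * (T%:R * c2).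
have d00 : 0 <= d0 by rewrite addr_ge0// mulr_ge0// mulr_ge0.
have hS w : \sum_(t < T) run_delta t w <= c * (\sum_(t < T) enorm (run_G t w) ^+ 2) + d0.
  (* The extra [2 * run_delta T w] makes the induction close, since it splits into the next summand
     and the halved term of the recursion. *)
  have : \sum_(t < T) run_delta t w + 2 * run_delta T w <=
      c * (\sum_(t < T) enorm (run_G t w) ^+ 2) + d0.
    rewrite /d0; elim: T {d0 d00} => [|T IH].
      by rewrite !big_ord0 mulr0 !add0r mul0r mulr0 addr0.
    rewrite !big_ord_recr/= (run_deltaS hdelta).
    have -> : run_x T.+1 w - run_x T w = - (eta_x p *: run_G T w).
      by rewrite run_xS addrAC subrr add0r.
    rewrite enormN enormZ (gtr0_norm heta) -[T.+1%:R]natr1 (mulrDl T%:R) mul1r.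
    rewrite (_ : 34 * Lg ^+ 2 / mu ^+ 2 * (eta_x p * enorm (run_G T w)) ^+ 2 =
      c / 2 * enorm (run_G T w) ^+ 2); last by rewrite /c; field; rewrite gt_eqF.
    exact: delta_sum_arith.
  by apply: le_trans; rewrite -[leLHS]addr0 lerD2l mulr_ge0// run_delta_ge0.
have mS := nnmeas_sum T hG2.
apply: le_trans (Ex_le (P := P) (nnmeas_sum T mD) _ hS) _.
  by apply: measurable_affine; exact: mS.1.
rewrite (Ex_affine mS c0 d00) (Ex_sum (h := fun t w => enorm (run_G t w) ^+ 2) T hG2).
have h := descent_G2 hPhi hgr hG2 herr heta hPhi0 run_descent gradient_error T.
have h' := lee_wpmul2l (x := c%:E) c0 h.
apply: le_trans (leeD2r _ h') _; rewrite -EFinM -EFinD lee_fin le_eqVlt.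
by apply/orP; left; apply/eqP; rewrite /d0; ring.
Qed.
End Convergence.

(** * Parameter choice *)

Section NatCeil.
Context {R : realType}.
Implicit Types a : R.

Lemma nat_ceilE a : 0 <= a -> (nat_ceil a)%:R = (Num.ceil a)%:~R :> R.
Proof.
move=> a0; have h : (0 <= Num.ceil a :> int) by rewrite ceil_ge0; lra.
by rewrite /nat_ceil -[in RHS](gez0_abs h).
Qed.

Lemma nat_ceil_ge a : 0 <= a -> a <= (nat_ceil a)%:R.
Proof. by move=> a0; rewrite nat_ceilE// ceil_ge. Qed.

Lemma nat_ceil_le a : 0 <= a -> (nat_ceil a)%:R <= a + 1.
Proof. by move=> a0; rewrite nat_ceilE//; have := @ceilB1_lt _ a; rewrite intrD; lra. Qed.

Lemma batch_size_gt0 a : (0 < batch_size a)%N.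
Proof. by rewrite /batch_size leq_max. Qed.

Lemma batch_size_ge1 a : 1 <= (batch_size a)%:R :> R.
Proof. by rewrite ler1n batch_size_gt0. Qed.

Lemma batch_size_ge a : 0 <= a -> a <= (batch_size a)%:R.
Proof.
by move=> a0; apply: le_trans (nat_ceil_ge a0) _; rewrite ler_nat leq_max leqnn orbT.
Qed.

Lemma batch_size_le a : 0 <= a -> (batch_size a)%:R <= a + 1.
Proof.
move=> a0; rewrite /batch_size /maxn; case: ifP => _; first exact: nat_ceil_le.
by lra.
Qed.

End NatCeil.

(** * Inequalities between the chosen parameters *)

Section ParameterBounds.
Context {R : realType}.
Variables (l mu Lf Lg sf sg Delta R0 e : R).
Hypothesis hmu : 0 < mu.
Hypothesis hmuLg : mu <= Lg.
Hypothesis hLg : Lg <= l.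
Hypothesis hLf0 : 0 <= Lf.
Hypothesis hLf : Lf <= l.
Hypothesis hDelta : 0 < Delta.
Hypothesis hR0 : 0 < R0.
Hypothesis he : 0 < e.
Hypothesis he1 : e <= 1 / 2.
Hypothesis hel : 2 * e <= l.

Local Notation k := (l / mu).
Local Notation Clam := (1 + R0^-1 + Delta^-1).

Local Ltac hlra := move: hmu hmuLg hLg hLf0 hLf hDelta hR0 he he1 hel; lra.

Let l0 : 0 < l. Proof. by hlra. Qed.
Let Lg0 : 0 < Lg. Proof. by hlra. Qed.
Let k1 : 1 <= k. Proof. by rewrite ler_pdivlMr ?mul1r//; hlra. Qed.
Let k0 : 0 < k. Proof. exact: lt_le_trans ltr01 k1. Qed.

(** Multiplied by [e], each of the three candidates is at most a multiple of [l * k ^+ 3], by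
    [e <= l] or [e <= 1] and [1 <= k]. The multiples depend only on [R0] and [Delta], as the hidden
    constants must. *)
Lemma lambda_bounds (L := 16 * Num.max (k / R0) (Num.max (l * k ^+ 2 / Delta) (l * k ^+ 3 / e))) :
  [/\ 0 < L, 16 * k <= L * R0, 16 * (l * k ^+ 3) <= L * e &
     L * e <= 16 * Clam * (l * k ^+ 3)].
Proof.
have a0 : 0 < k / R0 by rewrite divr_gt0.
have lk0 : 0 < l * k ^+ 3 by rewrite mulr_gt0 ?exprn_gt0.
have h1 : k / R0 <= Num.max (k / R0) (Num.max (l * k ^+ 2 / Delta) (l * k ^+ 3 / e)).
  by rewrite le_max lexx.
have h3 : l * k ^+ 3 / e <= Num.max (k / R0) (Num.max (l * k ^+ 2 / Delta) (l * k ^+ 3 / e)).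
  by rewrite !le_max lexx !orbT.
have h4 : Num.max (k / R0) (Num.max (l * k ^+ 2 / Delta) (l * k ^+ 3 / e)) * e <=
    Clam * (l * k ^+ 3).
  have hk2 : k ^+ 2 <= k ^+ 3 by exact: ler_weXn2l.
  have hk3 : k <= k ^+ 3 by rewrite -[leLHS]expr1; exact: ler_weXn2l.
  have i0 : 0 <= R0^-1 by rewrite invr_ge0 ltW.
  have i1 : 0 <= Delta^-1 by rewrite invr_ge0 ltW.
  have p0 : 0 <= R0^-1 * (l * k ^+ 3) by rewrite mulr_ge0// ltW.
  have p1 : 0 <= Delta^-1 * (l * k ^+ 3) by rewrite mulr_ge0// ltW.
  rewrite -ler_pdivlMr// !ge_max; apply/and3P; split; rewrite ler_pdivlMr//.
  - apply: (@le_trans _ _ (R0^-1 * (l * k ^+ 3)));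
      last by rewrite !mulrDl mul1r; move: lk0 p0 p1; lra.
    rewrite mulrAC mulrC; apply: ler_wpM2l => //.
    rewrite mulrC; apply: ler_pM => //; [exact: ltW|exact: ltW|hlra].
  - apply: (@le_trans _ _ (Delta^-1 * (l * k ^+ 3)));
      last by rewrite !mulrDl mul1r; move: lk0 p0 p1; lra.
    rewrite mulrAC mulrC; apply: ler_wpM2l => //.
    rewrite -[leRHS]mulr1; apply: ler_pM; [|exact: ltW| |hlra].
      by rewrite mulr_ge0 ?exprn_ge0 ?ltW.
    by apply: ler_wpM2l; [exact: ltW|].
  - rewrite divfK ?gt_eqF// !mulrDl mul1r; lra.
rewrite /L; move: (Num.max _ _) h1 h3 h4 => m h1 h3 h4; split.
- by rewrite mulr_gt0//; exact: lt_le_trans h1.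
- by rewrite -mulrA ler_pM2l// -ler_pdivrMr.
- by rewrite -mulrA ler_pM2l// -ler_pdivrMr.
- by rewrite -!mulrA ler_pM2l.
Qed.

Variables (L Bo Bi : R).
Hypothesis hL : 0 < L.
Hypothesis hL1 : 16 * k <= L * R0.
Hypothesis hL2 : 16 * (l * k ^+ 3) <= L * e.
Hypothesis hL3 : L * e <= 16 * Clam * (l * k ^+ 3).
Local Notation S := (sf ^+ 2 + L ^+ 2 * sg ^+ 2).
Hypothesis hBo1 : 1 <= Bo.
Hypothesis hBo : 16 * (S / e ^+ 2) <= Bo.
Hypothesis hBi : 16 * ((Lf ^+ 2 + L ^+ 2 * Lg ^+ 2) / (L ^+ 2 * mu ^+ 2) * Bo) <= Bi.

Let Bo0 : 0 < Bo. Proof. exact: lt_le_trans ltr01 hBo1. Qed.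

Lemma lambda_ge_kappa : 32 * k <= L.
Proof.
have h : 16 * (l * k) <= L * e.
  by apply: le_trans hL2; rewrite !ler_pM2l// -[leLHS]expr1; exact: ler_weXn2l.
have h2 : 16 * (2 * e * k) <= 16 * (l * k) by rewrite ler_pM2l// ler_pM2r.
have h3 : 32 * k * e <= L * e by move: h h2; lra.
by rewrite ler_pM2r in h3.
Qed.

Lemma lambda_Lf : Lf / L <= mu / 2.
Proof.
rewrite ler_pdivrMr//; have h := ler_wpM2l (ltW hmu) lambda_ge_kappa.
have hk : mu * k = l by rewrite mulrC divfK ?gt_eqF.
by move: h; rewrite mulrCA hk; hlra.
Qed.

(** The origin of the constant 3 in [delta0], which must also dominate the distance to the penalized
    minimizer. One factor [k / L] is at most [R0 / 16] and the other at most [1 / 32], so the square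
    is linear in [R0]. *)
Lemma init_le : 2 * R0 + 2 * (k / L) ^+ 2 <= 3 * R0.
Proof.
have h1 : k / L <= R0 / 16 by rewrite ler_pdivrMr//; move: hL1; lra.
have h2 : k / L <= 1 / 32 by rewrite ler_pdivrMr//; have := lambda_ge_kappa; lra.
have h0 : 0 <= k / L by rewrite divr_ge0// ltW.
have : (k / L) ^+ 2 <= R0 / 16 * (1 / 32) by rewrite expr2; exact: ler_pM.
have := hR0; lra.
Qed.

Lemma variance_le : S <= e ^+ 2 / 16 * Bo.
Proof.
have e20 : 0 < e ^+ 2 by rewrite exprn_gt0.
have : 16 * (S / e ^+ 2) * e ^+ 2 <= Bo * e ^+ 2 by rewrite ler_pM2r.
by rewrite -mulrA divfK ?gt_eqF//; lra.
Qed.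

Lemma Bi_ge : 16 * (Lg / mu) ^+ 2 * Bo <= Bi.
Proof.
apply: le_trans hBi; rewrite -mulrA ler_pM2l//; apply: ler_wpM2r; first exact: ltW.
rewrite ler_pdivlMr ?mulr_gt0 ?exprn_gt0//.
have -> : (Lg / mu) ^+ 2 * (L ^+ 2 * mu ^+ 2) = L ^+ 2 * Lg ^+ 2.
  by field; rewrite gt_eqF.
by rewrite lerDr sqr_ge0.
Qed.

Let r1 : 1 <= Lg / mu. Proof. by rewrite ler_pdivlMr ?mul1r. Qed.
Let rk : Lg / mu <= k. Proof. by rewrite ler_pM2r ?invr_gt0. Qed.

Let Bi_ge' : 16 * (Lg / mu) * Bo <= Bi.
Proof.
apply: le_trans Bi_ge; apply: ler_wpM2r; first exact: ltW.
by rewrite ler_pM2l// -[leLHS]expr1; exact: ler_weXn2l.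
Qed.

Let Bi0 : 0 < Bi.
Proof. by apply: lt_le_trans Bi_ge'; rewrite mulr_gt0// mulr_gt0// divr_gt0. Qed.

(** In units of [e ^+ 2 / 256] the shares are 26 for the inner noise, 26 for the inner tolerance, 18
    for the bias and 32 for the outer batches: 102 out of the allowed 128. *)
Lemma grad_noise_le :
  26 * (L * Lg) ^+ 2 * (S / ((2 * L * Lg) ^+ 2 * Bi) / (mu / (4 * Lg))
      + (256 * (L * l / e) ^+ 2)^-1)
    + 18 * (l * k ^+ 3 / L) ^+ 2 + (sf ^+ 2 + 2 * (L ^+ 2 * sg ^+ 2)) / Bo
  <= e ^+ 2 / 2.
Proof.
have hS := variance_le.
have f2 : 0 <= sf ^+ 2 := sqr_ge0 _.
have g2 : 0 <= L ^+ 2 * sg ^+ 2 by rewrite mulr_ge0 ?sqr_ge0.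
have n1 : (L * Lg) ^+ 2 * (S / ((2 * L * Lg) ^+ 2 * Bi) / (mu / (4 * Lg))) <= e ^+ 2 / 256.
  have -> : (L * Lg) ^+ 2 * (S / ((2 * L * Lg) ^+ 2 * Bi) / (mu / (4 * Lg))) =
      (Lg / mu) * S / Bi by field; rewrite !gt_eqF.
  rewrite ler_pdivrMr//.
  apply: le_trans (ler_wpM2l (ltW (lt_le_trans ltr01 r1)) hS) _.
  have h := ler_wpM2l (sqr_ge0 e) Bi_ge'.
  by move: h; move: (Lg / mu) => r; lra.
have n2 : (L * Lg) ^+ 2 * (256 * (L * l / e) ^+ 2)^-1 <= e ^+ 2 / 256.
  rewrite ler_pdivrMr ?mulr_gt0 ?exprn_gt0 ?mulr_gt0 ?invr_gt0//.
  have -> : e ^+ 2 / 256 * (256 * (L * l / e) ^+ 2) = (L * l) ^+ 2.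
    by field; rewrite gt_eqF.
  rewrite !exprMn ler_pM2l ?exprn_gt0//.
  by rewrite ler_sqr// nnegrE ltW.
have n3 : (l * k ^+ 3 / L) ^+ 2 <= e ^+ 2 / 256.
  have -> : e ^+ 2 / 256 = (e / 16) ^+ 2 by field.
  have lk0 : 0 < l * k ^+ 3 by rewrite mulr_gt0 ?exprn_gt0.
  have e16 : 0 <= e / 16 by rewrite divr_ge0// ltW.
  have a0 : 0 <= l * k ^+ 3 / L by rewrite divr_ge0// ltW.
  rewrite ler_sqr ?nnegrE// ler_pdivrMr//.
  by move: (l * k ^+ 3) lk0 hL2 => a; lra.
have n4 : (sf ^+ 2 + 2 * (L ^+ 2 * sg ^+ 2)) / Bo <= e ^+ 2 / 8.
  by rewrite ler_pdivrMr//; lra.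
have fin (X a b c E d : R) : X * a <= E / 256 -> X * b <= E / 256 -> c <= E / 256 ->
    d <= E / 8 -> 0 <= E -> 26 * X * (a + b) + 18 * c + d <= E / 2.
  have -> : 26 * X * (a + b) = 26 * (X * a) + 26 * (X * b) by ring.
  by lra.
exact: (fin _ _ _ _ _ _ n1 n2 n3 n4 (sqr_ge0 _)).
Qed.

Let T' := l * k ^+ 3 / e ^+ 2.

(** Keeps the noise term of the recursion of delta at most 1, so that it adds only [O(T)] to the
    sum. The outer batch size dominates [L ^+ 2 * sg ^+ 2] in units of [e ^+ 2], and [L ^+ 2 * Lg]
    dominates [e]. *)
Lemma drift_noise_le : sg ^+ 2 / (2 * Lg * Bi) <= 1.
Proof.
have hS := variance_le.
have B0 : 0 < 2 * Lg * Bi by rewrite mulr_gt0// mulr_gt0.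
rewrite ler_pdivrMr// mul1r.
have L2 : 0 < L ^+ 2 by rewrite exprn_gt0.
rewrite -(ler_pM2l L2).
apply: (@le_trans _ _ (e ^+ 2 / 16 * Bo)).
  by apply: le_trans hS; rewrite lerDr sqr_ge0.
have h1 : Bo <= Bi.
  apply: le_trans Bi_ge'; rewrite -[leLHS]mul1r; apply: ler_wpM2r; first exact: ltW.
  by move: r1; lra.
have hLe : 16 * l <= L * e.
  apply: le_trans hL2; rewrite ler_pM2l// -[leLHS]mulr1 ler_pM2l//.
  exact: exprn_ege1.
have hLL : 32 * k * (16 * l) <= L * (L * e).
  by apply: ler_pM lambda_ge_kappa hLe; rewrite mulr_ge0// ltW.
have hLL' : 32 * k * (16 * l) * mu <= L * (L * e) * Lg.
  apply: ler_pM => //; last exact: ltW.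
  by rewrite ?mulr_ge0 ?invr_ge0 ?ltW.
have hkl : 32 * k * (16 * l) * mu = 512 * (l * l) by field; rewrite gt_eqF.
have hll : 2 * e * (2 * e) <= l * l by apply: ler_pM => //; rewrite mulr_ge0// ltW.
have h2 : 2048 * e <= L ^+ 2 * Lg.
  by rewrite -(ler_pM2r he); move: hLL'; rewrite hkl; move: hll; lra.
apply: (@le_trans _ _ (L ^+ 2 * Lg * Bo)); last first.
  have -> : L ^+ 2 * (2 * Lg * Bi) = L ^+ 2 * Lg * (2 * Bi) by ring.
  apply: ler_wpM2l; first by rewrite mulr_ge0 ?ltW.
  by move: h1 Bi0; lra.
apply: ler_wpM2r; first exact: ltW.
apply: le_trans h2; have : e ^+ 2 <= e * (1 / 2) by rewrite expr2 ler_pM2l.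
by have := he; lra.
Qed.

Let T'_ge1 : 1 <= T'.
Proof.
rewrite ler_pdivlMr ?exprn_gt0// mul1r.
have h : e ^+ 2 <= l * 1 by rewrite expr2; apply: ler_pM; rewrite ?ltW//; hlra.
by apply: le_trans h _; rewrite ler_pM2l// exprn_ege1.
Qed.

(** Lets constants be absorbed into the logarithm: its argument is at least 2, and [ln 2] is at
    least [1 / 2]. *)
Lemma ln_ge : 1 <= 2 * ln (l * k / e).
Proof.
have h2 : 2 <= l * k / e.
  rewrite ler_pdivlMr//; apply: le_trans hel _.
  by rewrite -[leLHS]mulr1 ler_pM2l.
have h : ln (2 : R) <= ln (l * k / e).
  by rewrite ler_ln ?posrE//; exact: lt_le_trans h2.
have h' : 1 <= 2 * ln (2 : R).
  have := @le_ln1Dx R (- (1 / 2)); rewrite (_ : 1 + - (1 / 2) = 2^-1) ?lnV ?posrE//; last by field.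
  by move=> /(_ ltac:(lra)); lra.
by move: h h'; lra.
Qed.

(** The reason for the exponent 6: [L * l / e] is of order [l ^+ 2 * k ^+ 3 / e ^+ 2], so its square
    carries [k ^+ 6], which cancels and leaves [(e / l) ^+ 2]. *)
Lemma log_coef_le :
  256 * (L * l / e) ^+ 2 / (l * k / e) ^+ 6 <= (256 * Clam) ^+ 2 * (e / l) ^+ 2.
Proof.
have N0 : 0 < l * k / e by rewrite divr_gt0// mulr_gt0.
rewrite ler_pdivrMr ?exprn_gt0//.
have C0 : 0 < Clam by rewrite addr_gt0 ?invr_gt0// addr_gt0// invr_gt0.
have h : L * l / e <= 16 * Clam * (l ^+ 2 * k ^+ 3 / e ^+ 2).
  have -> : L * l / e = L * e * (l / e ^+ 2) by field; rewrite gt_eqF.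
  have -> : 16 * Clam * (l ^+ 2 * k ^+ 3 / e ^+ 2) =
     16 * Clam * (l * k ^+ 3) * (l / e ^+ 2) by field; rewrite !gt_eqF.
  by apply: ler_wpM2r hL3; rewrite divr_ge0 ?sqr_ge0 ?ltW.
have -> : (256 * Clam) ^+ 2 * (e / l) ^+ 2 * (l * k / e) ^+ 6 =
    256 * (16 * Clam * (l ^+ 2 * k ^+ 3 / e ^+ 2)) ^+ 2.
  by field; rewrite !gt_eqF.
rewrite ler_pM2l//; apply: lerXn2r => //; rewrite nnegrE.
  by rewrite divr_ge0 ?mulr_ge0 ?ltW.
by rewrite ?mulr_ge0 ?exprn_ge0 ?invr_ge0 ?exprn_ge0 ?mulr_ge0 ?invr_ge0 ?ltW.
Qed.

Local Notation CT := (32 * Delta + 1).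
Variables (T gn c2 : R).
Hypothesis hT0 : 0 <= T.
Hypothesis hT : T <= CT * T' + 1.
Hypothesis hgn0 : 0 <= gn.
Hypothesis hgn : gn <= e ^+ 2 / 2.
Hypothesis hc20 : 0 <= c2.
Hypothesis hc2 : c2 <= 1.

Local Notation eta := (1 / 8 / (l * k ^+ 3)).
Local Notation rho := (256 * (L * l / e) ^+ 2 / (l * k / e) ^+ 6).
Local Notation Sdelta := (2 * (3 * R0) +
  68 * (Lg / mu) ^+ 2 * eta ^+ 2 * (4 * Delta / eta + 2 * (T * gn)) + 2 * (T * c2)).
Local Notation Cdelta := ((256 * Clam) ^+ 2 * (6 * R0 + 34 * Delta + 3 * (CT + 1))).

Let T_le : T <= (CT + 1) * T'.
Proof. by apply: le_trans hT _; rewrite (mulrDl CT 1) mul1r lerD2l. Qed.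

Let lk30 : 0 < l * k ^+ 3. Proof. by rewrite mulr_gt0// exprn_gt0. Qed.
Let r0 : 0 <= Lg / mu. Proof. by rewrite ltW// divr_gt0. Qed.

Let drift_le : (Lg / mu) ^+ 2 * eta <= (8 * (l * k))^-1.
Proof.
apply: (@le_trans _ _ (k ^+ 2 * eta)).
  by apply: ler_wpM2r; [rewrite ltW// divr_gt0|rewrite lerXn2r ?nnegrE// ltW].
by rewrite le_eqVlt; apply/orP; left; apply/eqP; field; rewrite !gt_eqF.
Qed.

Let drift_sqr_le : (Lg / mu) ^+ 2 * eta ^+ 2 * e ^+ 2 <= 1 / 256.
Proof.
have -> : (Lg / mu) ^+ 2 * eta ^+ 2 * e ^+ 2 = (Lg / mu * eta * e) ^+ 2 by rewrite !exprMn.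
have -> : 1 / 256 = (1 / 16) ^+ 2 :> R by field.
have e0 : 0 < eta by rewrite divr_gt0.
have h0 : 0 <= Lg / mu * eta * e by rewrite mulr_ge0 ?(ltW he)// mulr_ge0 ?(ltW e0).
rewrite ler_sqr ?nnegrE//.
have rk3 : Lg / mu <= k ^+ 3.
  by apply: le_trans rk _; rewrite -[leLHS]expr1; exact: ler_weXn2l.
apply: (@le_trans _ _ (k ^+ 3 * eta * (l / 2))).
  apply: ler_pM; [by rewrite mulr_ge0 ?(ltW e0)|exact: ltW| |by hlra].
  by rewrite ler_pM2r.
by rewrite le_eqVlt; apply/orP; left; apply/eqP; field; rewrite !gt_eqF.
Qed.

(** [rho] is the slope in delta of the affine bound on the step count, and [Sdelta] bounds the sum
    of delta. Since [Sdelta] is at most [6 * R0 + 34 * Delta / (l * k) + 3 * T], the part of the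
    count outside the logarithm is [O(1)] per iteration on average, up to the factor [Lg / mu]. *)
Lemma delta_sum_le : rho * Sdelta <= Cdelta * T'.
Proof.
have e0 : 0 < eta by rewrite divr_gt0.
have D0 := hDelta; have R00 := hR0.
have hS : Sdelta <= 6 * R0 + 34 * Delta * (l * k)^-1 + 3 * T.
  have -> : Sdelta = 6 * R0 + 272 * Delta * ((Lg / mu) ^+ 2 * eta) +
     (136 * ((Lg / mu) ^+ 2 * eta ^+ 2 * gn) * T + 2 * c2 * T).
    by field; rewrite !gt_eqF.
  have h1 : 272 * Delta * ((Lg / mu) ^+ 2 * eta) <= 34 * Delta * (l * k)^-1.
    apply: le_trans (ler_wpM2l _ drift_le) _; first by rewrite mulr_ge0// ltW.
    by rewrite le_eqVlt; apply/orP; left; apply/eqP; field; rewrite !gt_eqF.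
  have h2 : 136 * ((Lg / mu) ^+ 2 * eta ^+ 2 * gn) <= 1.
    have : (Lg / mu) ^+ 2 * eta ^+ 2 * gn <= (Lg / mu) ^+ 2 * eta ^+ 2 * (e ^+ 2 / 2).
      by apply: ler_wpM2l => //; rewrite mulr_ge0 ?sqr_ge0.
    by have := drift_sqr_le; rewrite mulrA; lra.
  have h3 := ler_wpM2r hT0 h2.
  have h4 : 2 * c2 * T <= 2 * T by rewrite ler_wpM2r//; move: hc2; lra.
  by move: h1 h3 h4; rewrite mul1r; lra.
have S0 : 0 <= Sdelta.
  have h1 : 0 <= 4 * Delta / eta by rewrite divr_ge0 ?(ltW e0)// mulr_ge0// ltW.
  have h2 : 0 <= 2 * (T * gn) by rewrite !mulr_ge0.
  have h3 : 0 <= 68 * (Lg / mu) ^+ 2 * eta ^+ 2.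
    by rewrite mulr_ge0 ?sqr_ge0// mulr_ge0 ?sqr_ge0.
  have h4 : 0 <= 2 * (T * c2) by rewrite !mulr_ge0.
  by have := mulr_ge0 h3 (addr_ge0 h1 h2); lra.
have C0 : 0 <= (256 * Clam) ^+ 2 := sqr_ge0 _.
apply: le_trans (ler_wpM2r S0 log_coef_le) _.
rewrite -[leRHS]mulrA -[leLHS]mulrA; apply: ler_wpM2l => //.
apply: le_trans (ler_wpM2l (sqr_ge0 _) hS) _.
have X1 : (e / l) ^+ 2 <= 1.
  by rewrite exprn_ile1 ?divr_ge0 ?(ltW he) ?(ltW l0)// ler_pdivrMr// mul1r; hlra.
have XT : (e / l) ^+ 2 * (l * k)^-1 <= T'.
  rewrite ler_pdivlMr ?exprn_gt0//.
  have -> : (e / l) ^+ 2 * (l * k)^-1 * e ^+ 2 = e ^+ 4 / (l ^+ 3 * k).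
    by field; rewrite !gt_eqF.
  rewrite ler_pdivrMr ?mulr_gt0 ?exprn_gt0 ?invr_gt0//.
  have -> : l * k ^+ 3 * (l ^+ 3 * k) = (l * k) ^+ 4 by ring.
  have lk0 : 0 < l * k by rewrite mulr_gt0.
  apply: lerXn2r; rewrite ?nnegrE ?(ltW lk0) ?(ltW he)//.
  apply: (@le_trans _ _ l); first by hlra.
  by rewrite -[leLHS]mulr1 ler_pM2l.
have T1 := T'_ge1; have Tl := T_le; have X0 := sqr_ge0 (e / l).
have i1 : (e / l) ^+ 2 * (6 * R0) <= 6 * R0 * T'.
  rewrite mulrC ler_pM2l ?mulr_gt0//; exact: le_trans X1 T1.
have i2 : (e / l) ^+ 2 * (34 * Delta * (l * k)^-1) <= 34 * Delta * T'.
  by rewrite mulrCA; apply: ler_wpM2l => //; rewrite mulr_ge0// ltW.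
have i3 : (e / l) ^+ 2 * (3 * T) <= 3 * (CT + 1) * T'.
  rewrite -mulrA mulrCA ler_pM2l//; apply: le_trans Tl.
  by rewrite -[leRHS]mul1r ler_wpM2r.
rewrite !(mulrDr ((e / l) ^+ 2)) !(mulrDl _ _ T').
by move: i1 i2 i3; rewrite !mulrDr !mulrDl; lra.
Qed.

Local Notation lnN := (ln (l * k / e)).
Local Notation Ccalls := (66 * ((CT + 1) * 98 + 16 * Cdelta) + 6 * (CT + 1)).

(** The inner batch costs a factor [k ^+ 2] over the outer one. Since [1 <= k] and [1 <= Bo], the
    contributions [4 + 16 + 1] fit under 22. *)
Lemma Bi_le : Bi <= 16 * ((Lf ^+ 2 + L ^+ 2 * Lg ^+ 2) / (L ^+ 2 * mu ^+ 2) * Bo) + 1 ->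
  Bi <= 22 * k ^+ 2 * Bo.
Proof.
have mL0 : 0 < L ^+ 2 * mu ^+ 2 by rewrite mulr_gt0 ?exprn_gt0.
move=> h; apply: le_trans h _.
have h1 : (Lf ^+ 2 + L ^+ 2 * Lg ^+ 2) / (L ^+ 2 * mu ^+ 2) <= 1 / 4 + k ^+ 2.
  have -> : (Lf ^+ 2 + L ^+ 2 * Lg ^+ 2) / (L ^+ 2 * mu ^+ 2) =
     (Lf / L) ^+ 2 / mu ^+ 2 + (Lg / mu) ^+ 2 by field; rewrite !gt_eqF.
  apply: lerD; last by rewrite lerXn2r ?nnegrE// ltW.
  rewrite ler_pdivrMr ?exprn_gt0//.
  have -> : 1 / 4 * mu ^+ 2 = (mu / 2) ^+ 2 by field.
  by rewrite lerXn2r ?nnegrE ?divr_ge0 ?(ltW hL) ?(ltW hmu)// lambda_Lf.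
have h2 := ler_wpM2r (ltW Bo0) h1.
have kk : 1 <= k ^+ 2 by exact: exprn_ege1.
have h3 := ler_wpM2r (ltW Bo0) kk.
by move: h2 h3 hBo1; rewrite mulrDl; lra.
Qed.

Hypothesis hBi' : Bi <= 22 * k ^+ 2 * Bo.

(** The factor [k ^+ 3] is [k ^+ 2] from the inner batch size times [k] from the number of inner
    steps. In the constant, [66 = 3 * 22] and [98 = 2 + 48 + 48], after [1 <= 2 * lnN]. *)
Lemma calls_le :
  3 * Bi * (T * (1 + 8 * (Lg / mu) * (6 * lnN + 3)) + 8 * (Lg / mu) * (rho * Sdelta))
    + 3 * (T * Bo) <= Ccalls * (k ^+ 3 * T' * Bo * lnN).
Proof.
have D0 := hDelta; have R00 := hR0.
have T1 := T'_ge1; have hl := ln_ge.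
have T0 : 0 <= T' by lra.
have l0' : 0 <= lnN by lra.
have C0 : 0 <= (256 * Clam) ^+ 2 := sqr_ge0 _.
have Cd0 : 0 <= Cdelta by rewrite mulr_ge0//; lra.
have CT0 : 0 <= CT + 1 by lra.
have i1 : 1 + 8 * (Lg / mu) * (6 * lnN + 3) <= 98 * (k * lnN).
  have a1 : 8 * (Lg / mu) * (6 * lnN + 3) <= 8 * k * (6 * lnN + 3).
    by rewrite ler_wpM2r//; [lra|rewrite ler_pM2l].
  have a2 : 1 * 1 <= k * (2 * lnN) by apply: ler_pM.
  have a3 : k * 1 <= k * (2 * lnN) by rewrite ler_pM2l.
  by move: a1 a2 a3; lra.
have i2 : T * (1 + 8 * (Lg / mu) * (6 * lnN + 3)) <= (CT + 1) * T' * (98 * (k * lnN)).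
  have a1 : 0 <= 8 * (Lg / mu) * (6 * lnN + 3).
    by apply: mulr_ge0; [rewrite mulr_ge0|lra].
  by apply: ler_pM => //; lra.
have i3 : 8 * (Lg / mu) * (rho * Sdelta) <= 16 * (k * lnN) * (Cdelta * T').
  apply: (@le_trans _ _ (8 * (Lg / mu) * (Cdelta * T'))).
    by apply: ler_wpM2l delta_sum_le; rewrite mulr_ge0.
  apply: ler_wpM2r; first by rewrite mulr_ge0.
  have a3 : k * 1 <= k * (2 * lnN) by rewrite ler_pM2l.
  by move: rk a3; lra.
have Y0 : 0 <= ((CT + 1) * 98 + 16 * Cdelta) * (T' * (k * lnN)).
  apply: mulr_ge0; first by lra.
  by rewrite mulr_ge0// mulr_ge0// ltW.
have i4 : 3 * Bi * (T * (1 + 8 * (Lg / mu) * (6 * lnN + 3)) +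
    8 * (Lg / mu) * (rho * Sdelta)) <=
    3 * (22 * k ^+ 2 * Bo) * (((CT + 1) * 98 + 16 * Cdelta) * (T' * (k * lnN))).
  apply: (@le_trans _ _ (3 * Bi * (((CT + 1) * 98 + 16 * Cdelta) * (T' * (k * lnN))))).
    apply: ler_wpM2l; first by rewrite mulr_ge0// ltW.
    by move: i2 i3; rewrite (mulrDl _ _ (T' * _)); lra.
  by apply: ler_wpM2r => //; rewrite ler_pM2l.
have i5 : T * Bo <= 2 * (CT + 1) * (k ^+ 3 * T' * Bo * lnN).
  have -> : 2 * (CT + 1) * (k ^+ 3 * T' * Bo * lnN) =
     (CT + 1) * T' * Bo * (k ^+ 3 * (2 * lnN)) by ring.
  apply: (@le_trans _ _ ((CT + 1) * T' * Bo)); first by rewrite ler_pM2r.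
  have k3 : 1 <= k ^+ 3 by exact: exprn_ege1.
  have : 1 * 1 <= k ^+ 3 * (2 * lnN) by apply: ler_pM.
  rewrite mulr1 => h; rewrite -[leLHS]mulr1; apply: ler_wpM2l => //.
  by rewrite mulr_ge0 ?(ltW Bo0)// mulr_ge0.
apply: (@le_trans _ _ (3 * (22 * k ^+ 2 * Bo) * (((CT + 1) * 98 + 16 * Cdelta) *
  (T' * (k * lnN))) + 3 * (2 * (CT + 1) * (k ^+ 3 * T' * Bo * lnN)))).
  by apply: lerD => //; rewrite ler_pM2l.
rewrite le_eqVlt; apply/orP; left; apply/eqP.
by move: Cdelta CT T' lnN => u v x y; ring.
Qed.

Let T'N : 1 <= l ^+ 2 * k ^+ 6 / e ^+ 2.
Proof.
have h : 1 <= l * k ^+ 3 / e.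
  rewrite ler_pdivlMr// mul1r; apply: (@le_trans _ _ l); first by hlra.
  by rewrite -[leLHS]mulr1 ler_pM2l// exprn_ege1.
have -> : l ^+ 2 * k ^+ 6 / e ^+ 2 = (l * k ^+ 3 / e) ^+ 2 by field; rewrite !gt_eqF.
exact: exprn_ege1.
Qed.

Let e2_le1 : e ^+ 2 <= 1.
Proof. by rewrite exprn_ile1 ?(ltW he)//; hlra. Qed.

Lemma Bo_le_det : sg = 0 -> Bo <= 16 * (S / e ^+ 2) + 1 ->
  Bo <= (16 * sf ^+ 2 + 1) / e ^+ 2.
Proof.
move=> ->; rewrite expr0n/= mulr0 addr0 => h; apply: le_trans h _.
have e20 : 0 < e ^+ 2 by rewrite exprn_gt0.
rewrite ler_pdivlMr// mulrDl -mulrA divfK ?gt_eqF//.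
by rewrite lerD2l mul1r.
Qed.

(** Noise in [g] is amplified by [L ^+ 2], of order [l ^+ 2 * k ^+ 6 / e ^+ 2]; this is the whole
    gap between the two complexity bounds. *)
Lemma Bo_le_noisy : Bo <= 16 * (S / e ^+ 2) + 1 ->
  Bo <= (16 * sf ^+ 2 + 1 + 16 * (16 * Clam) ^+ 2 * sg ^+ 2) * (l ^+ 2 * k ^+ 6 / e ^+ 4).
Proof.
have e20 : 0 < e ^+ 2 by rewrite exprn_gt0.
have hY := T'N; set Y := l ^+ 2 * k ^+ 6 / e ^+ 2 in hY *.
move=> h; rewrite -(ler_pM2r e20); apply: le_trans (ler_wpM2r (ltW e20) h) _.
have -> : (16 * (S / e ^+ 2) + 1) * e ^+ 2 = 16 * S + e ^+ 2 by field; rewrite gt_eqF.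
have -> : (16 * sf ^+ 2 + 1 + 16 * (16 * Clam) ^+ 2 * sg ^+ 2) *
    (l ^+ 2 * k ^+ 6 / e ^+ 4) * e ^+ 2 =
    (16 * sf ^+ 2 + 1 + 16 * (16 * Clam) ^+ 2 * sg ^+ 2) * Y.
  by rewrite /Y; field; rewrite !gt_eqF.
have i1 : sf ^+ 2 * 1 <= sf ^+ 2 * Y by apply: ler_wpM2l hY; exact: sqr_ge0.
have i2 : L ^+ 2 * sg ^+ 2 <= (16 * Clam) ^+ 2 * Y * sg ^+ 2.
  apply: ler_wpM2r; first exact: sqr_ge0.
  rewrite -(ler_pM2r e20) -exprMn.
  have -> : (16 * Clam) ^+ 2 * Y * e ^+ 2 = (16 * Clam * (l * k ^+ 3)) ^+ 2.
    by rewrite /Y; field; rewrite !gt_eqF.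
  have h0 : 0 <= L * e by rewrite mulr_ge0 ?ltW.
  by apply: lerXn2r hL3; rewrite nnegrE//; exact: le_trans h0 hL3.
have := e2_le1; rewrite !mulrDl mul1r.
by move: hY i1 i2; rewrite mulr1; clearbody Y; lra.
Qed.

End ParameterBounds.

(** [nat_ceil] is the absolute value of the ceiling, so the value [k] is taken on two half-open
    intervals. *)
Lemma measurable_nat_ceil {R : realType} d (T : measurableType d) (h : T -> R) k :
  measurable_fun setT h -> measurable [set x | nat_ceil (h x) = k].
Proof.
move=> mh; pose I (z : int) : set R := [set` `](z - 1)%:~R, z%:~R]].
have -> : [set x | nat_ceil (h x) = k] = setT `&` h @^-1` (I k `|` I (- k%:Z)).
  rewrite setTI; apply/seteqP; split => x /=; rewrite /I /= !in_itv/= /nat_ceil.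
    move=> kE; have := @ceilB1_lt _ (h x); have := @ceil_ge _ (h x).
    have [hc|hc] : Num.ceil (h x) = k \/ Num.ceil (h x) = - k%:Z by lia.
      by rewrite hc => -> ->; left.
    by rewrite hc => -> ->; right.
  by case=> /ceil_def ->; lia.
by apply: mh => //; apply: measurableU; exact: measurable_itv.
Qed.

(** * The number of inner steps *)

Section InnerSteps.
Context {R : realType}.
Variables (mu Lg a : R).
Hypothesis hmu : 0 < mu.
Hypothesis hmuLg : mu <= Lg.
Hypothesis ha : 0 < a.

Local Notation steps delta := (nat_ceil (8 * (Lg / mu) * ln (expR 1 + a * delta))).
Local Notation q := (mu / (4 * Lg)).

Let Lg0 : 0 < Lg. Proof. exact: lt_le_trans hmuLg. Qed.

Let e2 : 2 <= expR 1 :> R. Proof. exact: (@expR_ge1Dx R 1). Qed.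

Lemma measurable_inner_steps k : measurable [set delta | steps delta = k].
Proof.
apply: measurable_nat_ceil; apply: measurable_funM => //.
apply: measurableT_comp; first exact: measurable_ln.
by apply: measurable_funD => //; exact: measurable_funM.
Qed.

(** The coefficient satisfies [8 * (Lg / mu) * q = 2], so the contraction is at most [u ^- 2] with
    [u] the argument of the logarithm. Then [2 <= u] gives [1 / 4], and [a * delta <= u] gives
    [a^-1]. *)
Lemma inner_steps_contract delta : 0 <= delta ->
  (1 - q) ^+ steps delta <= 1 / 4 /\ (1 - q) ^+ steps delta * delta <= a^-1.
Proof.
move=> d0; have ad0 : 0 <= a * delta by rewrite mulr_ge0// ltW.
have : 2 <= expR 1 + a * delta by rewrite (le_trans e2)// lerDl.
have : a * delta <= expR 1 + a * delta by rewrite lerDr; exact: expR_ge0.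
move: (expR 1 + a * delta) => u hu u2.
have u0 : 0 < u by lra.
have lnu0 : 0 <= ln u by rewrite ln_ge0//; lra.
have q0 : 0 < q by rewrite divr_gt0// mulr_gt0.
have q1 : 0 <= 1 - q.
  by rewrite subr_ge0 ler_pdivrMr ?mulr_gt0// mul1r; move: hmuLg Lg0; lra.
have hq : (1 - q) ^+ nat_ceil (8 * (Lg / mu) * ln u) <= u ^- 2.
  have h1 : 1 - q <= expR (- q) by exact: expR_ge1Dx.
  apply: (@le_trans _ _ (expR (- q) ^+ nat_ceil (8 * (Lg / mu) * ln u))).
    by apply: lerXn2r h1; rewrite nnegrE// expR_ge0.
  have -> : u ^- 2 = expR (- (2 * ln u)) by rewrite expRN expRM_natl lnK ?posrE.
  rewrite -expRM_natl ler_expR mulrN lerN2.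
  have h0 : 0 <= 8 * (Lg / mu) * ln u by rewrite !mulr_ge0// ?invr_ge0// ltW.
  have := ler_wpM2r (ltW q0) (nat_ceil_ge h0); apply: le_trans.
  rewrite le_eqVlt; apply/orP; left; apply/eqP; field.
  by rewrite !gt_eqF.
have v1 : u^-1 <= 1 / 2.
  by rewrite mul1r lef_pV2 ?posrE.
have v0 : 0 < u^-1 by rewrite invr_gt0.
split.
  apply: le_trans hq _; rewrite -exprVn.
  have -> : 1 / 4 = (1 / 2) ^+ 2 :> R by field.
  by apply: lerXn2r v1; rewrite nnegrE ?ltW.
apply: le_trans (ler_wpM2r d0 hq) _; rewrite -exprVn.
apply: (@le_trans _ _ (u^-1 * delta)).
  apply: ler_wpM2r => //; rewrite expr2 -[leRHS]mulr1; apply: ler_wpM2l.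
    exact: ltW.
  by apply: le_trans v1 _; rewrite ler_pdivrMr// mul1r ler1n.
by rewrite ler_pdivrMl// ler_pdivlMr// mulrC.
Qed.

(* [ln u <= ln M + u / M - 1] with [M = N ^+ 6] makes the number of steps affine in
   [delta], whose expectation is controlled. *)
Lemma inner_steps_le (N delta : R) : 1 <= N -> 0 <= delta ->
  (steps delta)%:R <= 1 + 8 * (Lg / mu) * (6 * ln N + 3 + a / N ^+ 6 * delta).
Proof.
move=> N1 d0; have N0 : 0 < N by exact: lt_le_trans N1.
have M0 : 0 < N ^+ 6 by rewrite exprn_gt0.
have M1 : 1 <= N ^+ 6 by exact: exprn_ege1.
set u := expR 1 + a * delta.
have ad0 : 0 <= a * delta by rewrite mulr_ge0// ltW.
have u2 : 2 <= u by rewrite (le_trans e2)// lerDl.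
have u0 : 0 < u by lra.
have lnu0 : 0 <= ln u by rewrite ln_ge0//; lra.
have h0 : 0 <= 8 * (Lg / mu) * ln u by rewrite !mulr_ge0// ?invr_ge0// ltW.
apply: le_trans (nat_ceil_le h0) _; rewrite addrC lerD2l.
apply: ler_wpM2l; first by rewrite mulr_ge0// divr_ge0// ltW.
have -> : ln u = 6 * ln N + ln (u / N ^+ 6).
  by rewrite ln_div ?posrE// lnXn// -mulr_natl; ring.
rewrite -addrA lerD2l.
have um0 : 0 < u / N ^+ 6 by rewrite divr_gt0.
have h1 := @le_ln1Dx R (u / N ^+ 6 - 1).
have := h1 _; rewrite addrCA subrr addr0 => h2.
apply: le_trans (h2 _) _; first by lra.
rewrite /u mulrDl (mulrAC a) -[leLHS]addrA (addrC _ (-1)) addrA lerD2r.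
have : expR 1 / N ^+ 6 <= expR 1 by rewrite ler_pdivrMr// ler_peMr// expR_ge0.
(* The summand 3 in the statement is this 4 minus the 1 of the tangent line; the bound follows from
   [expR (- (1 / 2)) >= 1 / 2]. *)
suff : expR 1 <= 4 :> R by lra.
have := @expR_ge1Dx R (- (1 / 2)).
have -> : expR 1 = (expR (- (1 / 2)) ^+ 2)^-1 :> R.
  by rewrite -expRM_natl -expRN; congr expR; field.
move=> h; have -> : 4 = ((1 / 2) ^+ 2)^-1 :> R by field.
rewrite lef_pV2 ?posrE ?exprn_gt0 ?expR_gt0//.
by apply: lerXn2r; rewrite ?nnegrE ?expR_ge0//; lra.
Qed.

End InnerSteps.

(** Pointwise arithmetic-geometric mean inequality, used instead of Jensen to pass from second to
    first moments. *)
Lemma Ex_enorm_le {R : realType} {d} {W : measurableType d} {P : probability W R} n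
    (X : W -> 'rV[R]_n) (e : R) : 0 < e -> mvec X ->
  (\int[P]_w (enorm (X w))%:E <=
    (2 * e)^-1%:E * \int[P]_w (enorm (X w) ^+ 2)%:E + (e / 2)%:E)%E.
Proof.
move=> e0 mX; have mS := measurable_enorm_sqr mX.
have c0 : 0 <= (2 * e)^-1 by rewrite invr_ge0 mulr_ge0// ltW.
have hX : nnmeas (fun w => enorm (X w)).
  split=> //.
  apply: (measurable_econtinuous (F := @enorm R n)) mX.
  apply: (@enorm_lipschitz_econtinuous _ _ _ 1) => u v; rewrite mul1r ler_norml.
  have := enormD (u - v) v; have := enormD (v - u) u; rewrite !subrK.
  by rewrite (enormB v u); lra.
have hS : nnmeas (fun w => enorm (X w) ^+ 2) by split=> // w; exact: sqr_ge0.
rewrite -(Ex_affine hS c0) ?divr_ge0 ?(ltW e0)//.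
apply: Ex_le => //; first exact: (measurable_affine _ _ mS).
move=> w; rewrite -(ler_pM2l (x := 2 * e)) ?mulr_gt0//.
rewrite mulrDr mulrA mulfV ?mul1r; last by rewrite gt_eqF// mulr_gt0.
have := sqr_ge0 (enorm (X w) - e); rewrite sqrrB => h.
have -> : 2 * e * (e / 2) = e ^+ 2 by field.
by move: h; rewrite -mulr_natr; lra.
Qed.

(** [c_eta] meets the step condition with equality; the three 16s and [c_log] set the shares of the
    gradient error; [c_del] covers both initial errors; [c_K] makes the inner contraction quadratic
    in the argument of the logarithm. *)
Definition choice_consts {R : realType} : @hidden_consts R :=
  {| c_eta := 1 / 8; c_lam := 16; c_out := 16; c_in := 16; c_del := 3; c_K := 8;
     c_log := 256 |}.

Lemma calls_regroup {R : comPzRingType} (B r rho S t u o : R) :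
  3 * B * (r * rho) * S + (3 * B * (t * u) + 3 * (t * o)) =
  3 * B * (t * u + r * (rho * S)) + 3 * (t * o).
Proof. by ring. Qed.

Lemma calls_regroup_cst {R : comPzRingType} (B t u o : R) :
  3 * B * (t * u) + 3 * (t * o) = t * (3 * B * u + 3 * o).
Proof. by ring. Qed.

Lemma det_rate {F : fieldType} (l k e x y : F) : e != 0 ->
  k ^+ 3 * (l * k ^+ 3 / e ^+ 2) * (x / e ^+ 2) * y = x * (l * k ^+ 6 / e ^+ 4 * y).
Proof. by move=> e0; field. Qed.

Lemma noisy_rate {F : fieldType} (l k e x y : F) : e != 0 ->
  k ^+ 3 * (l * k ^+ 3 / e ^+ 2) * (x * (l ^+ 2 * k ^+ 6 / e ^+ 4)) * y =
  x * (l ^+ 3 * k ^+ 12 / e ^+ 6 * y).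
Proof. by move=> e0; field. Qed.

(** * Stationarity and oracle complexity for the chosen parameters *)

Section ChosenParameters.
Context {R : realType} {dF dG dW : measure_display}.
Context {Xf : measurableType dF} {Xg : measurableType dG} {W : measurableType dW}.
Context {Qf : probability Xf R} {Qg : probability Xg R} {P : probability W R}.
Context {xif : f_slot -> W -> Xf} {xig : g_slot -> W -> Xg}.
Hypothesis hiid : iid_samples P Qf Qg xif xig.
Context {dx dy : nat} {f g : 'rV[R]_(dx + dy) -> R}.
Context {Gf : 'rV[R]_(dx + dy) -> Xf -> 'rV[R]_(dx + dy)}.
Context {Gg : 'rV[R]_(dx + dy) -> Xg -> 'rV[R]_(dx + dy)}.
Context {sigmaf sigmag : R}.
Hypothesis hGf : unbiased_oracle Qf Gf f sigmaf.
Hypothesis hGg : unbiased_oracle Qg Gg g sigmag.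
Context {mu Cf Lf Lg rhog : R}.
Hypothesis hdx : (0 < dx)%N.
Hypothesis hdy : (0 < dy)%N.
Hypothesis hmu : 0 < mu.
Hypothesis hg_sc : strongly_convex_in_y mu g.
Hypothesis hg_grad : lipschitz_grad Lg g.
Hypothesis hg_hess : lipschitz_hess rhog g.
Hypothesis hf_lip : lipschitz_in_y Cf f.
Hypothesis hf_grad : lipschitz_grad Lf f.
Context {x0 : 'rV[R]_dx} {y0 : 'rV[R]_dy} {Delta R0 phi_inf eps : R}.
Hypothesis hDelta : 0 < Delta.
Hypothesis hR0 : 0 < R0.
Hypothesis hphi : forall x, phi_inf <= hyperobj f g x.
Hypothesis DeltaE : Delta = hyperobj f g x0 - phi_inf.
Hypothesis R0E : R0 = enorm (y0 - ystar g x0) ^+ 2.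
Local Notation ell := (Num.max Cf (Num.max Lf (Num.max Lg rhog))).
Local Notation kappa := (ell / mu).
Hypothesis heps : 0 < eps.
Hypothesis heps1 : eps <= 1 / 2.
Hypothesis heps2 : 2 * eps <= ell.

Local Notation p := (f2bsa_choice choice_consts Cf Lf Lg rhog mu sigmaf sigmag Delta R0 eps).
Local Notation run := (@run _ _ _ _ Xf Xg W xif xig dx dy Gf Gg p x0 y0).
Local Notation run_x := (@run_x _ _ _ _ Xf Xg W xif xig dx dy Gf Gg p x0 y0).
Local Notation run_delta := (@run_delta _ _ _ _ Xf Xg W xif xig dx dy Gf Gg p x0 y0).
Local Notation run_K := (@run_K _ _ _ _ Xf Xg W xif xig dx dy Gf Gg p x0 y0).
Local Notation CT := (32 * Delta + 1).
Local Notation N := (ell * kappa / eps).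
Local Notation a := (256 * (lam p * ell / eps) ^+ 2).
Local Notation Bi := ((B_in p)%:R : R).
Local Notation Bo := ((B_out p)%:R : R).

Let hmuLg : mu <= Lg. Proof. exact: Lg_ge_mu hdy hg_sc hg_grad. Qed.
Let hLf0 : 0 <= Lf. Proof. exact: Lf_ge0 hdx hf_grad. Qed.
Let hLf : Lf <= ell. Proof. by have [] := @ell_ge R Cf Lf Lg rhog. Qed.
Let hLg : Lg <= ell. Proof. by have [] := @ell_ge R Cf Lf Lg rhog. Qed.
Let hCf : Cf <= ell. Proof. by have [] := @ell_ge R Cf Lf Lg rhog. Qed.
Let l0 : 0 < ell. Proof. exact: ell_gt0 hdy hmu hg_sc hg_grad. Qed.
Let k0 : 0 < kappa. Proof. exact: divr_gt0. Qed.
Let Lg0 : 0 < Lg. Proof. exact: lt_le_trans hmuLg. Qed.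

Let lamP := lambda_bounds hmu hmuLg hLg hLf0 hLf hDelta hR0 heps heps1 heps2.
Let hL : 0 < lam p. Proof. by have [] := lamP. Qed.
Let hL1 : 16 * kappa <= lam p * R0. Proof. by have [] := lamP. Qed.
Let hL2 : 16 * (ell * kappa ^+ 3) <= lam p * eps. Proof. by have [] := lamP. Qed.
Let hL3 : lam p * eps <= 16 * (1 + R0^-1 + Delta^-1) * (ell * kappa ^+ 3).
Proof. by have [] := lamP. Qed.

Let var_ge0 : 0 <= 16 * ((sigmaf ^+ 2 + lam p ^+ 2 * sigmag ^+ 2) / eps ^+ 2).
Proof.
by rewrite mulr_ge0// divr_ge0 ?sqr_ge0// addr_ge0 ?sqr_ge0// mulr_ge0 ?sqr_ge0.
Qed.

Let hBo1 : 1 <= Bo. Proof. exact: batch_size_ge1. Qed.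
Let hBo : 16 * ((sigmaf ^+ 2 + lam p ^+ 2 * sigmag ^+ 2) / eps ^+ 2) <= Bo.
Proof. exact: batch_size_ge. Qed.
Let hBo' : Bo <= 16 * ((sigmaf ^+ 2 + lam p ^+ 2 * sigmag ^+ 2) / eps ^+ 2) + 1.
Proof. exact: batch_size_le. Qed.

Let Bi_ge0 : 0 <= 16 * ((Lf ^+ 2 + lam p ^+ 2 * Lg ^+ 2) / (lam p ^+ 2 * mu ^+ 2) * Bo).
Proof.
by rewrite mulr_ge0// mulr_ge0// divr_ge0 ?addr_ge0 ?sqr_ge0// mulr_ge0 ?sqr_ge0.
Qed.

Let hBi : 16 * ((Lf ^+ 2 + lam p ^+ 2 * Lg ^+ 2) / (lam p ^+ 2 * mu ^+ 2) * Bo) <= Bi.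
Proof. exact: batch_size_ge. Qed.
Let hBi' : Bi <= 16 * ((Lf ^+ 2 + lam p ^+ 2 * Lg ^+ 2) / (lam p ^+ 2 * mu ^+ 2) * Bo) + 1.
Proof. exact: batch_size_le. Qed.

Let a0 : 0 < a. Proof.
by apply: mulr_gt0; [rewrite ltr0n|apply: exprn_gt0; apply: divr_gt0; [exact: mulr_gt0|]].
Qed.

Let hlam_mu : Lf / lam p <= mu / 2.
Proof.
exact: (lambda_Lf hmu hmuLg hLg hLf0 hLf hDelta hR0 heps heps1 heps2 hL hL2).
Qed.

Local Notation ylam := (ystar (@penalty _ _ _ f g (lam p))).

Let hinit_y : enorm (y0 - ylam x0) ^+ 2 <= delta0 p.
Proof.
have -> : y0 - ylam x0 = (y0 - ystar g x0) + (ystar g x0 - ylam x0) by rewrite addrA subrK.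
apply: le_trans (enormD_sqr_le _ _) _; rewrite -R0E enormB.
apply: le_trans (init_le hmu hmuLg hLg hLf0 hLf hDelta hR0 heps heps1 heps2 hL hL1 hL2).
rewrite lerD2l ler_pM2l//.
have h := ylam_ystar hdy hmu hg_sc hg_grad hf_lip hf_grad hL hlam_mu x0.
have h' : enorm (ylam x0 - ystar g x0) <= kappa / lam p.
  apply: le_trans h _; rewrite -mulrA -invfM (mulrC mu).
  by apply: ler_wpM2r hCf; rewrite invr_ge0 mulr_ge0 ?ltW.
apply: lerXn2r h'; rewrite nnegrE//.
by rewrite divr_ge0 ?(ltW k0) ?(ltW hL).
Qed.

Let hinit_z : enorm (y0 - ystar g x0) ^+ 2 <= delta0 p.
Proof. by rewrite -R0E /= ler_peMl ?ler1n// ltW. Qed.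

Let hdelta0 : 0 <= delta0 p. Proof. exact: le_trans (sqr_ge0 _) hinit_z. Qed.

Local Notation c2 := (sigmag ^+ 2 / (2 * Lg * Bi)).

Let hc2 : 0 <= c2. Proof. by rewrite divr_ge0 ?sqr_ge0// !mulr_ge0// ltW. Qed.

Let hdelta delta dist : delta_next p delta dist =
  delta / 2 + 34 * Lg ^+ 2 / mu ^+ 2 * dist ^+ 2 + c2.
Proof. by []. Qed.

Let heta : 0 < eta_x p. Proof. by rewrite divr_gt0// mulr_gt0// exprn_gt0. Qed.

Let heta_le : 8 * (ell * kappa ^+ 3) * eta_x p <= 1.
Proof.
rewrite /=; move: (ell * kappa ^+ 3) (mulr_gt0 l0 (exprn_gt0 3 k0)) => b b0.
by rewrite le_eqVlt; apply/orP; left; apply/eqP; field; rewrite gt_eqF.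
Qed.

Let hK k : measurable [set delta | inner_steps p delta = k].
Proof. exact: measurable_inner_steps. Qed.

Let hBin : (0 < B_in p)%N. Proof. exact: batch_size_gt0. Qed.
Let hBout : (0 < B_out p)%N. Proof. exact: batch_size_gt0. Qed.

Let hsteps delta : 0 <= delta ->
  (1 - mu / (4 * Lg)) ^+ inner_steps p delta <= 1 / 4 /\
  (1 - mu / (4 * Lg)) ^+ inner_steps p delta * delta <= a^-1.
Proof. exact: inner_steps_contract. Qed.

Let ia0 : 0 <= a^-1. Proof. by rewrite invr_ge0 ltW. Qed.

Local Notation gn := (@grad_noise _ sigmaf sigmag mu Cf Lf Lg rhog p a^-1).

Let hgn : gn <= eps ^+ 2 / 2.
Proof.
exact: (grad_noise_le hmu hmuLg hLg hLf0 hLf hDelta hR0 heps heps1 heps2 hL hL2 hBo1 hBo hBi).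
Qed.

Let hgn0 : 0 <= gn.
Proof.
have S0 : 0 <= sigmaf ^+ 2 + lam p ^+ 2 * sigmag ^+ 2.
  by apply: addr_ge0; [exact: sqr_ge0|rewrite mulr_ge0 ?sqr_ge0].
have S0' : 0 <= sigmaf ^+ 2 + 2 * (lam p ^+ 2 * sigmag ^+ 2).
  by apply: addr_ge0; [exact: sqr_ge0|rewrite mulr_ge0// mulr_ge0 ?sqr_ge0].
rewrite /grad_noise /noise_out /noise_in; apply: addr_ge0; last by rewrite divr_ge0.
apply: addr_ge0; last by rewrite mulr_ge0// sqr_ge0.
apply: mulr_ge0; first by rewrite mulr_ge0// sqr_ge0.
apply: addr_ge0 => //; apply: divr_ge0; last by rewrite divr_ge0 ?ltW// mulr_gt0.
by apply: divr_ge0 => //; rewrite mulr_ge0 ?sqr_ge0.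
Qed.

Local Notation T := (nat_ceil (CT * ell * kappa ^+ 3 / eps ^+ 2)).

Let CT0 : 0 < CT. Proof. by rewrite addr_gt0// mulr_gt0. Qed.

Let T'0 : 0 < CT * ell * kappa ^+ 3 / eps ^+ 2.
Proof. by rewrite divr_gt0 ?exprn_gt0// mulr_gt0 ?exprn_gt0// mulr_gt0. Qed.

Let T0 : (0 : R) < T%:R. Proof. exact: lt_le_trans T'0 (nat_ceil_ge (ltW T'0)). Qed.

Let T_le : T%:R <= CT * (ell * kappa ^+ 3 / eps ^+ 2) + 1.
Proof. by apply: le_trans (nat_ceil_le (ltW T'0)) _; rewrite !mulrA. Qed.

(** The mean of the squared gradient norms is at most [eps ^+ 2]; the weighted mean inequality then
    gives [eps / 2 + eps / 2]. *)
Lemma mean_grad_le :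
  ((T%:R^-1)%R%:E * \sum_(t < T) \int[P]_w (enorm (grad (hyperobj f g) (run_x t w)))%:E
    <= eps%:E)%E.
Proof.
have hG := sum_grad_sqr hiid hGf hGg hdx hdy hmu hg_sc hg_grad hg_hess hf_lip hf_grad hL
  hlam_mu hBin hBout erefl erefl hdelta hK ia0 hc2 hdelta0 hinit_y hinit_z hsteps heta
  heta_le hphi T.
have mh t := mvec_hyper hiid hGf hGg hdx hdy hmu hg_sc hg_grad hg_hess hf_lip hf_grad hL
  hlam_mu hBin hBout hdelta hK t (x0 := x0) (y0 := y0).
pose X t w := hypergrad (f := f) (g := g) (run_x t w).
have E t w : grad (hyperobj f g) (run_x t w) = X t w.
  exact: (grad_hyperobj hdy hmu hg_sc hg_grad hg_hess hf_lip hf_grad).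
under eq_bigr do under eq_integral do rewrite E.
rewrite -(lee_pmul2l (x := T%:R%:E))// ?lte_fin// muleA -EFinM mulfV ?gt_eqF// mul1e.
have c0 : 0 <= (2 * eps)^-1 by rewrite invr_ge0 mulr_ge0// ltW.
have s0 t : (0 <= \int[P]_w (enorm (X t w) ^+ 2)%:E)%E.
  by apply: integral_ge0 => w _; rewrite lee_fin sqr_ge0.
apply: (@le_trans _ _ (\sum_(t < T)
    ((2 * eps)^-1%:E * \int[P]_w (enorm (X t w) ^+ 2)%:E + (eps / 2)%:E))%E).
  by apply: lee_sum => t _; apply: Ex_enorm_le => //; exact: mh.
have -> : (\sum_(t < T) ((2 * eps)^-1%:E * \int[P]_w (enorm (X t w) ^+ 2)%:E + (eps / 2)%:E) =
    (2 * eps)^-1%:E * \sum_(t < T) \int[P]_w (enorm (X t w) ^+ 2)%:E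
    + (T%:R * (eps / 2))%:E)%E.
  rewrite big_split/= -ge0_sume_distrr; last by move=> t _; exact: s0.
  by rewrite sumEFin sumr_const card_ord -(mulr_natl (eps / 2)).
have := lee_wpmul2l (x := (2 * eps)^-1%:E) c0 hG => h.
apply: le_trans (leeD2r _ h) _.
rewrite -EFinM -EFinD -EFinM lee_fin -DeltaE.
have TT : CT * ell * kappa ^+ 3 / eps ^+ 2 <= T%:R := nat_ceil_ge (ltW T'0).
have e20 : 0 < eps ^+ 2 by rewrite exprn_gt0.
have h1 : 2 * Delta / eta_x p + T%:R * gn <= T%:R * eps ^+ 2.
  have i1 : 2 * Delta / eta_x p = 16 * Delta * (ell * kappa ^+ 3).
    rewrite /=; move: (ell * kappa ^+ 3) (mulr_gt0 l0 (exprn_gt0 3 k0)) => b b0.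
    by field; rewrite gt_eqF.
  have i2 : T%:R * gn <= T%:R * (eps ^+ 2 / 2) by apply: ler_wpM2l hgn.
  (* The 32 in [CT] is twice the 16 in [2 * Delta / eta_x]: the initial gap uses half of
     [T * eps ^+ 2] and the gradient noise the other half. *)
  have i3 : 32 * Delta * (ell * kappa ^+ 3) <= T%:R * eps ^+ 2.
    have b0 := mulr_gt0 l0 (exprn_gt0 3 k0).
    move: TT; rewrite ler_pdivrMr// => TT; apply: le_trans TT; rewrite -[leRHS]mulrA.
    by apply: ler_wpM2r; [exact: ltW|rewrite lerDl].
  by rewrite i1; move: i2 i3; move: (T%:R * gn) => u; lra.
apply: (@le_trans _ _ ((2 * eps)^-1 * (T%:R * eps ^+ 2) + T%:R * (eps / 2))).
  by rewrite lerD2r ler_wpM2l.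
rewrite le_eqVlt; apply/orP; left; apply/eqP.
by move: (T%:R : R) => n; field; rewrite gt_eqF.
Qed.

Lemma run_calls t w : (st_calls (run t w))%:R =
  \sum_(i < t) ((run_K i w)%:R * (3 * Bi) + 3 * Bo) :> R.
Proof.
elim: t => [|t IH]; first by rewrite big_ord0.
rewrite big_ord_recr/= -IH !natrD natrM !natrD -/(run_K t w).
by rewrite /run_K /run_delta /run; ring.
Qed.

Local Notation Clam := (1 + R0^-1 + Delta^-1).
Definition calls_const : R := 66 * ((CT + 1) * 98 +
  16 * ((256 * Clam) ^+ 2 * (6 * R0 + 34 * Delta + 3 * (CT + 1)))) + 6 * (CT + 1).

(** The count is bounded pathwise by an affine function of the sum of delta, with slope [c] and
    intercept [b]; only this sum is then averaged. *)
Lemma mean_calls_le :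
  (\int[P]_w ((st_calls (run T w))%:R : R)%:E <=
    (calls_const * (kappa ^+ 3 * (ell * kappa ^+ 3 / eps ^+ 2) * Bo * ln N))%:E)%E.
Proof.
have hD := sum_delta hiid hGf hGg hdx hdy hmu hg_sc hg_grad hg_hess hf_lip hf_grad hL
  hlam_mu hBin hBout erefl erefl hdelta hK ia0 hc2 hdelta0 hinit_y hinit_z hsteps heta
  heta_le hphi T.
have D0 t w : 0 <= run_delta t w by exact: (run_delta_ge0 hdelta hc2 hdelta0).
have mD t : measurable_fun setT (run_delta t).
  exact: (measurable_run_delta hiid hGf hGg hdx hdy hmu hL hlam_mu hBin hBout hdelta hK).
have hKm t k : measurable [set w | run_K t w = k].
  exact: (measurable_K hiid hGf hGg hdx hdy hmu hL hlam_mu hBin hBout hdelta hK).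
have mC : nnmeas (fun w => (st_calls (run T w))%:R : R).
  split=> //; rewrite (funext (run_calls T)); apply: measurable_rsum => t.
  apply: measurable_funD => //; apply: measurable_funM => //.
  exact: (measurable_random_index (K := run_K t) (h := fun k _ => k%:R : R) (hKm t)).
pose c := 3 * Bi * (8 * (Lg / mu) * (a / N ^+ 6)).
pose b := 3 * Bi * (T%:R * (1 + 8 * (Lg / mu) * (6 * ln N + 3))) + 3 * (T%:R * Bo).
have N1 : 1 <= N.
  rewrite ler_pdivlMr// mul1r; apply: (@le_trans _ _ ell).
    by apply: le_trans heps2; rewrite ler_peMl ?ler1n// ltW.
  by rewrite ler_peMr ?(ltW l0)//; exact: kappa_ge1 hdy hmu hg_sc hg_grad.
have Bi0 : 0 <= 3 * Bi by rewrite mulr_ge0.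
have r0 : 0 <= 8 * (Lg / mu) by rewrite mulr_ge0// divr_ge0 ?ltW.
have rho0 : 0 <= a / N ^+ 6.
  by apply: divr_ge0; [exact: ltW|apply: exprn_ge0; exact: le_trans ler01 N1].
have c0 : 0 <= c by apply: mulr_ge0 Bi0 _; exact: mulr_ge0.
have lnN0 : 0 <= ln N by exact: ln_ge0.
have b0 : 0 <= b.
  apply: addr_ge0; last by rewrite !mulr_ge0// ltW.
  apply: mulr_ge0 => //; apply: mulr_ge0 => //; apply: addr_ge0 => //.
  by apply: mulr_ge0 => //; rewrite addr_ge0// mulr_ge0.
have hC w : (st_calls (run T w))%:R <= c * (\sum_(t < T) run_delta t w) + b.
  have -> : c * (\sum_(t < T) run_delta t w) + b = \sum_(t < T)
      ((1 + 8 * (Lg / mu) * (6 * ln N + 3 + a / N ^+ 6 * run_delta t w)) * (3 * Bi) + 3 * Bo).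
    rewrite [RHS](eq_bigr (fun t : 'I_T => c * run_delta t w +
      (3 * Bi * (1 + 8 * (Lg / mu) * (6 * ln N + 3)) + 3 * Bo))); last first.
      by move=> t _; rewrite /c; ring.
    rewrite big_split/= -mulr_sumr sumr_const card_ord; congr (_ + _).
    rewrite -[RHS]mulr_natl /b; exact: calls_regroup_cst.
  rewrite run_calls; apply: ler_sum => t _; rewrite lerD2r; apply: ler_wpM2r => //.
  exact: (inner_steps_le hmu hmuLg a0 N1 (D0 t w)).
have nD t : nnmeas (run_delta t) by split.
have nS := nnmeas_sum T nD.
apply: le_trans (Ex_le (P := P) mC _ hC) _.
  by apply: measurable_affine; exact: nS.1.
rewrite (Ex_affine nS c0 b0).
apply: le_trans (leeD2r _ (lee_wpmul2l (x := c%:E) c0 hD)) _.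
rewrite -EFinM -EFinD lee_fin -DeltaE.
have hdr := drift_noise_le hmu hmuLg hLg hLf0 hLf hDelta hR0 heps heps1 heps2 hL hL2 hBo1
  hBo hBi.
have hB2 := Bi_le hmu hmuLg hLg hLf0 hLf hDelta hR0 heps heps1 heps2 hL hL2 hBo1 hBi'.
have := calls_le hmu hmuLg hLg hLf0 hLf hDelta hR0 heps heps1 heps2 hL hL3 hBo1 hBi
  (ltW T0) T_le hgn0 hgn hc2 hdr hB2.
apply: le_trans; rewrite le_eqVlt; apply/orP; left; apply/eqP.
exact: calls_regroup.
Qed.

(** One constant for both regimes: when [sigmag = 0] the last summand vanishes and the factor of
    [Bo_le_det] remains. *)
Definition oracle_const : R :=
  calls_const * (16 * sigmaf ^+ 2 + 1 + 16 * (16 * Clam) ^+ 2 * sigmag ^+ 2).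

Let Clam_gt0 : 0 < Clam. Proof. by rewrite addr_gt0 ?invr_gt0// addr_gt0 ?invr_gt0. Qed.

Lemma calls_const_gt0 : 0 < calls_const.
Proof.
have c1 : 0 < CT + 1 by rewrite addr_gt0.
have H0 : 0 < (256 * Clam) ^+ 2.
  by apply: exprn_gt0; apply: mulr_gt0; [rewrite ltr0n|exact: Clam_gt0].
have H1 : 0 < 6 * R0 + 34 * Delta + 3 * (CT + 1).
  by move: (CT + 1) c1 hR0 hDelta => v; lra.
have := mulr_gt0 H0 H1; rewrite /calls_const; move: (_ ^+ 2 * _) => u u0.
by move: (CT + 1) c1 => v v0; lra.
Qed.

Let noise_const_ge0 : 0 <= 16 * (16 * Clam) ^+ 2 * sigmag ^+ 2.
Proof. by rewrite mulr_ge0 ?sqr_ge0// mulr_ge0// sqr_ge0. Qed.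

Lemma oracle_const_gt0 : 0 < oracle_const.
Proof.
apply: mulr_gt0; first exact: calls_const_gt0.
by have := noise_const_ge0; have := sqr_ge0 sigmaf; lra.
Qed.

Let rate_le x : Bo <= x ->
  (\int[P]_w ((st_calls (run T w))%:R : R)%:E <=
    (calls_const * (kappa ^+ 3 * (ell * kappa ^+ 3 / eps ^+ 2) * x * ln N))%:E)%E.
Proof.
move=> h; apply: le_trans mean_calls_le _; rewrite lee_fin.
have k1 : 1 <= kappa by exact: kappa_ge1 hdy hmu hg_sc hg_grad.
have N1 : 1 <= N.
  rewrite ler_pdivlMr// mul1r; apply: (@le_trans _ _ ell).
    by apply: le_trans heps2; rewrite ler_peMl ?ler1n// ltW.
  by rewrite ler_peMr ?(ltW l0).
apply: ler_wpM2l; first exact: ltW calls_const_gt0.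
apply: ler_wpM2r; first exact: ln_ge0.
apply: ler_wpM2l => //; apply: mulr_ge0; first by rewrite exprn_ge0// ltW.
by rewrite divr_ge0 ?sqr_ge0// mulr_ge0 ?exprn_ge0 ?ltW.
Qed.

Lemma mean_calls_det : sigmag = 0 ->
  (\int[P]_w ((st_calls (run T w))%:R : R)%:E <=
    (oracle_const * (ell * kappa ^+ 6 / eps ^+ 4 * ln N))%:E)%E.
Proof.
move=> sg0; have h := Bo_le_det hmu hmuLg hLg hLf0 hLf hDelta hR0 heps heps1 heps2 sg0 hBo'.
apply: le_trans (rate_le h) _.
rewrite det_rate ?gt_eqF// lee_fin /oracle_const sg0 expr0n/= mulr0 addr0.
by rewrite -[leRHS]mulrA.
Qed.

Lemma mean_calls_noisy :
  (\int[P]_w ((st_calls (run T w))%:R : R)%:E <=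
    (oracle_const * (ell ^+ 3 * kappa ^+ 12 / eps ^+ 6 * ln N))%:E)%E.
Proof.
have h := Bo_le_noisy hmu hmuLg hLg hLf0 hLf hDelta hR0 heps heps1 heps2 hL hL3 hBo'.
apply: le_trans (rate_le h) _.
by rewrite noisy_rate ?gt_eqF// lee_fin /oracle_const -[leRHS]mulrA.
Qed.

End ChosenParameters.

Theorem theorem4p2 (R : realType) :
  (* the constants in the parameter choices are absolute *)
  exists2 c : @hidden_consts R, hidden_consts_pos c &
  (* those in the bounds on T and on the oracle calls depend only on
     Delta, R0, sigma_f, sigma_g *)
  forall Delta R0 sigmaf sigmag : R,
    0 < Delta -> 0 < R0 -> 0 <= sigmaf -> 0 <= sigmag ->
  exists CT CN : R, [/\ 0 < CT, 0 < CN &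
  forall (dx dy : nat) (hdx : (0 < dx)%N) (hdy : (0 < dy)%N)
    (f g : 'rV[R]_(dx + dy) -> R)
    (mu Cf Lf Lg rhog : R)
    (hmu : 0 < mu)
    (hg_sc : strongly_convex_in_y mu g)
    (hg_grad : lipschitz_grad Lg g)
    (hg_hess : lipschitz_hess rhog g)
    (hf_lip : lipschitz_in_y Cf f)
    (hf_grad : lipschitz_grad Lf f)
    (hf_C2 : twice_continuously_differentiable f)
    (hphi_lb : has_lbound (range (hyperobj f g)))
    (x0 : 'rV[R]_dx) (y0 : 'rV[R]_dy)
    (hDelta : Delta = hyperobj f g x0 - inf (range (hyperobj f g)))
    (hR0 : R0 = enorm (y0 - ystar g x0) ^+ 2)
    (dF dG dW : measure_display)
    (Xf : measurableType dF) (Xg : measurableType dG) (W : measurableType dW)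
    (Qf : probability Xf R) (Qg : probability Xg R) (P : probability W R)
    (Gf : 'rV[R]_(dx + dy) -> Xf -> 'rV[R]_(dx + dy))
    (Gg : 'rV[R]_(dx + dy) -> Xg -> 'rV[R]_(dx + dy))
    (hGf : unbiased_oracle Qf Gf f sigmaf)
    (hGg : unbiased_oracle Qg Gg g sigmag)
    (xif : f_slot -> W -> Xf) (xig : g_slot -> W -> Xg)
    (hiid : iid_samples P Qf Qg xif xig)
    (eps : R),
  let ell := Num.max Cf (Num.max Lf (Num.max Lg rhog)) in
  let kappa := ell / mu in
  (* the small-eps regime of the O-notation *)
  0 < eps -> eps <= Num.min 1 ell / 2 ->
  let p := f2bsa_choice c Cf Lf Lg rhog mu sigmaf sigmag Delta R0 eps in
  let run := fun (t : nat) (w : W) =>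
    f2bsa Gf Gg p (fun a => xif a w) (fun b => xig b w) x0 y0 t in
  let T := nat_ceil (CT * ell * kappa ^+ 3 / eps ^+ 2) in
  let calls := fun w : W => (st_calls (run T w))%:R : R in
  [/\ (* the output is uniformly distributed over the iterates x_0, .., x_{T-1} *)
      ((T%:R^-1)%R%:E * \sum_(t < T)
         'E_P[fun w => enorm (grad (hyperobj f g) (st_x (run t w)))]
         <= eps%:E)%E,
      0 < sigmaf -> sigmag = 0 ->
      ('E_P[calls] <=
        (CN * (ell * kappa ^+ 6 / eps ^+ 4 * ln (ell * kappa / eps)))%:E)%E &
      0 < sigmaf -> 0 < sigmag ->
      ('E_P[calls] <=
        (CN * (ell ^+ 3 * kappa ^+ 12 / eps ^+ 6 * ln (ell * kappa / eps)))%:E)%E]].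
Proof.
exists choice_consts; first by split; split; rewrite /= ?divr_gt0 ?ltr0n.
move=> Delta R0 sigmaf sigmag hDelta0 hR00 hsf hsg.
exists (32 * Delta + 1), (@oracle_const R sigmaf sigmag Delta R0); split.
- by rewrite addr_gt0// mulr_gt0.
- exact: (oracle_const_gt0 hDelta0 hR00).
move=> dx dy hdx hdy f g mu Cf Lf Lg rhog hmu hg_sc hg_grad hg_hess hf_lip hf_grad hf_C2
  hphi_lb x0 y0 hDelta hR0 dF dG dW Xf Xg W Qf Qg P Gf Gg hGf hGg xif xig hiid eps
  ell kappa heps hepsm p run T calls.
(* The regime of small [eps] is used in two forms; together with [1 <= kappa] the second makes
   [ell * kappa / eps] at least 2, so the logarithm is bounded away from zero. *)
have heps1 : eps <= 1 / 2.
  by apply: le_trans hepsm _; rewrite ler_pM2r// ge_min lexx.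
have heps2 : 2 * eps <= ell.
  have : eps <= ell / 2 by apply: le_trans hepsm _; rewrite ler_pM2r// ge_min lexx orbT.
  by rewrite ler_pdivlMr// mulrC.
have hphi x : inf (range (hyperobj f g)) <= hyperobj f g x.
  by apply: ge_inf => //; exists x.
have EE (X : W -> R) : ('E_P[X] = \int[P]_w (X w)%:E)%E by rewrite unlock.
split.
- have h := mean_grad_le hiid hGf hGg hdx hdy hmu hg_sc hg_grad hg_hess hf_lip hf_grad
    hDelta0 hR00 hphi hDelta hR0 heps heps1 heps2.
  by under eq_bigr do rewrite EE; exact: h.
- move=> _ sg0.
  have h := mean_calls_det hiid hGf hGg hdx hdy hmu hg_sc hg_grad hg_hess hf_lip hf_grad
    hDelta0 hR00 hphi hDelta hR0 heps heps1 heps2 sg0.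
  by rewrite EE; exact: h.
- move=> _ _.
  have h := mean_calls_noisy hiid hGf hGg hdx hdy hmu hg_sc hg_grad hg_hess hf_lip hf_grad
    hDelta0 hR00 hphi hDelta hR0 heps heps1 heps2.
  by rewrite EE; exact: h.
Qed.
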